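(* Let $(M^{2n+1},\xi)$ be a closed contact manifold, and let $\alpha$ be any contact form on $M$ with $\ker\alpha=\xi$. Then the orbit $\mathcal{O}(\alpha)$ is not maximal.
   Context: A contact structure $\xi$ on a smooth manifold $M$ of dimension $2n+1$ is given as $\xi=\ker\alpha$ for a global contact form $\alpha$ (a $1$-form with $\alpha\wedge(d\alpha)^n$ nowhere zero), and is identified with the oriented conformal class $[\alpha]=\{e^f\alpha : f\in C^\infty(M)\}$. Let $\mathrm{Diff}_+(M,\xi)$ be the group of diffeomorphisms $\varphi$ of $M$ with $\varphi^*\alpha=e^f\alpha$ for some $f\in C^\infty(M)$. The orbit of $\alpha$ is $\mathcal{O}(\alpha)=\{\varphi^*\alpha : \varphi\in\mathrm{Diff}_+(M,\xi)\}$, identified with the set $C_+^\infty(M,\alpha)=\{f\in C^\infty(M) : \exists\,\varphi\in\mathrm{Diff}_+(M,\xi),\ \varphi^*\alpha=e^f\alpha\}$. When $M$ is closed (compact without boundary), the change of variables formula shows that every $f\in C_+^\infty(M,\alpha)$ satisfies the average value constraint $\int_M e^{(n+1)f}\,\alpha\wedge(d\alpha)^n=\int_M\alpha\wedge(d\alpha)^n$, and $\mathcal{O}(\alpha)$ is called maximal if $C_+^\infty(M,\alpha)$ consists of all smooth functions on $M$ satisfying this constraint.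
   Formalization: The formal theorem assumes n ≥ 1 (dimension at least 3) and M nonempty; for n = 0 the claim fails on the circle, where every smooth f satisfying the average value constraint comes from a diffeomorphism, and for M empty the orbit is trivially maximal. *)

(* Defs.v *)
From HB Require Import structures.
From mathcomp Require Import all_boot all_order all_algebra all_fingroup.
From mathcomp Require Import all_classical all_reals all_analysis.
Set Implicit Arguments.
Unset Strict Implicit.
Unset Printing Implicit Defensive.
Import Order.TTheory GRing.Theory Num.Theory.
Import numFieldNormedType.Exports.
Local Open Scope classical_set_scope.
Local Open Scope ring_scope.

(* Calculus on open subsets of R^m; tangent vectors are rows, covectors are
   columns, so that the value of the covector a at the vector v is v *m a. *)

(* Meant for U open, so that the derivatives at points of U do not depend on
   the values of f outside U. *)
Fixpoint Ck_on (R : realType) (m : nat) (W : normedModType R) (k : nat)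
    (U : set 'rV[R]_m) (f : 'rV[R]_m -> W) : Prop :=
  (forall x, U x -> {for x, continuous f}) /\
  match k with
  | 0 => True
  | k'.+1 => forall l : 'I_m,
      (forall x, U x -> derivable f x (delta_mx 0 l)) /\
      Ck_on k' U (fun x => 'D_(delta_mx 0 l) f x)
  end.

Definition smooth_on (R : realType) (m : nat) (W : normedModType R)
    (U : set 'rV[R]_m) (f : 'rV[R]_m -> W) : Prop :=
  forall k, Ck_on k U f.

(* Lebesgue integral over R^m as an iterated integral; it is only applied
   below to continuous functions with compact support. *)
Fixpoint integral_rV (R : realType) (m : nat) : ('rV[R]_m -> R) -> R :=
  match m with
  | 0 => fun f => f 0
  | m'.+1 => fun f =>
      (\int[@lebesgue_measure R]_(t in [set: R])
         integral_rV (fun x : 'rV[R]_m' =>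
           f (row_mx (const_mx t : 'rV[R]_1) x)))%R
  end.

(* Multilinear forms on V are plain functions of k vectors; multilinearity and
   alternation hold for the forms that are used but are not recorded. *)
Definition kform (R : realType) (V : Type) (k : nat) := ('I_k -> V) -> R.

(* Normalised so that dx_1 /\ ... /\ dx_k is the determinant. *)
Definition wedge (R : realType) (V : Type) (p q : nat)
    (a : kform R V p) (b : kform R V q) : kform R V (p + q) := fun v =>
  (p`! * q`!)%:R^-1 *
  \sum_(s : 'S_(p + q))
    (-1) ^+ (s : bool) * a (fun i => v (s (lshift q i)))
                       * b (fun j => v (s (rshift p j))).

Fixpoint wedge_pow (R : realType) (V : Type) (w : kform R V 2) (n : nat) :
    kform R V n.*2 :=
  match n with
  | 0 => fun _ => 1
  | n'.+1 => wedge w (@wedge_pow R V w n')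
  end.
Arguments wedge_pow {R V} w n _.

Record chart (R : realType) (m : nat) (T : topologicalType) := Chart {
  source : set T;
  target : set 'rV[R]_m;
  to_rV : T -> 'rV[R]_m;
  of_rV : 'rV[R]_m -> T;
  source_open : open source;
  target_open : open target;
  to_rV_target : forall p, source p -> target (to_rV p);
  of_rV_source : forall x, target x -> source (of_rV x);
  to_rVK : forall p, source p -> of_rV (to_rV p) = p;
  of_rVK : forall x, target x -> to_rV (of_rV x) = x;
  to_rV_continuous : forall p, source p -> {for p, continuous to_rV};
  of_rV_continuous : forall x, target x -> {for x, continuous of_rV}
}.

(* The points at which the local expression c' o phi o c^-1 is meaningful. *)
Definition local_dom (R : realType) (m m' : nat) (S T : topologicalType)
    (phi : S -> T) (c : chart R m S) (c' : chart R m' T) : set 'rV[R]_m :=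
  [set x | target c x /\ source c' (phi (of_rV c x))].

Definition local_expr (R : realType) (m m' : nat) (S T : topologicalType)
    (phi : S -> T) (c : chart R m S) (c' : chart R m' T) :
    'rV[R]_m -> 'rV[R]_m' :=
  fun x => to_rV c' (phi (of_rV c x)).

(* Smooth manifolds without boundary. The smooth structure is given by a
   smooth atlas, not required to be maximal. *)
Record smoothManifold (R : realType) (m : nat) := SmoothManifold {
  carrier :> topologicalType;
  atlas : Type;
  chart_of : atlas -> chart R m carrier;
  manifold_hausdorff : hausdorff_space carrier;
  manifold_second_countable : @second_countable carrier;
  atlas_cover : forall p : carrier, exists i, source (chart_of i) p;
  atlas_compatible : forall i j,
    smooth_on (local_dom id (chart_of i) (chart_of j))
              (local_expr id (chart_of i) (chart_of j))
}.

Definition smooth_fun (R : realType) (m : nat) (M : smoothManifold R m)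
    (f : M -> R) : Prop :=
  forall i : atlas M, smooth_on (target (chart_of i)) (f \o of_rV (chart_of i)).

Definition smooth_map (R : realType) (m m' : nat) (M : smoothManifold R m)
    (N : smoothManifold R m') (phi : M -> N) : Prop :=
  continuous phi /\
  forall (i : atlas M) (j : atlas N),
    smooth_on (local_dom phi (chart_of i) (chart_of j))
              (local_expr phi (chart_of i) (chart_of j)).

Definition diffeomorphism (R : realType) (m : nat) (M : smoothManifold R m)
    (phi : M -> M) : Prop :=
  smooth_map phi /\
  exists psi : M -> M, [/\ smooth_map psi, cancel phi psi & cancel psi phi].

(* phi^*a read in the charts c and c', where a is the local coefficient of a
   1-form in c'. *)
Definition local_pullback (R : realType) (m m' : nat) (S T : topologicalType)
    (phi : S -> T) (c : chart R m S) (c' : chart R m' T)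
    (a : 'rV[R]_m' -> 'cV[R]_m') : 'rV[R]_m -> 'cV[R]_m :=
  fun x => 'J (local_expr phi c c') x *m a (local_expr phi c c' x).

(* A smooth 1-form, as a compatible family of smooth local coefficients;
   [form_coef i] is only meaningful on the target of the chart i. *)
Record oneForm (R : realType) (m : nat) (M : smoothManifold R m) := OneForm {
  form_coef :> atlas M -> 'rV[R]_m -> 'cV[R]_m;
  form_smooth : forall i, smooth_on (target (chart_of i)) (form_coef i);
  form_compatible : forall i j x,
    local_dom id (chart_of i) (chart_of j) x ->
    form_coef i x = local_pullback id (chart_of i) (chart_of j) (form_coef j) x
}.

(* In the chart i, at x: the form itself and its exterior derivative,
   d a (v, w) = D_v (a w) - D_w (a v) for constant v and w. *)
Definition form_at (R : realType) (m : nat) (M : smoothManifold R m)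
    (alpha : oneForm M) (i : atlas M) (x : 'rV[R]_m) : kform R 'rV[R]_m 1 :=
  fun v => (v ord0 *m alpha i x) 0 0.

Definition dform_at (R : realType) (m : nat) (M : smoothManifold R m)
    (alpha : oneForm M) (i : atlas M) (x : 'rV[R]_m) : kform R 'rV[R]_m 2 :=
  fun v => (v ord_max *m 'D_(v ord0) (alpha i) x
            - v ord0 *m 'D_(v ord_max) (alpha i) x) 0 0.

(* The coefficient of alpha /\ (d alpha)^n with respect to dx_0 /\ ... /\ dx_2n
   in the chart i. *)
Definition contact_volume (R : realType) (n : nat)
    (M : smoothManifold R n.*2.+1) (alpha : oneForm M) (i : atlas M)
    (x : 'rV[R]_(n.*2.+1)) : R :=
  wedge (form_at alpha i x) (wedge_pow (dform_at alpha i x) n)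
    (fun l : 'I_(n.*2.+1) => delta_mx 0 l).

Definition contact_form (R : realType) (n : nat)
    (M : smoothManifold R n.*2.+1) (alpha : oneForm M) : Prop :=
  forall i x, target (chart_of i) x -> contact_volume alpha i x != 0.

(* phi^* alpha = e^f alpha *)
Definition pullback_eq (R : realType) (m : nat) (M : smoothManifold R m)
    (phi : M -> M) (alpha : oneForm M) (f : M -> R) : Prop :=
  forall i j x, local_dom phi (chart_of i) (chart_of j) x ->
    local_pullback phi (chart_of i) (chart_of j) (alpha j) x =
    expR (f (of_rV (chart_of i) x)) *: alpha i x.

Definition Diff_plus (R : realType) (m : nat) (M : smoothManifold R m)
    (alpha : oneForm M) : set (M -> M) :=
  [set phi | diffeomorphism phi /\
             exists f, smooth_fun f /\ pullback_eq phi alpha f].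

Definition C_plus (R : realType) (m : nat) (M : smoothManifold R m)
    (alpha : oneForm M) : set (M -> R) :=
  [set f | smooth_fun f /\
           exists phi, Diff_plus alpha phi /\ pullback_eq phi alpha f].

Definition partition_of_unity (R : realType) (m : nat) (M : smoothManifold R m)
    (N : nat) (i : 'I_N -> atlas M) (rho : 'I_N -> M -> R) : Prop :=
  [/\ forall k, smooth_fun (rho k),
      forall k p, 0 <= rho k p,
      forall k, closure [set p | rho k p != 0] `<=` source (chart_of (i k))
    & forall p, \sum_(k < N) rho k p = 1].

(* v is the integral over M of h alpha /\ (d alpha)^n, for M closed and
   oriented by the volume form alpha /\ (d alpha)^n itself: in a chart that
   reverses this orientation the coefficient changes sign, whence the absolute
   value. On a closed manifold finite partitions of unity exist, and v does not
   depend on the one that is used. *)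
Definition contact_integral (R : realType) (n : nat)
    (M : smoothManifold R n.*2.+1) (alpha : oneForm M) (h : M -> R) (v : R) :
    Prop :=
  exists (N : nat) (i : 'I_N -> atlas M) (rho : 'I_N -> M -> R),
    partition_of_unity i rho /\
    v = \sum_(k < N) integral_rV
          ((fun x => rho k (of_rV (chart_of (i k)) x)
                     * h (of_rV (chart_of (i k)) x)
                     * `|contact_volume alpha (i k) x|)
             \_ (target (chart_of (i k)))).

Definition average_value_constraint (R : realType) (n : nat)
    (M : smoothManifold R n.*2.+1) (alpha : oneForm M) (f : M -> R) : Prop :=
  exists v, contact_integral alpha (fun p => expR (n.+1%:R * f p)) v /\
            contact_integral alpha (fun=> 1) v.

Definition maximal_orbit (R : realType) (n : nat)
    (M : smoothManifold R n.*2.+1) (alpha : oneForm M) : Prop :=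
  C_plus alpha = [set f | smooth_fun f /\ average_value_constraint alpha f].

(* Main.v *)
From HB Require Import structures.
Require Import Defs.
From mathcomp Require Import all_boot all_order all_algebra all_fingroup.
From mathcomp Require Import all_classical all_reals all_analysis.
From mathcomp Require Import ring lra.
Set Implicit Arguments.
Unset Strict Implicit.
Unset Printing Implicit Defensive.
Import Order.TTheory GRing.Theory Num.Theory.
Import numFieldNormedType.Exports.
Local Open Scope classical_set_scope.
Local Open Scope ring_scope.

(** The obstruction is the length of closed Reeb orbits. On a closed manifold every closed
    Reeb orbit of alpha has a period bounded below by a positive constant, since the Reeb
    field is nowhere zero; and if phi^* alpha = e^f alpha, then phi carries the closed Reeb
    orbits of e^f alpha to closed Reeb orbits of alpha with the same period. It is therefore
    enough to find f that satisfies the volume constraint and for which e^f alpha has a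
    closed Reeb orbit of very small period.

    Such an orbit is prescribed inside one chart. Since n > 0, the contact condition gives
    X and Y in the contact hyperplane at a point with d alpha (X, Y) = 1, and a small circle
    in the plane of X and Y, corrected to second order in a transverse direction, is
    positively transverse: alpha is positive on its velocity (loop_estimate). A loop with
    velocity w is a Reeb orbit of e^f alpha, up to parametrisation, as soon as along it
    d f (v) alpha(w) = d alpha (w, v) for all v (jet_reeb). The right-hand side vanishes for
    v = w, so this prescribes a differential that is zero along the loop, and a function l
    with l = 0 on the loop and this differential is easily written down (loop_jet). Then
    f = l + c works for every constant c, and the period is proportional to e^c. Away from
    the loop f is free, and is used to adjust the total volume (exists_conformal_factor); this
    takes a partition of unity (exists_partition_of_unity), and the linearity and positivity
    of the integral.

    Neither the Reeb field nor its flow is constructed: a Reeb orbit is a curve whose velocity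
    is in the kernel of d alpha and on which alpha is positive. That two forms related by a
    diffeomorphism have the same such curves (pullback_reeb) rests on the fact that d
    commutes with pullback (dmat_pullback). The lower bound for periods
    (no_short_reeb_loop) is local: in a chart, a slow loop stays near its starting point
    q, where alpha is close to the constant covector alpha_q, and the corresponding linear
    coordinate increases strictly along the loop, so the loop cannot close up. *)

(** * Differentiability of functions with continuous partial derivatives *)

Section Lines.
Context {R : realType}.

(** Turns directional derivatives on a normed space into derivatives of functions
    of one real variable, where the mean value theorem is available. *)
Lemma is_derive_line (V W : normedModType R) (f : V -> W) (y v : V) (t : R) :
  derivable f (y + t *: v) v ->
  is_derive t 1 (fun s : R => f (y + s *: v)) ('D_v f (y + t *: v)).
Proof.
have E : (fun h => h^-1 *: (((fun s => f (y + s *: v)) \o shift t) (h *: (1 : R))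
      - f (y + t *: v))) =
    (fun h => h^-1 *: ((f \o shift (y + t *: v)) (h *: v) - f (y + t *: v))).
  apply/funext => h; rewrite /=; congr (_ *: (f _ - _)).
  by rewrite [h%:A]mulr1 scalerDl addrCA.
by move=> df; split; rewrite /derivable /derive E.
Qed.

Lemma MVT_line (V : normedModType R) (f : V -> R) (y v : V) (t : R) :
  (forall s : R, `|s| <= `|t| -> derivable f (y + s *: v) v) ->
  exists2 s : R, `|s| <= `|t| & f (y + t *: v) - f y = t * 'D_v f (y + s *: v).
Proof.
move=> df; pose g s := f (y + s *: v).
have dg (s : R) : `|s| <= `|t| -> is_derive s 1 g ('D_v f (y + s *: v)).
  by move=> /df; exact: is_derive_line.
have gE0 : g 0 = f y by rewrite /g scale0r addr0.
have cg (a b : R) : (forall s : R, s \in `[a, b] -> `|s| <= `|t|) ->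
    {within `[a, b], continuous g}.
  move=> ab; apply: derivable_within_continuous => s /ab sab.
  exact: (@ex_derive _ _ _ _ _ _ _ (dg _ sab)).
have [t0|t0|<-] := ltgtP 0 t; last first.
- by exists 0; rewrite ?normr0// scale0r addr0 subrr mul0r.
- have le0 (s : R) : s \in `[t, 0] -> `|s| <= `|t|.
    by rewrite in_itv/= => /andP[ts s0]; rewrite !ler0_norm ?lerN2// ltW.
  have [s st e] := MVT t0 (fun s hs => dg s (le0 s (subset_itv_oo_cc hs))) (cg _ _ le0).
  exists s; first by apply: le0; exact: subset_itv_oo_cc.
  by move: e; rewrite gE0 /g => e; lra.
- have le0 (s : R) : s \in `[0, t] -> `|s| <= `|t|.
    by rewrite in_itv/= => /andP[ts s0]; rewrite !ger0_norm// ltW.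
  have [s st e] := MVT t0 (fun s hs => dg s (le0 s (subset_itv_oo_cc hs))) (cg _ _ le0).
  exists s; first by apply: le0; exact: subset_itv_oo_cc.
  by move: e; rewrite gE0 /g subr0 mulrC.
Qed.

End Lines.

Section C1.
Context {R : realType} (m : nat).
Local Notation e_ l := (delta_mx 0 l : 'rV[R]_m).

Lemma norm_coord_le (p q : nat) (x : 'M[R]_(p, q)) i j : `|x i j| <= `|x|.
Proof.
rewrite [leRHS]/Num.Def.normr/= mx_normrE.
exact: (le_bigmax _ (fun i : 'I_p * 'I_q => `|x i.1 i.2|) (i, j)).
Qed.

Lemma mx_norm_leP (p q : nat) (x : 'M[R]_(p, q)) (c : R) : 0 <= c ->
  (forall i j, `|x i j| <= c) -> `|x| <= c.
Proof.
move=> c0 h; rewrite [leLHS]/Num.Def.normr/= mx_normrE.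
by apply: bigmax_le => // -[i j] _; exact: h.
Qed.

Let trunc (h : 'rV[R]_m) (j : nat) : 'rV[R]_m :=
  \row_l (if (l < j)%N then h 0 l else 0).

(** Moving from x to x + h one coordinate at a time splits the increment of f into
    m increments along coordinate lines; the mean value theorem turns each of them
    into a partial derivative at a point within |h| of x. *)
Lemma C1_littleo (U : set 'rV[R]_m) (f : 'rV[R]_m -> R) x (eps : R) :
  open U -> U x -> (forall l y, U y -> derivable f y (e_ l)) ->
  (forall l, {for x, continuous (fun y => 'D_(e_ l) f y)}) -> 0 < eps ->
  \forall h \near (0 : 'rV[R]_m),
    `|f (x + h) - f x - \sum_l h 0 l * 'D_(e_ l) f x| <= eps * `|h|.
Proof.
move=> oU Ux dfU cf eps0; pose e := eps / m.+1%:R.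
have e0 : 0 < e by rewrite divr_gt0.
have [d /= d0 dP] : exists2 d : R, 0 < d & forall y, `|y - x| < d ->
    U y /\ forall l, `|'D_(e_ l) f y - 'D_(e_ l) f x| <= e.
  have : \forall y \near x, U y /\ forall l, `|'D_(e_ l) f y - 'D_(e_ l) f x| <= e.
    near=> y; split; first by near: y; exact: open_nbhs_nbhs.
    near: y; apply: filter_forall => l.
    by have /cvgrPdistC_le/(_ _ e0) := cf l.
  move=> /nbhs_ballP[d /= d0 dP]; exists d => // y yx.
  by apply: dP; rewrite -ball_normE /ball_ /= distrC.
have nd : \forall h \near (0 : 'rV[R]_m), `|h| < d by exact: nbhs0_lt.
near=> h.
have hd : `|h| < d by near: h.
have step (j : 'I_m) : `|f (x + trunc h j.+1) - f (x + trunc h j)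
    - h 0 j * 'D_(e_ j) f x| <= e * `|h|.
  have -> : trunc h j.+1 = trunc h j + h 0 j *: e_ j.
    apply/rowP => l; rewrite !mxE eqxx /= ltnS leq_eqVlt.
    have [->|lj] := eqVneq l j; first by rewrite eqxx ltnn mulr1 add0r.
    by rewrite (inj_eq val_inj) (negbTE lj) mulr0 addr0.
  have small (s : R) : `|s| <= `|h 0 j| -> `|(x + trunc h j + s *: e_ j) - x| < d.
    move=> sh; have -> : x + trunc h j + s *: e_ j - x = trunc h j + s *: e_ j.
      by rewrite -[x + _ + _]addrA addrAC subrr add0r.
    apply: le_lt_trans hd; apply: mx_norm_leP => // i l; rewrite (ord1 i) !mxE eqxx /=.
    have [->|lj] := eqVneq l j.
      by rewrite ltnn mulr1 add0r; apply: le_trans sh _; exact: norm_coord_le.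
    rewrite mulr0 addr0; case: ifP => _; first exact: norm_coord_le.
    by rewrite normr0.
  rewrite (addrA x); have [s sh ->] : exists2 s : R, `|s| <= `|h 0 j| &
      f (x + trunc h j + h 0 j *: e_ j) - f (x + trunc h j) =
      h 0 j * 'D_(e_ j) f (x + trunc h j + s *: e_ j).
    by apply: MVT_line => s /small /dP [Uy _]; exact: dfU.
  rewrite -mulrBr normrM mulrC ler_pM//; last exact: norm_coord_le.
  by have /dP[_ ] := small _ sh.
have -> : f (x + h) - f x = \sum_(j < m) (f (x + trunc h j.+1) - f (x + trunc h j)).
  rewrite -(big_mkord xpredT (fun j => f (x + trunc h j.+1) - f (x + trunc h j))).
  rewrite telescope_sumr//; congr (f _ - f _).
    by congr (_ + _); apply/rowP => l; rewrite mxE ltn_ord.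
  by rewrite [trunc _ _](_ : _ = 0) ?addr0//; apply/rowP => l; rewrite !mxE.
rewrite -sumrB; apply: le_trans (ler_norm_sum _ _ _) _.
apply: (@le_trans _ _ (\sum_(i < m) e * `|h|)); first exact: ler_sum.
rewrite sumr_const card_ord -mulr_natl mulrA ler_wpM2r//.
rewrite /e mulrCA ger_pMr// ler_pdivrMr// mul1r ler_nat.
exact: leqnSn.
Unshelve. all: by end_near. Qed.

Lemma C1_is_diff (U : set 'rV[R]_m) (f : 'rV[R]_m -> R) x :
  open U -> U x -> (forall l y, U y -> derivable f y (e_ l)) ->
  (forall l, {for x, continuous (fun y => 'D_(e_ l) f y)}) ->
  differentiable f x.
Proof.
move=> oU Ux dfU cf.
pose L (h : 'rV[R]_m) := \sum_l h 0 l * 'D_(e_ l) f x.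
have lin_L : linear (L : 'rV[R]_m -> R).
  move=> k u v; rewrite /L scaler_sumr -big_split; apply: eq_bigr => l _ /=.
  by rewrite !mxE mulrDl -mulrA.
pose LM := GRing.isLinear.Build _ _ _ _ _ lin_L.
pose LL : {linear 'rV[R]_m -> R} := HB.pack L LM.
have cL : continuous LL.
  apply: bounded_linear_continuous.
  apply/linear_boundedP; exists (\sum_l `|'D_(e_ l) f x|); split.
    by apply/ger0_real/sumr_ge0.
  move=> y /ltW ly v; apply: le_trans (ler_norm_sum _ _ _) _.
  apply: (@le_trans _ _ (\sum_l `|'D_(e_ l) f x| * `|v|)).
    apply: ler_sum => l _; rewrite normrM mulrC ler_wpM2l//; exact: norm_coord_le.
  by rewrite -mulr_suml ler_wpM2r.
have fE : f \o shift x = cst (f x) + LL +o_ (0 : 'rV[R]_m) id.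
  apply/eqaddoP => _/posnumP[eps]; near=> h.
  rewrite /= -[(_ - _) h]/(f (h + x) - (f x + L h)) opprD addrA (addrC h).
  near: h; exact: (C1_littleo oU).
apply/diff_locallyP; rewrite (diff_unique cL fE); split => //.
Unshelve. all: by end_near. Qed.

End C1.

(** * Closure properties of functions of class C^k *)

Lemma near_eq_continuous_at (V W : topologicalType) (f g : V -> W) x :
  (\forall y \near x, f y = g y) -> {for x, continuous f} -> {for x, continuous g}.
Proof.
move=> fg cf; rewrite /prop_for /continuous_at -(nbhs_singleton fg).
by apply: cvg_trans cf; apply: near_eq_cvg; apply: filterS fg => y ->.
Qed.

Section Ck.
Context {R : realType} (m : nat).
Local Notation e_ l := (delta_mx 0 l : 'rV[R]_m).
Implicit Types (U V : set 'rV[R]_m) (k : nat).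

Lemma Ck_cont (W : normedModType R) k U (f : 'rV[R]_m -> W) :
  Ck_on k U f -> forall x, U x -> {for x, continuous f}.
Proof. by case: k => [|k] []. Qed.

Lemma Ck_pred (W : normedModType R) k U (f : 'rV[R]_m -> W) :
  Ck_on k.+1 U f -> Ck_on k U f.
Proof.
elim: k f => [|k IH] f [cf df]; first by split.
by split => // l; have [d1 d2] := df l; split => //; exact: IH.
Qed.

(** Openness of the domain is what makes iterated derivatives depend only on the
    values in the domain. *)
Lemma Ck_eq (W : normedModType R) k U (f g : 'rV[R]_m -> W) :
  open U -> (forall x, U x -> f x = g x) -> Ck_on k U f -> Ck_on k U g.
Proof.
move=> oU; elim: k f g => [|k IH] f g fg [cf df];
  have nfg x : U x -> \forall y \near x, f y = g y
    by move=> Ux; apply: filterS (open_nbhs_nbhs (conj oU Ux)) => y /fg.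
- by split => // x Ux; exact: near_eq_continuous_at (nfg _ Ux) (cf _ Ux).
- split.
    by move=> x Ux; exact: near_eq_continuous_at (nfg _ Ux) (cf _ Ux).
  move=> l; have [d1 d2] := df l; split.
    by move=> x Ux; apply: near_eq_derivable (d1 _ Ux); exact: nfg.
  by apply: IH d2 => x Ux; apply: near_eq_derive; exact: nfg.
Qed.

Lemma Ck_local (W : normedModType R) k U (f : 'rV[R]_m -> W) :
  (forall x, U x -> exists V, V x /\ Ck_on k V f) -> Ck_on k U f.
Proof.
elim: k f => [|k IH] f h.
  by split => // x /h[V [Vx [cf _]]]; exact: cf.
split; first by move=> x /h[V [Vx [cf _]]]; exact: cf.
move=> l; split; first by move=> x /h[V [Vx [_ /(_ l)[d1 _]]]]; exact: d1.
by apply: IH => x /h[V [Vx [_ /(_ l)[_ d2]]]]; exists V.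
Qed.

Lemma Ck_cst (W : normedModType R) k U (c : W) : Ck_on k U (fun=> c).
Proof.
elim: k c => [|k IH] c; first by split => // x _; exact: cst_continuous.
split; first by move=> x _; exact: cst_continuous.
move=> l; split; first by move=> x _; exact: derivable_cst.
have -> : (fun x => 'D_(e_ l) (fun=> c) x) = (fun=> 0) by apply/funext => x; exact: derive_cst.
exact: IH.
Qed.

Lemma Ck_add (W : normedModType R) k U (f g : 'rV[R]_m -> W) : open U ->
  Ck_on k U f -> Ck_on k U g -> Ck_on k U (fun x => f x + g x).
Proof.
move=> oU; elim: k f g => [|k IH] f g [cf df] [cg dg].
  by split => // x Ux; apply: continuousD; [exact: cf|exact: cg].
split; first by move=> x Ux; apply: continuousD; [exact: cf|exact: cg].
move=> l; have [df1 df2] := df l; have [dg1 dg2] := dg l; split.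
  by move=> x Ux; apply: derivableD; [exact: df1|exact: dg1].
apply: Ck_eq (IH _ _ df2 dg2) => // x Ux.
by rewrite -deriveD//; [exact: df1|exact: dg1].
Qed.

Lemma Ck_mul k U (f g : 'rV[R]_m -> R) : open U ->
  Ck_on k U f -> Ck_on k U g -> Ck_on k U (fun x => f x * g x).
Proof.
move=> oU; elim: k f g => [|k IH] f g Cf Cg;
  (have cfg x : U x -> {for x, continuous (fun x => f x * g x)}
    by move=> Ux; apply: continuousM; [exact: Ck_cont Cf _ Ux|exact: Ck_cont Cg _ Ux]).
  by split.
split => // l.
have [_ /(_ l)[df1 df2]] := Cf; have [_ /(_ l)[dg1 dg2]] := Cg; split.
  by move=> x Ux; apply: derivableM; [exact: df1|exact: dg1].
have := Ck_add oU (IH _ _ (Ck_pred Cf) dg2) (IH _ _ (Ck_pred Cg) df2).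
apply: Ck_eq => // x Ux.
by rewrite [RHS](deriveM (df1 _ Ux) (dg1 _ Ux)).
Qed.

Lemma Ck_opp k U (f : 'rV[R]_m -> R) : open U ->
  Ck_on k U f -> Ck_on k U (fun x => - f x).
Proof.
move=> oU Cf; have := Ck_mul oU (@Ck_cst _ k U (-1 : R)) Cf.
by apply: Ck_eq => // x _; rewrite mulN1r.
Qed.

Lemma Ck_sub_fun k U (f g : 'rV[R]_m -> R) : open U ->
  Ck_on k U f -> Ck_on k U g -> Ck_on k U (fun x => f x - g x).
Proof. by move=> oU Cf Cg; apply: Ck_add => //; exact: Ck_opp. Qed.

Lemma Ck_sum k U (I : Type) (r : seq I) (f : I -> 'rV[R]_m -> R) : open U ->
  (forall i, Ck_on k U (f i)) -> Ck_on k U (fun x => \sum_(i <- r) f i x).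
Proof.
move=> oU Cf; elim: r => [|i r IH].
  by apply: Ck_eq (Ck_cst k U (0 : R)) => // x _; rewrite big_nil.
by apply: Ck_eq (Ck_add oU (Cf i) IH) => // x _; rewrite big_cons.
Qed.

Lemma Ck_prod k U (I : Type) (r : seq I) (f : I -> 'rV[R]_m -> R) : open U ->
  (forall i, Ck_on k U (f i)) -> Ck_on k U (fun x => \prod_(i <- r) f i x).
Proof.
move=> oU Cf; elim: r => [|i r IH].
  by apply: Ck_eq (Ck_cst k U (1 : R)) => // x _; rewrite big_nil.
by apply: Ck_eq (Ck_mul oU (Cf i) IH) => // x _; rewrite big_cons.
Qed.

Lemma is_derive_coord (l j : 'I_m) x :
  is_derive x (e_ l) (fun x : 'rV[R]_m => x 0 j) ((j == l)%:R).
Proof.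
have E : (fun h : R => h^-1 *: (((fun x : 'rV[R]_m => x 0 j) \o shift x) (h *: e_ l) - x 0 j))
   @ 0^' --> ((j == l)%:R : R).
  apply: cvg_near_cst; near=> h.
  rewrite /= !mxE eqxx /= addrK [_ *: _]mulrA mulVf ?mul1r//.
  by near: h; exact: nbhs_dnbhs_neq.
by split; [apply/cvg_ex; eexists; exact: E|exact: cvg_lim E].
Unshelve. all: by end_near. Qed.

Lemma Ck_coord k U (j : 'I_m) : open U -> Ck_on k U (fun x : 'rV[R]_m => x 0 j).
Proof.
move=> oU; have cc x : U x -> {for x, continuous (fun x : 'rV[R]_m => x 0 j)}.
  by move=> _; exact: coord_continuous.
case: k => [|k]; split => // l; split.
  by move=> x Ux; apply: ex_derive; exact: is_derive_coord.
apply: Ck_eq (Ck_cst k U ((j == l)%:R : R)) => // x Ux.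
by have [_ ->] := is_derive_coord l j x.
Qed.

Lemma mx_continuousP (T : topologicalType) (p q : nat) (F : T -> 'M[R]_(p, q)) x :
  {for x, continuous F} <-> forall i j, {for x, continuous (fun y => F y i j)}.
Proof.
split=> [cF i j|cF].
  apply: (@continuous_comp _ _ _ F (fun M : 'M[R]_(p, q) => M i j)) => //.
  exact: coord_continuous.
apply/cvgrPdist_le => /= e e0; near=> y.
apply: mx_norm_leP (ltW e0) _ => i j; rewrite !mxE; move: i j.
near: y; apply: filter_forall => i; apply: filter_forall => j.
by have /cvgrPdist_le/(_ _ e0) := cF i j.
Unshelve. all: by end_near. Qed.

Lemma Ck_mx k U (p q : nat) (F : 'rV[R]_m -> 'M[R]_(p, q)) : open U ->
  Ck_on k U F <-> forall i j, Ck_on k U (fun x => F x i j).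
Proof.
move=> oU; elim: k F => [|k IH] F.
  split=> [[cF _] i j|cF]; split => // x Ux.
    by have /mx_continuousP := cF _ Ux; exact.
  by apply/mx_continuousP => i j; have [+ _] := cF i j; exact.
split=> [[cF dF] i j|CF].
  split; first by move=> x Ux; have /mx_continuousP := cF _ Ux; exact.
  move=> l; have [d1 /IH d2] := dF l; split.
    by move=> x Ux; have /derivable_mxP := d1 _ Ux; exact.
  apply: Ck_eq (d2 i j) => // x Ux.
  by rewrite (derive_mx (d1 _ Ux)) mxE.
split; first by move=> x Ux; apply/mx_continuousP => i j; exact: Ck_cont (CF i j) _ Ux.
move=> l; have d1 x : U x -> derivable F x (e_ l).
  by move=> Ux; apply/derivable_mxP => i j; have [_ /(_ l)[+ _]] := CF i j; exact.
split => //; apply/IH => i j; have [_ /(_ l)[_]] := CF i j.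
apply: Ck_eq => // x Ux.
by rewrite (derive_mx (d1 _ Ux)) mxE.
Qed.

Lemma C1_differentiable U (f : 'rV[R]_m -> R) x : open U ->
  Ck_on 1 U f -> U x -> differentiable f x.
Proof.
move=> oU [cf df] Ux; apply: (C1_is_diff oU Ux) => [l y Uy|l].
  by have [+ _] := df l; exact.
by have [_ [+ _]] := df l; exact.
Qed.

Lemma differentiable_mxP (V : normedModType R) (p q : nat) (F : V -> 'M[R]_(p, q)) x :
  (forall i j, differentiable (fun y => F y i j) x) -> differentiable F x.
Proof.
move=> dF.
have -> : F = \sum_(i < p) \sum_(j < q) (fun y => F y i j *: delta_mx i j).
  apply/funext => y; rewrite fct_sumE [LHS]matrix_sum_delta; apply: eq_bigr => i _.
  by rewrite fct_sumE.
apply: differentiable_sum => i; apply: differentiable_sum => j.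
by apply: differentiableZl; exact: dF.
Qed.

Lemma C1_differentiable_mx U (p q : nat) (F : 'rV[R]_m -> 'M[R]_(p, q)) x : open U ->
  Ck_on 1 U F -> U x -> differentiable F x.
Proof.
move=> oU /(Ck_mx _ _ oU) CF Ux; apply: differentiable_mxP => i j.
exact: C1_differentiable oU (CF i j) Ux.
Qed.

End Ck.

Section Comp.
Context {R : realType}.

Lemma derive_row_sum (m : nat) (W : normedModType R) (f : 'rV[R]_m -> W) x (v : 'rV[R]_m) :
  differentiable f x -> 'D_v f x = \sum_j v 0 j *: 'D_(delta_mx 0 j) f x.
Proof.
move=> df; rewrite deriveE// {1}(row_sum_delta v) linear_sum; apply: eq_bigr => j _.
by rewrite linearZ deriveE.
Qed.

Lemma derive_comp_rV (V W : normedModType R) (U : normedModType R)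
    (f : V -> W) (F : U -> V) x v :
  differentiable F x -> differentiable f (F x) ->
  'D_v (f \o F) x = 'D_('D_v F x) f (F x).
Proof.
move=> dF df; rewrite !deriveE//; last exact: differentiable_comp.
by rewrite diff_comp.
Qed.

(** By induction on k, through D_l (f o F) = sum_j D_l F_j (D_j f o F). *)
Lemma Ck_comp (m p k : nat) (U : set 'rV[R]_m) (V : set 'rV[R]_p)
    (f : 'rV[R]_p -> R) (F : 'rV[R]_m -> 'rV[R]_p) : open U -> open V ->
  (forall x, U x -> V (F x)) -> Ck_on k U F -> Ck_on k V f ->
  Ck_on k U (fun x => f (F x)).
Proof.
move=> oU oV UV; elim: k f => [|k IH] f CF Cf;
  (have cfF x : U x -> {for x, continuous (fun x => f (F x))}
    by move=> Ux; apply: (@continuous_comp _ _ _ F f);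
      [exact: Ck_cont CF _ Ux|exact: Ck_cont Cf _ (UV _ Ux)]).
  by split.
have C1 (n : nat) (A : set 'rV[R]_n) (W : normedModType R) (g : 'rV[R]_n -> W) : Ck_on k.+1 A g -> Ck_on 1 A g.
  by elim: (k) => // k' IHk /Ck_pred.
have dF x : U x -> differentiable F x.
  by move=> Ux; apply: (C1_differentiable_mx oU) => //; exact: C1.
have df x : U x -> differentiable f (F x).
  by move=> /UV Ux; apply: (C1_differentiable oV) => //; exact: C1.
split => // l; split.
  by move=> x Ux; apply: diff_derivable; apply: differentiable_comp; [exact: dF|exact: df].
have h : Ck_on k U (fun x => \sum_j ('D_(delta_mx 0 l) F x) 0 j * 'D_(delta_mx 0 j) f (F x)).
  apply: Ck_sum => // j; apply: Ck_mul => //.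
    by have [_ /(_ l)[_ /(Ck_mx _ _ oU)]] := CF; exact.
  apply: (IH (fun y => 'D_(delta_mx 0 j) f y)); first exact: Ck_pred.
  by have [_ /(_ j)[_]] := Cf.
apply: Ck_eq h => // x Ux.
by rewrite (derive_comp_rV _ (dF _ Ux) (df _ Ux)) (derive_row_sum _ (df _ Ux)).
Qed.

(** The whole sequence of derivatives is carried as data: for exp, ln, the inverse
    and the flat functions below the derivatives are explicit, and composition on
    the left then needs no chain rule of higher order. *)
Definition smooth1 (A : set R) (h : R -> R) := exists H : nat -> R -> R,
  H 0%N = h /\ forall i y, A y -> is_derive y 1 (H i) (H i.+1 y).

Lemma is_derive_comp1 (V : normedModType R) (f : V -> R) (h : R -> R) x v (a : R) :
  derivable f x v -> is_derive (f x) 1 h a ->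
  is_derive x v (fun y => h (f y)) (a * 'D_v f x).
Proof.
move=> df dh.
have df' : derivable f (x + 0 *: v) v by rewrite scale0r addr0.
have l := is_derive_line df'; rewrite scale0r addr0 in l.
have dh' : is_derive ((fun s : R => f (x + s *: v)) 0) 1 h a by rewrite scale0r addr0.
have c := @is_derive1_comp _ h (fun s : R => f (x + s *: v)) 0 a _ dh' l.
have E : (fun t : R => t^-1 *: (((fun y => h (f y)) \o shift x) (t *: v) - h (f x))) =
  (fun t : R => t^-1 *: (((h \o (fun s : R => f (x + s *: v))) \o shift 0) (t *: (1 : R)) -
   (h \o (fun s : R => f (x + s *: v))) 0)).
  apply/funext => t; rewrite /= scale0r !addr0; congr (_ *: (h (f _) - _)).
  by rewrite [t%:A]mulr1 addrC.
case: c => c1 c2; split; first by rewrite /derivable E.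
by rewrite /derive E.
Qed.

Lemma Ck_comp1 (m k : nat) (U : set 'rV[R]_m) (A : set R) (h : R -> R)
    (f : 'rV[R]_m -> R) : open U -> smooth1 A h ->
  (forall x, U x -> A (f x)) -> Ck_on k U f -> Ck_on k U (fun x => h (f x)).
Proof.
move=> oU [H [<- dH]] UA Cf.
suff : forall i, Ck_on k U (fun x => H i (f x)) by exact.
elim: k Cf => [|k IH] Cf i;
  (have cc (x : 'rV[R]_m) : U x -> {for x, continuous (fun x => H i (f x))}
    by move=> Ux; apply: (@continuous_comp _ _ _ f (H i)); [exact: Ck_cont Cf _ Ux|
      apply: differentiable_continuous; apply/derivable1_diffP;
      apply: ex_derive; exact: dH (UA _ Ux)]).
  by split.
split => // l; have [_ /(_ l)[d1 d2]] := Cf.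
have d (x : 'rV[R]_m) : U x -> is_derive x (delta_mx 0 l) (fun x => H i (f x))
    (H i.+1 (f x) * 'D_(delta_mx 0 l) f x).
  by move=> Ux; apply: is_derive_comp1; [exact: d1|exact: dH (UA _ Ux)].
split; first by move=> x /d dx; exact: ex_derive.
apply: Ck_eq (Ck_mul oU (IH (Ck_pred Cf) i.+1) d2) => // x /d dx.
by rewrite derive_val.
Qed.

End Comp.

(** * Symmetry of mixed partials and the exterior derivative *)

Lemma addrrBK (V : zmodType) (x a b : V) : x + a + b - x = a + b.
Proof. by rewrite addrC addrA addKr. Qed.

Lemma nbhs_dist_lt {R : realType} (V : normedModType R) (x : V) (A : set V) :
  nbhs x A -> exists2 d : R, 0 < d & forall y, `|y - x| < d -> A y.
Proof.
move=> /nbhs_ballP[d /= d0 dP]; exists d => // y yx.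
by apply: dP; rewrite -ball_normE /ball_ /= distrC.
Qed.

Lemma continuous_dist_lt {R : realType} (V W : normedModType R) (f : V -> W) x (e : R) :
  0 < e -> {for x, continuous f} ->
  exists2 d : R, 0 < d & forall y, `|y - x| < d -> `|f y - f x| <= e.
Proof.
move=> e0 cf; apply: nbhs_dist_lt.
by have /cvgrPdistC_le/(_ _ e0) := cf.
Qed.

Lemma dist_lt_continuous {R : realType} (V W : normedModType R) (f : V -> W) x :
  (forall e : R, 0 < e -> exists2 d : R, 0 < d &
    forall y, `|y - x| < d -> `|f y - f x| <= e) -> {for x, continuous f}.
Proof.
move=> h; apply/cvgrPdistC_le => /= e /h[d d0 dP].
apply/nbhs_ballP; exists d => // y; rewrite -ball_normE /ball_ /= distrC => yx.
exact: dP.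
Qed.

Section Schwarz.
Context {R : realType} (m : nat).
Local Notation e_ l := (delta_mx 0 l : 'rV[R]_m).

Lemma is_derive_translate (V W : normedModType R) (f : V -> W) (y v w : V) :
  derivable f (y + w) v ->
  is_derive y v (fun z => f (z + w)) ('D_v f (y + w)).
Proof.
have E : (fun h => h^-1 *: (((fun z => f (z + w)) \o shift y) (h *: v) - f (y + w))) =
    (fun h => h^-1 *: ((f \o shift (y + w)) (h *: v) - f (y + w))).
  by apply/funext => h; rewrite /= addrA.
by move=> df; split; rewrite /derivable /derive E.
Qed.

Lemma norm_delta_le (l : 'I_m) : `|e_ l| <= 1.
Proof.
apply: mx_norm_leP => // i j; rewrite mxE.
by case: (_ && _); rewrite ?normr1 ?normr0.
Qed.

(** The second difference of f over the parallelogram with sides s e_l and s e_k is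
    computed by the mean value theorem, first along e_l and then along e_k. Since
    it is symmetric in l and k, the limit s -> 0 identifies the mixed partials. *)
Lemma second_difference (U : set 'rV[R]_m) (f : 'rV[R]_m -> R) x (d : R) l k (s : R) :
  Ck_on 2 U f -> (forall y, `|y - x| < d -> U y) -> `|s| + `|s| < d ->
  exists t1 t2 : R, [/\ `|t1| <= `|s|, `|t2| <= `|s| &
    f (x + s *: e_ l + s *: e_ k) - f (x + s *: e_ l) - f (x + s *: e_ k) + f x =
    s * (s * 'D_(e_ k) (fun y => 'D_(e_ l) f y) (x + t1 *: e_ l + t2 *: e_ k))].
Proof.
move=> [_ /(_ l)[dl [_ /(_ k)[dkl _]]]] dU sd.
have inU (a b : R) : `|a| <= `|s| -> `|b| <= `|s| -> U (x + a *: e_ l + b *: e_ k).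
  move=> sa sb; apply: dU; rewrite addrrBK.
  apply: le_lt_trans sd; apply: le_trans (ler_normD _ _) _.
  apply: lerD; rewrite normrZ.
    by apply: le_trans sa; rewrite ler_piMr// norm_delta_le.
  by apply: le_trans sb; rewrite ler_piMr// norm_delta_le.
have inU0 (a : R) : `|a| <= `|s| -> U (x + a *: e_ l).
  by move=> sa; have := inU a 0 sa; rewrite normr0 scale0r addr0; apply.
pose g y := f (y + s *: e_ k) - f y.
have dg (t : R) : `|t| <= `|s| -> is_derive (x + t *: e_ l) (e_ l) g
    ('D_(e_ l) f (x + t *: e_ l + s *: e_ k) - 'D_(e_ l) f (x + t *: e_ l)).
  move=> ts; apply: is_deriveB.
    by apply: is_derive_translate; apply: dl; exact: inU.
  by apply: derivableP; apply: dl; exact: inU0.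
have [t1 t1s E1] : exists2 t : R, `|t| <= `|s| &
    g (x + s *: e_ l) - g x = s * 'D_(e_ l) g (x + t *: e_ l).
  by apply: MVT_line => t /dg dgt; exact: ex_derive.
have [t2 t2s E2] : exists2 t : R, `|t| <= `|s| &
    'D_(e_ l) f (x + t1 *: e_ l + s *: e_ k) - 'D_(e_ l) f (x + t1 *: e_ l) =
    s * 'D_(e_ k) (fun y => 'D_(e_ l) f y) (x + t1 *: e_ l + t *: e_ k).
  apply: (@MVT_line _ _ (fun y => 'D_(e_ l) f y) (x + t1 *: e_ l) (e_ k) s) => t ts.
  by apply: dkl; exact: inU.
exists t1, t2; split => //; rewrite -E2.
have [_ <-] := dg _ t1s; rewrite -E1 /g; ring.
Qed.

Lemma Schwarz (U : set 'rV[R]_m) (f : 'rV[R]_m -> R) x l k : open U -> U x ->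
  Ck_on 2 U f ->
  'D_(e_ k) (fun y => 'D_(e_ l) f y) x = 'D_(e_ l) (fun y => 'D_(e_ k) f y) x.
Proof.
move=> oU Ux Cf; apply/eqP; rewrite -subr_eq0 -normr_le0; apply/ler_addgt0Pr => e e0; rewrite add0r.
have cc i j : {for x, continuous (fun y => 'D_(e_ i) (fun y => 'D_(e_ j) f y) y)}.
  by have [_ /(_ j)[_ [_ /(_ i)[_ [+ _]]]]] := Cf; exact.
have e20 : 0 < e / 2 by rewrite divr_gt0.
pose Dkl y := 'D_(e_ k) (fun y => 'D_(e_ l) f y) y.
pose Dlk y := 'D_(e_ l) (fun y => 'D_(e_ k) f y) y.
have [d d0 dP] : exists2 d : R, 0 < d & forall y, `|y - x| < d ->
   [/\ U y, `|Dkl y - Dkl x| <= e / 2 & `|Dlk y - Dlk x| <= e / 2].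
  have [d1 d10 dP1] := nbhs_dist_lt (open_nbhs_nbhs (conj oU Ux)).
  have [d2 d20 dP2] := continuous_dist_lt e20 (cc k l : {for x, continuous Dkl}).
  have [d3 d30 dP3] := continuous_dist_lt e20 (cc l k : {for x, continuous Dlk}).
  exists (Num.min d1 (Num.min d2 d3)); first by rewrite !lt_min d10 d20 d30.
  move=> y; rewrite !lt_min => /and3P[y1 y2 y3].
  by split; [exact: dP1|exact: dP2|exact: dP3].
pose s := d / 3; have s0 : 0 < s by rewrite divr_gt0.
have sd : `|s| + `|s| < d by rewrite gtr0_norm// /s; lra.
have dU y : `|y - x| < d -> U y by move=> /dP[].
have close (a b : R) i j : `|a| <= `|s| -> `|b| <= `|s| -> `|x + a *: e_ i + b *: e_ j - x| < d.
  move=> sa sb; rewrite addrrBK.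
  apply: le_lt_trans sd; apply: le_trans (ler_normD _ _) _.
  apply: lerD; rewrite normrZ.
    by apply: le_trans sa; rewrite ler_piMr// norm_delta_le.
  by apply: le_trans sb; rewrite ler_piMr// norm_delta_le.
have [t1 [t2 [h1 h2 E1]]] := second_difference l k Cf dU sd.
have [t3 [t4 [h3 h4 E2]]] := second_difference k l Cf dU sd.
have E : Dkl (x + t1 *: e_ l + t2 *: e_ k) = Dlk (x + t3 *: e_ k + t4 *: e_ l).
  apply: (mulfI (lt0r_neq0 s0)); apply: (mulfI (lt0r_neq0 s0)).
  rewrite -[LHS]E1 -[RHS]E2 (addrAC x); ring.
have [_ A1 _] := dP _ (close t1 t2 l k h1 h2).
have [_ _ A2] := dP _ (close t3 t4 k l h3 h4).
rewrite -[X in `|X|]/(Dkl x - Dlk x).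
rewrite -E in A2; apply: le_trans (ler_distD _ _ _) _.
by rewrite distrC [leRHS]splitr; exact: lerD A1 A2.
Qed.

End Schwarz.

Section ExteriorDerivative.
Context {R : realType} (m : nat).
Local Notation e_ l := (delta_mx 0 l : 'rV[R]_m).
Implicit Types (a : 'rV[R]_m -> 'cV[R]_m) (U V : set 'rV[R]_m).

(** The exterior derivative of the 1-form with coefficients a, as the skew matrix of
    the bilinear form: d a (v, w) = v *m dmat a x *m w^T. *)
Definition dmat a (x : 'rV[R]_m) : 'M[R]_m :=
  \matrix_(l, k) ('D_(e_ l) (fun y => a y k 0) x - 'D_(e_ k) (fun y => a y l 0) x).

Lemma eq_dmat a b x : (\forall y \near x, a y = b y) -> dmat a x = dmat b x.
Proof.
move=> ab; apply/matrixP => l k; rewrite !mxE.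
by congr (_ - _); apply: near_eq_derive; apply: filterS ab => y ->.
Qed.

Lemma jacobianE (p : nat) (F : 'rV[R]_m -> 'rV[R]_p) x k j : differentiable F x ->
  ('J F x) k j = 'D_(e_ k) (fun y => F y 0 j) x.
Proof.
move=> dF; have dFk := diff_derivable (v := e_ k) dF.
transitivity (('D_(e_ k) F x) 0 j); last by rewrite (derive_mx dFk) mxE.
by rewrite deriveEjacobian// -rowE [RHS]mxE.
Qed.

(** d commutes with pullback: by the product rule d(F^* a) is F^*(d a) plus a term in
    the second derivatives of F, which is symmetric and so disappears. *)
Lemma dmat_pullback U V (F : 'rV[R]_m -> 'rV[R]_m) a x : open U -> open V -> U x ->
  (forall y, U y -> V (F y)) -> Ck_on 2 U F -> Ck_on 1 V a ->
  dmat (fun y => 'J F y *m a (F y)) x =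
  'J F x *m dmat a (F x) *m ('J F x)^T.
Proof.
move=> oU oV Ux UV CF Ca.
pose Fp p y := F y 0 p; pose ap p y := a y p 0.
have CFp p : Ck_on 2 U (Fp p) by have /(Ck_mx _ _ oU) := CF; exact.
have Cap p : Ck_on 1 V (ap p) by have /(Ck_mx _ _ oV) := Ca; exact.
have dF y : U y -> differentiable F y.
  by move=> Uy; exact: C1_differentiable_mx oU (Ck_pred CF) Uy.
have dap p : differentiable (ap p) (F x) := C1_differentiable oV (Cap p) (UV _ Ux).
pose H l k p := 'D_(e_ l) (fun y => 'D_(e_ k) (Fp p) y) x.
pose D q p := 'D_(e_ q) (ap p) (F x).
pose J := 'J F x.
have JE i j : J i j = 'D_(e_ i) (Fp j) x by apply: jacobianE; exact: dF.
have dA l k : 'D_(e_ l) (fun y => ('J F y *m a (F y)) k 0) x =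
  \sum_p (H l k p * ap p (F x) + J k p * \sum_q J l q * D q p).
  have -> : 'D_(e_ l) (fun y => ('J F y *m a (F y)) k 0) x =
     'D_(e_ l) (\sum_p (fun y => 'D_(e_ k) (Fp p) y * ap p (F y))) x.
    apply: near_eq_derive; apply: filterS (open_nbhs_nbhs (conj oU Ux)) => y Uy.
    rewrite mxE fct_sumE; apply: eq_bigr => p _.
    by rewrite jacobianE//; exact: dF.
  have dap' p : derivable (fun y => ap p (F y)) x (e_ l).
    by apply: diff_derivable; apply: differentiable_comp => //; exact: dF.
  have dkF p : derivable (fun y => 'D_(e_ k) (Fp p) y) x (e_ l).
    by have [_ /(_ k)[_ [_ /(_ l)[+ _]]]] := CFp p; exact.
  rewrite derive_sum; last by move=> p; exact: derivableM.
  apply: eq_bigr => p _; rewrite [LHS]deriveM// addrC; congr (_ + _).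
    by rewrite [LHS]mulrC.
  rewrite JE; congr (_ * _).
  rewrite (derive_comp_rV _ (dF _ Ux) (dap p)) (derive_row_sum _ (dap p)).
  apply: eq_bigr => q _; rewrite JE; congr (_ * _).
  by rewrite (derive_mx (diff_derivable (v := e_ l) (dF _ Ux))) mxE.
have S l k p : H l k p = H k l p by exact: Schwarz oU Ux (CFp p).
rewrite -/J [dmat a (F x)](_ : _ = \matrix_(q, p) (D q p - D p q))//.
clearbody H D; clear JE; clearbody J.
apply/matrixP => l k; rewrite mxE !dA -sumrB mxE.
transitivity (\sum_p \sum_q (J k p * J l q * D q p - J l p * J k q * D q p)).
  apply: eq_bigr => p _; rewrite S opprD addrACA subrr add0r !mulr_sumr -sumrB.
  by apply: eq_bigr => q _; rewrite !mulrA.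
under [RHS]eq_bigr do rewrite mxE mulr_suml.
rewrite [RHS]exchange_big /=.
under eq_bigr do rewrite sumrB.
under [RHS]eq_bigr => q _ do under eq_bigr => p _ do rewrite !mxE mulrBr mulrBl.
under [RHS]eq_bigr do rewrite sumrB.
rewrite !sumrB; congr (_ - _).
  rewrite exchange_big /=; apply: eq_bigr => p _; apply: eq_bigr => q _.
  by rewrite [J k q * _]mulrC mulrAC.
by apply: eq_bigr => p _; apply: eq_bigr => q _; rewrite mulrAC.
Qed.

(** d(e^g a) = e^g (d a + d g /\ a). *)
Lemma dmat_exp (g : 'rV[R]_m -> R) a x :
  differentiable g x -> differentiable a x ->
  dmat (fun y => expR (g y) *: a y) x =
  expR (g x) *: (dmat a x + (\col_l 'D_(e_ l) g x) *m (a x)^T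
     - a x *m (\col_l 'D_(e_ l) g x)^T).
Proof.
move=> dg da.
have dak k l : derivable (fun y => a y k 0) x (e_ l).
  by have /derivable_mxP := diff_derivable (v := e_ l) da; exact.
have deg l : is_derive x (e_ l) (fun y => expR (g y)) (expR (g x) * 'D_(e_ l) g x).
  by apply: is_derive_comp1; exact: diff_derivable.
have E l k : 'D_(e_ l) (fun y => (expR (g y) *: a y) k 0) x =
   expR (g x) * ('D_(e_ l) g x * a x k 0 + 'D_(e_ l) (fun y => a y k 0) x).
  have -> : (fun y => (expR (g y) *: a y) k 0) = (fun y => expR (g y)) * (fun y => a y k 0).
    by apply/funext => y; rewrite mxE.
  rewrite deriveM//; have [_ ->] := deg l; rewrite /GRing.scale /=; ring.
apply/matrixP => l k; rewrite !mxE !E !big_ord1 !mxE; ring.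
Qed.

End ExteriorDerivative.

(** * Smooth bump functions *)

Section SmoothReal.
Context {R : realType}.

Lemma smooth1_expR : smooth1 setT (@expR R).
Proof. by exists (fun=> expR); split => // _ y _; exact: is_derive_expR. Qed.

Lemma is_derive_inv (y : R) : 0 < y -> is_derive y 1 (fun x : R => x^-1) (- (y^-1 ^+ 2)).
Proof.
move=> y0; have yn : (id : R -> R) y != 0 by rewrite gt_eqF.
split; first by apply: (@derivableV _ _ (id : R -> R)); rewrite ?gt_eqF.
rewrite (@deriveV _ _ (id : R -> R))// derive_id exprVn.
by rewrite -[RHS]mulr1.
Qed.

Lemma is_derive_invX (n : nat) (y : R) : 0 < y ->
  is_derive y 1 (fun x : R => x^-1 ^+ n) (- (n%:R * y^-1 ^+ n.+1)).
Proof.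
move=> y0; elim: n => [|n IH].
  rewrite mul0r oppr0.
  have -> : (fun x : R => x^-1 ^+ 0) = cst 1 by apply/funext => x; rewrite expr0.
  exact: is_derive_cst.
have -> : (fun x : R => x^-1 ^+ n.+1) = (fun x => x^-1) * (fun x => x^-1 ^+ n).
  by apply/funext => x; rewrite exprS.
have d1 := is_derive_inv y0.
have dM := is_deriveM d1 IH.
apply: is_derive_eq dM _.
rewrite /GRing.scale /= !exprS expr0 -[n.+1%:R]natr1; ring.
Qed.

Lemma smooth1_inv : smooth1 [set y : R | 0 < y] (fun y => y^-1).
Proof.
exists (fun i y => (-1) ^+ i * (i`!)%:R * y^-1 ^+ i.+1); split.
  by apply/funext => y; rewrite expr0 fact0 !mul1r expr1.
move=> i y /= y0.
have -> : (fun y => (-1) ^+ i * (i`!)%:R * y^-1 ^+ i.+1) =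
    ((-1) ^+ i * (i`!)%:R : R) *: (fun y : R => y^-1 ^+ i.+1) by [].
have d1 := is_derive_invX i.+1 y0.
apply: is_derive_eq; rewrite /GRing.scale /= factS natrM !exprS; ring.
Qed.

Lemma smooth1_ln : smooth1 [set y : R | 0 < y] (@ln R).
Proof.
have [H [H0 dH]] := smooth1_inv.
exists (fun i => if i is j.+1 then H j else @ln R); split => // -[|i] y y0.
  by rewrite H0; exact: is_derive1_ln.
exact: dH.
Qed.

(** The functions P(1/x) exp(-1/x), extended by 0 to x <= 0. Differentiation replaces P
    by X^2 (P - P'), so that this family contains all its derivatives, and smoothness
    reduces to differentiability at 0. *)
Definition flat (P : {poly R}) (x : R) : R :=
  if 0 < x then P.[x^-1] * expR (- x^-1) else 0.

Lemma horner_le (P : {poly R}) (y : R) : 1 <= y ->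
  `|P.[y]| <= (\sum_(i < size P) `|P`_i|) * y ^+ size P.
Proof.
move=> y1; rewrite horner_coef; apply: le_trans (ler_norm_sum _ _ _) _.
rewrite mulr_suml; apply: ler_sum => i _; rewrite normrM ler_wpM2l//.
by rewrite normrX ger0_norm ?(le_trans ler01)// ler_weXn2l// ltnW.
Qed.

(** With y = 1/x, a polynomial of degree less than d is at most A y^d for y >= 1, while
    exp y >= y^(d + 2) / (d + 2)!; the quotient is of order x^2. *)
Lemma flat_le (P : {poly R}) : exists2 C : R, 0 < C & forall x, x <= 1 -> `|flat P x| <= C * x ^+ 2.
Proof.
pose d := size P; pose A := \sum_(i < d) `|P`_i|.
have A0 : 0 <= A by apply: sumr_ge0.
exists (A * (d.+2)`!%:R + 1).
  by rewrite ltr_wpDl// mulr_ge0.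
move=> x x1; rewrite /flat; case: ifPn => [x0|_]; last first.
  by rewrite normr0 mulr_ge0 ?sqr_ge0// addr_ge0// mulr_ge0.
set y := x^-1; have y1 : 1 <= y by rewrite /y invf_ge1.
have y0 : 0 < y by rewrite invr_gt0.
have e1 : y ^+ d.+2 <= (d.+2)`!%:R * expR y.
  rewrite mulrC -ler_pdivrMr ?ltr0n ?fact_gt0//.
  by apply: le_trans (expR_ge1Dxn d.+1 (ltW y0)); rewrite lerDr.
rewrite normrM (ger0_norm (expR_ge0 _)) expRN ler_pdivrMr ?expR_gt0//.
apply: le_trans (horner_le P y1) _.
have xE : x ^+ 2 = (y ^+ 2)^-1 by rewrite /y exprVn invrK.
rewrite mulrAC xE ler_pdivlMr ?exprn_gt0// -mulrA -exprD addn2.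
rewrite -/d -/A mulrDl mul1r.
apply: (@le_trans _ _ (A * (d.+2)`!%:R * expR y)); last by rewrite lerDl expR_ge0.
by rewrite -mulrA ler_wpM2l.
Qed.

Lemma is_derive_quadratic (f : R -> R) (C : R) : 0 < C ->
  (forall x, x <= 1 -> `|f x| <= C * x ^+ 2) -> is_derive (0 : R) 1 f 0.
Proof.
move=> C0 fC.
have f0 : f 0 = 0.
  by apply/eqP; rewrite -normr_le0; apply: le_trans (fC _ ler01) _; rewrite expr0n mulr0.
have E : (fun h : R => h^-1 *: ((f \o shift 0) (h *: (1 : R)) - f 0)) @ 0^' --> (0 : R).
  apply/cvgrPdist_le => /= e e0; near=> h.
  rewrite sub0r normrN f0 subr0 addr0 [h%:A]mulr1 normrM.
  have hn0 : h != 0 by near: h; exact: nbhs_dnbhs_neq.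
  rewrite normfV ler_pdivrMl ?normr_gt0//.
  have hs : `|h| < Num.min 1 (e / C).
    by near: h; apply: dnbhs0_lt; rewrite lt_min ltr01 divr_gt0.
  move: hs; rewrite lt_min => /andP[h1 hC].
  apply: (le_trans (fC _ (le_trans (ler_norm _) (ltW h1)))).
  rewrite -normr_id -real_normK ?num_real// normr_id expr2 mulrCA ler_wpM2l//.
  by rewrite mulrC -ler_pdivlMr// ltW.
by split; [apply/cvg_ex; eexists; exact: E|exact: cvg_lim E].
Unshelve. all: by end_near. Qed.

Lemma is_derive_flat (P : {poly R}) (x : R) :
  is_derive x 1 (flat P) (flat ('X^2 * (P - P^`())) x).
Proof.
have [x0|x0|<-] := ltgtP 0 x.
- rewrite [in X in is_derive _ _ _ X]/flat x0.
  apply: (@near_eq_is_derive _ _ _ (fun z : R => P.[z^-1] * expR (- z^-1))).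
    near=> z; rewrite /flat ifT//; near: z; exact: lt_nbhsr.
  have d1 := is_derive_inv x0.
  have d2 : is_derive x 1 (fun z : R => P.[z^-1]) (P^`().[x^-1] * - (x^-1 ^+ 2)).
    exact: (@is_derive1_comp _ (horner P)).
  have dN : is_derive x 1 (fun z : R => - z^-1) (x^-1 ^+ 2).
    by have := is_deriveN d1; rewrite opprK.
  have d3 : is_derive x 1 (fun z : R => expR (- z^-1)) (expR (- x^-1) * x^-1 ^+ 2).
    exact: (@is_derive1_comp _ expR (fun z : R => - z^-1) x _ _ (is_derive_expR _) dN).
  have dM := is_deriveM d2 d3; apply: is_derive_eq dM _.
  rewrite /GRing.scale /= hornerM hornerXn hornerD hornerN; ring.
- rewrite [in X in is_derive _ _ _ X]/flat ltNge (ltW x0) /=.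
  apply: (@near_eq_is_derive _ _ _ (cst 0)).
  near=> z; rewrite /flat ifF//; apply/negbTE; rewrite -leNgt; apply/ltW.
  by near: z; exact: lt_nbhsl.
- rewrite [in X in is_derive _ _ _ X]/flat ltxx.
  by have [C C0] := flat_le P; exact: is_derive_quadratic.
Unshelve. all: by end_near. Qed.

Lemma smooth1_flat (P : {poly R}) : smooth1 setT (flat P).
Proof.
exists (fun i => flat (iter i (fun Q => 'X^2 * (Q - Q^`())) P)); split => // i y _.
exact: is_derive_flat.
Qed.

Definition step (t : R) : R := flat 1 t / (flat 1 t + flat 1 (1 - t)).

Lemma flat1_ge0 t : 0 <= flat 1 t.
Proof. by rewrite /flat; case: ifP => // _; rewrite hornerC mul1r expR_ge0. Qed.

Lemma flat1_gt0 t : 0 < t -> 0 < flat 1 t.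
Proof. by move=> t0; rewrite /flat t0 hornerC mul1r expR_gt0. Qed.

Lemma step_den t : 0 < flat 1 t + flat 1 (1 - t).
Proof.
have [t0|t0] := ltP 0 t; first by rewrite ltr_pwDl ?flat1_gt0 ?flat1_ge0.
by rewrite ltr_wpDl ?flat1_ge0// flat1_gt0// subr_gt0 (le_lt_trans t0).
Qed.

Lemma step_ge0 t : 0 <= step t.
Proof. by rewrite divr_ge0 ?flat1_ge0// ltW// step_den. Qed.

Lemma step_le1 t : step t <= 1.
Proof. by rewrite ler_pdivrMr ?step_den// mul1r lerDl flat1_ge0. Qed.

Lemma step_eq0 t : t <= 0 -> step t = 0.
Proof. by move=> t0; rewrite /step {1}/flat ltNge t0 mul0r. Qed.

Lemma step_eq1 t : 1 <= t -> step t = 1.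
Proof.
move=> t1; rewrite /step.
have -> : flat 1 (1 - t) = 0 by rewrite /flat subr_gt0 ltNge t1.
by rewrite addr0 divff// gt_eqF// flat1_gt0// (lt_le_trans ltr01).
Qed.

End SmoothReal.

Section Bump.
Context {R : realType} (m : nat).
Implicit Types (U : set 'rV[R]_m) (k : nat).

Lemma Ck_step k U (f : 'rV[R]_m -> R) : open U -> Ck_on k U f ->
  Ck_on k U (fun x => step (f x)).
Proof.
move=> oU Cf; rewrite /step.
have C1f : Ck_on k U (fun x => flat 1 (f x)).
  exact: (Ck_comp1 oU (smooth1_flat 1) (fun _ _ => I) Cf).
have C2f : Ck_on k U (fun x => flat 1 (1 - f x)).
  apply: (Ck_comp1 oU (smooth1_flat 1) (fun _ _ => I)).
  by apply: Ck_sub_fun => //; exact: Ck_cst.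
apply: Ck_mul => //; apply: (Ck_comp1 oU smooth1_inv) (Ck_add oU C1f C2f).
by move=> x _; exact: step_den.
Qed.

(** A product over the coordinates fits the sup norm of row vectors: it is 1 where all
    coordinates are within r of those of y, and 0 as soon as one is at distance 2 r. *)
Definition bump (y : 'rV[R]_m) (r : R) (x : 'rV[R]_m) : R :=
  \prod_l step (2 - ((x 0 l - y 0 l) / r) ^+ 2).

Lemma Ck_bump k U y r : open U -> Ck_on k U (bump y r).
Proof.
move=> oU; apply: Ck_prod => // l; apply: Ck_step => //.
apply: Ck_sub_fun => //; first exact: Ck_cst.
have h : Ck_on k U (fun x : 'rV[R]_m => (x 0 l - y 0 l) / r).
  apply: Ck_mul => //; last exact: Ck_cst.
  by apply: Ck_sub_fun => //; [exact: Ck_coord|exact: Ck_cst].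
exact: (Ck_mul oU h h).
Qed.

Lemma bump_ge0 y r x : 0 <= bump y r x.
Proof. by apply: prodr_ge0 => l _; exact: step_ge0. Qed.

Lemma bump_le1 y r x : bump y r x <= 1.
Proof. by apply: prodr_ile1 => l _; rewrite step_ge0 step_le1. Qed.

Lemma bump_eq1 y r x : 0 < r -> `|x - y| <= r -> bump y r x = 1.
Proof.
move=> r0 xy; rewrite /bump big1// => l _; apply: step_eq1.
suff : ((x 0 l - y 0 l) / r) ^+ 2 <= 1 by move: (_ ^+ 2) => z z1; lra.
rewrite -[_ ^+ 2]real_normK ?num_real// expr_le1// normrM normfV (gtr0_norm r0).
rewrite ler_pdivrMr// mul1r; apply: le_trans xy.
by have := norm_coord_le (x - y) 0 l; rewrite !mxE.
Qed.

Lemma bump_eq0 y r x : 0 < r -> 2 * r <= `|x - y| -> bump y r x = 0.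
Proof.
move=> r0 xy; have n0 : mx_norm (x - y) != 0.
  by rewrite gt_eqF// (lt_le_trans _ xy)// mulr_gt0.
have [[i l] /= E] := mx_norm_neq0 n0.
move: xy; rewrite /Num.Def.normr /= E (ord1 i) !mxE => xl.
rewrite /bump (bigD1 l)//= step_eq0 ?mul0r//.
suff : 4 <= ((x 0 l - y 0 l) / r) ^+ 2 by move: (_ ^+ 2) => z z4; lra.
rewrite -[_ ^+ 2]real_normK ?num_real// normrM normfV (gtr0_norm r0).
have : 2 <= `|x 0 l - y 0 l| / r by rewrite ler_pdivlMr.
move: (_ / r) => t t2; rewrite expr2; nra.
Qed.

End Bump.

(** * Iterated integrals of compactly supported continuous functions *)

Section Integral1.
Context {R : realType}.
Local Notation mu := (@lebesgue_measure R).

Definition cc1 (B : R) (F : R -> R) := continuous F /\ forall t, B < `|t| -> F t = 0.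

Lemma cc1_integral (B C : R) F : cc1 B F -> B <= C ->
  (\int[mu]_(t in [set: R]) F t)%R = (\int[mu]_(t in `[(- C), C]) F t)%R.
Proof.
move=> [_ F0] BC; rewrite [RHS]Rintegral_mkcond; congr (Rintegral _ _ _).
apply/funext => t; rewrite patchE; case: ifPn => // /negP tB.
apply: F0; rewrite ltNge; apply/negP => tB'; apply: tB.
by rewrite inE /= in_itv /= -ler_norml (le_trans tB').
Qed.

Lemma cc1_integrable (B C D : R) F : cc1 B F -> mu.-integrable `[C, D] (EFin \o F).
Proof.
move=> [cF _]; apply: continuous_compact_integrable; first exact: segment_compact.
exact: continuous_subspaceT.
Qed.

Lemma cc1_linear (B a b : R) F G : cc1 B F -> cc1 B G ->
  (\int[mu]_(t in [set: R]) (a * F t + b * G t))%R =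
  a * (\int[mu]_(t in [set: R]) F t)%R + b * (\int[mu]_(t in [set: R]) G t)%R.
Proof.
move=> HF HG; have HFG : cc1 B (fun t => a * F t + b * G t).
  case: HF HG => cF F0 [cG G0]; split.
    by move=> t; apply: cvgD; apply: cvgMr; [exact: cF|exact: cG].
  by move=> t tB; rewrite F0// G0// !mulr0 addr0.
have iF := cc1_integrable (- B) B HF; have iG := cc1_integrable (- B) B HG.
rewrite (cc1_integral HFG (lexx _)) (cc1_integral HF (lexx _)) (cc1_integral HG (lexx _)).
have iaF : mu.-integrable `[(- B), B] (EFin \o (fun t => a * F t)).
  apply: (@cc1_integrable B); case: HF => cF F0; split.
    by move=> t; apply: cvgMr; exact: cF.
  by move=> t tB; rewrite F0// mulr0.
have ibG : mu.-integrable `[(- B), B] (EFin \o (fun t => b * G t)).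
  apply: (@cc1_integrable B); case: HG => cG G0; split.
    by move=> t; apply: cvgMr; exact: cG.
  by move=> t tB; rewrite G0// mulr0.
by rewrite RintegralD// !RintegralZl.
Qed.

Lemma cc1_bound (B c : R) F : 0 < B -> cc1 B F -> (forall t, `|F t| <= c) ->
  `|(\int[mu]_(t in [set: R]) F t)%R| <= 2 * B * c.
Proof.
move=> B0 HF Fc; rewrite (cc1_integral HF (lexx _)).
apply: le_trans (le_normr_Rintegral _ _) _ => //; first exact: cc1_integrable HF.
have -> : 2 * B * c = (\int[mu]_(t in `[(- B), B]) (cst c t))%R.
  rewrite Rintegral_cst// /= lebesgue_measure_itv/= lte_fin ifT ?gtrN//=.
  by rewrite opprK mulrC mulr_natl mulr2n.
apply: le_Rintegral => //.
  apply: (@cc1_integrable B _ _ (fun t => `|F t|)); case: HF => cF F0; split.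
    by move=> t; apply: cvg_norm; exact: cF.
  by move=> t tB; rewrite F0// normr0.
apply: continuous_compact_integrable; first exact: segment_compact.
by apply: continuous_subspaceT => t; exact: cvg_cst.
Qed.

Lemma cc1_gt0 (B : R) F t0 : cc1 B F -> (forall t, 0 <= F t) -> 0 < F t0 ->
  0 < (\int[mu]_(t in [set: R]) F t)%R.
Proof.
move=> HF F0 Ft0; pose c := F t0 / 2; have c0 : 0 < c by rewrite divr_gt0.
have [d d0 dP] := continuous_dist_lt c0 (HF.1 t0).
pose J : set R := `[t0 - d / 2, t0 + d / 2]%classic.
apply: (@lt_le_trans _ _ (\int[mu]_(t in [set: R]) ((cst c \_ J) t))%R).
  rewrite -Rintegral_mkcond Rintegral_cst//=; last exact: measurable_itv.
  rewrite lebesgue_measure_itv/= lte_fin ifT; last by lra.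
  rewrite /=; apply: mulr_gt0 => //; lra.
apply: (@le_Rintegral _ _ _ mu [set: R] (cst c \_ J) F) => //.
- rewrite -restrict_EFin.
  apply: (integrable_mkcond (mu:=mu) (EFin \o cst c) (measurable_itv `[t0 - d / 2, t0 + d / 2])).1.
  apply: continuous_compact_integrable; first exact: segment_compact.
  by apply: continuous_subspaceT => t; exact: cvg_cst.
- have -> : F = F \_ `[(- B), B]%classic.
    apply/funext => t; rewrite patchE; case: ifPn => // /negP tB.
    apply: HF.2; rewrite ltNge; apply/negP => tB'; apply: tB.
    by rewrite inE /= in_itv /= -ler_norml.
  rewrite -restrict_EFin.
  apply: (integrable_mkcond (mu:=mu) (EFin \o F) (measurable_itv `[(- B), B])).1.
  exact: cc1_integrable HF.
- move=> t _; rewrite patchE; case: ifPn => // tJ.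
  have tJ' : J t by move: tJ; rewrite inE.
  move: tJ'; rewrite /J /= in_itv /= => /andP[t1 t2].
  have /dP : `|t - t0| < d by rewrite ltr_norml; apply/andP; split; lra.
  by rewrite ler_norml /c => /andP[h _]; lra.
Qed.

End Integral1.

Section IntegralRV.
Context {R : realType}.

Definition cc_rV (m : nat) (B : R) (f : 'rV[R]_m -> R) :=
  continuous f /\ forall x, B < `|x| -> f x = 0.

Let cons_rV (m : nat) (t : R) (x : 'rV[R]_m) : 'rV[R]_m.+1 :=
  row_mx (const_mx t : 'rV[R]_1) x.

Let cons_rV0 m t (x : 'rV[R]_m) : cons_rV t x 0 ord0 = t.
Proof.
rewrite /cons_rV [ord0](_ : _ = lshift m (ord0 : 'I_1)); last exact: val_inj.
by rewrite (row_mxEl (const_mx t : 'rV[R]_1) x) mxE.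
Qed.

Let cons_rVS m t (x : 'rV[R]_m) i : cons_rV t x 0 (lift ord0 i) = x 0 i.
Proof.
rewrite /cons_rV [lift ord0 i](_ : _ = rshift 1 i); last exact: val_inj.
by rewrite (row_mxEr (const_mx t : 'rV[R]_1) x).
Qed.

Let cons_rV_dist m (s t c : R) (x y : 'rV[R]_m) : `|s - t| <= c -> `|x - y| <= c ->
  `|cons_rV s x - cons_rV t y| <= c.
Proof.
move=> st xy; apply: mx_norm_leP; first exact: le_trans st.
move=> i j; rewrite (ord1 i) mxE [X in _ + X]mxE; have [k ->|->] := unliftP ord0 j.
  rewrite !cons_rVS; apply: le_trans xy.
  by have := norm_coord_le (x - y) 0 k; rewrite !mxE.
by rewrite !cons_rV0.
Qed.

Let le_cons_rV m t (x : 'rV[R]_m) : `|x| <= `|cons_rV t x|.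
Proof.
apply: mx_norm_leP => // i j; rewrite (ord1 i) -(cons_rVS t).
exact: norm_coord_le.
Qed.

Let le_cons_rV0 m t (x : 'rV[R]_m) : `|t| <= `|cons_rV t x|.
Proof. by rewrite -{1}(cons_rV0 t x); exact: norm_coord_le. Qed.

Let cons_rV_cont m (s : R) (x : 'rV[R]_m) (f : 'rV[R]_m.+1 -> R) (e : R) :
  0 < e -> continuous f -> exists2 d : R, 0 < d &
  forall t y, `|t - s| < d -> `|y - x| < d -> `|f (cons_rV t y) - f (cons_rV s x)| <= e.
Proof.
move=> e0 cf; have [d d0 dP] := continuous_dist_lt e0 (cf (cons_rV s x)).
exists (d / 2); first by rewrite divr_gt0.
move=> t y ts yx; apply: dP; apply: (@le_lt_trans _ _ (d / 2)); last by lra.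
by apply: cons_rV_dist; apply: ltW.
Qed.

Let slice_cc m (B t : R) (f : 'rV[R]_m.+1 -> R) :
  cc_rV B f -> cc_rV B (fun x => f (cons_rV t x)).
Proof.
move=> [cf f0]; split; last first.
  by move=> x Bx; apply: f0; apply: lt_le_trans Bx _; exact: le_cons_rV.
move=> x; apply: dist_lt_continuous => e e0.
have [d d0 dP] := cons_rV_cont t x e0 cf.
by exists d => // y yx; apply: dP => //; rewrite subrr normr0.
Qed.

(** Slices are uniformly close because the support is compact. *)
Let slice_unif m (B s e : R) (f : 'rV[R]_m.+1 -> R) : cc_rV B f -> 0 < e ->
  \forall t \near s, forall x, `|f (cons_rV t x) - f (cons_rV s x)| <= e.
Proof.
move=> [cf f0] e0; pose K : set 'rV[R]_m := [set x | `|x| <= B].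
have cK : compact K.
  apply: bounded_closed_compact.
    exists B; split; first exact: num_real.
    by move=> M BM x; rewrite /K /= => /le_trans; apply; exact: ltW.
  have -> : K = (fun x : 'rV[R]_m => `|x|) @^-1` [set y | y <= B] by [].
  apply: preimage_closed; last exact: closed_le.
  by move=> x _; exact: norm_continuous.
have e20 : 0 < e / 2 by rewrite divr_gt0.
have N : \forall t \near s, K `<=` (fun x => `|f (cons_rV t x) - f (cons_rV s x)| <= e).
  apply: (iffLR (compact_near_coveringP K) cK R (nbhs s)
    (fun t x => `|f (cons_rV t x) - f (cons_rV s x)| <= e)) => x _.
  have [d d0 dP] := cons_rV_cont s x e20 cf.
  exists ([set y | `|y - x| < d], [set t | `|t - s| < d]).
    split; apply/nbhs_ballP; exists d => // y; by rewrite -ball_normE /ball_ /= distrC.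
  move=> [y t] /= [yx ts].
  rewrite -[X in `|X|](subrKA (f (cons_rV s x))); apply: le_trans (ler_normD _ _) _.
  rewrite [leRHS]splitr; apply: lerD; first exact: dP.
  by rewrite distrC; apply: dP => //; rewrite subrr normr0.
apply: filterS N => t Kt x; have [xB|xB] := leP `|x| B; first exact: Kt.
have z u : f (cons_rV u x) = 0 by apply: f0; apply: lt_le_trans xB _; exact: le_cons_rV.
by rewrite !z subrr normr0 ltW.
Qed.

(** The four properties are proved together by induction on the dimension: the inner
    integral is again continuous with compact support, and its continuity in the first
    coordinate uses linearity and the bound in one dimension less. *)
Lemma integral_rV_props (m : nat) (B : R) : 0 < B ->
  [/\ forall (a b : R) f g, cc_rV B f -> cc_rV B g ->
        integral_rV (fun x : 'rV[R]_m => a * f x + b * g x) =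
        a * integral_rV f + b * integral_rV g,
      forall (c : R) (f : 'rV[R]_m -> R), cc_rV B f -> 0 <= c ->
        (forall x, `|f x| <= c) -> `|integral_rV f| <= (2 * B) ^+ m * c,
      forall f : 'rV[R]_m -> R, (forall x, 0 <= f x) -> 0 <= integral_rV f
    & forall (f : 'rV[R]_m -> R) x0, cc_rV B f -> (forall x, 0 <= f x) -> 0 < f x0 ->
        0 < integral_rV f].
Proof.
move=> B0; elim: m => [|m [lin bnd ge0 gt0]].
  split => //=.
  - by move=> c f _ _; rewrite expr0 mul1r.
  - move=> f x0 _ _; by rewrite [x0](_ : _ = 0)//; apply/rowP => -[].
  have F_cc (f : 'rV[R]_m.+1 -> R) : cc_rV B f ->
    cc1 B (fun t => integral_rV (fun x : 'rV[R]_m => f (cons_rV t x))).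
  move=> Hf; split; last first.
    move=> t Bt; have z x : f (cons_rV t x) = 0.
      by apply: Hf.2; apply: lt_le_trans Bt _; exact: le_cons_rV0.
    have := bnd 0 _ (slice_cc t Hf) (lexx _).
    rewrite mulr0 normr_le0 => h; apply/eqP; apply: h => x.
    by rewrite z normr0.
  move=> s; apply/cvgrPdistC_le => /= e e0.
  pose e' := e / (2 * B) ^+ m.
  have BM : 0 < (2 * B) ^+ m by rewrite exprn_gt0// mulr_gt0.
  have e'0 : 0 < e' by rewrite divr_gt0.
  apply: filterS (slice_unif s Hf e'0) => t ts.
  have -> : integral_rV (fun x => f (cons_rV t x)) - integral_rV (fun x => f (cons_rV s x))
     = integral_rV (fun x => f (cons_rV t x) - f (cons_rV s x)).
    have := lin 1 (-1) _ _ (slice_cc t Hf) (slice_cc s Hf).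
    rewrite mul1r mulN1r => <-; congr (integral_rV _); apply/funext => x.
    by rewrite mul1r mulN1r.
  have -> : e = (2 * B) ^+ m * e' by rewrite /e' mulrC divfK// gt_eqF.
  apply: bnd => //; last exact: ltW.
  have [c1 z1] := slice_cc t Hf; have [c2 z2] := slice_cc s Hf; split.
    by move=> x; apply: continuousB; [exact: c1|exact: c2].
  by move=> x Bx; rewrite z1// z2// subrr.
split.
- move=> a b f g Hf Hg /=.
  rewrite -(cc1_linear _ _ (F_cc _ Hf) (F_cc _ Hg)); congr (Rintegral _ _ _).
  apply/funext => t; exact: (lin a b _ _ (slice_cc t Hf) (slice_cc t Hg)).
- move=> c f Hf c0 fc /=; rewrite exprS -mulrA.
  apply: (cc1_bound B0 (F_cc _ Hf)) => t.
  by apply: bnd => //; exact: slice_cc.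
- move=> f f0 /=; apply: Rintegral_ge0 => t _; exact: ge0.
- move=> f x0 Hf f0 fx0 /=.
  apply: (cc1_gt0 (t0 := x0 0 ord0) (F_cc _ Hf)); first by move=> t; exact: ge0.
  apply: (gt0 _ (\row_j x0 0 (lift ord0 j)) (slice_cc _ Hf)) => //.
  rewrite [cons_rV _ _](_ : _ = x0)//; apply/rowP => j.
  by have [k ->|->] := unliftP ord0 j; rewrite ?cons_rVS ?cons_rV0 ?mxE.
Qed.

End IntegralRV.

(** * Linear algebra of the contact condition *)

Section Wedge.
Context {R : realType} (m : nat).
Local Notation V := 'rV[R]_m.
Local Notation e_ l := (delta_mx 0 l : 'rV[R]_m).

Definition upd k (v : 'I_k -> V) (j : 'I_k) (x : V) : 'I_k -> V :=
  fun i => if i == j then x else v i.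

(** Multilinearity, for forms that are plain functions of k vectors. *)
Definition slot_linear k (b : kform R V k) := forall v j (c : R) x y,
  b (upd v j (c *: x + y)) = c * b (upd v j x) + b (upd v j y).

Definition annihilated k (b : kform R V k) (x : V) := forall v j, v j = x -> b v = 0.

Lemma slot_linear_sum k (b : kform R V k) v j (I : Type) (r : seq I) (c : I -> R) (x : I -> V) :
  slot_linear b ->
  b (upd v j (\sum_(i <- r) c i *: x i)) = \sum_(i <- r) c i * b (upd v j (x i)).
Proof.
move=> lb; elim: r => [|i r IH]; last by rewrite !big_cons lb IH.
rewrite !big_nil; have := lb v j (-1) 0 0.
by rewrite scaler0 addr0 mulN1r addNr.
Qed.

Lemma upd_shift k p (v : 'I_p -> V) (j : 'I_p) x (t : 'I_k -> 'I_p) i : injective t ->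
  t i = j -> (fun i => upd v j x (t i)) = upd (fun i => v (t i)) i x.
Proof.
move=> it tij; apply/funext => i'; rewrite /upd -tij.
by rewrite (inj_eq it).
Qed.

Lemma upd_noshift k p (v : 'I_p -> V) (j : 'I_p) x (t : 'I_k -> 'I_p) :
  (forall i, t i != j) -> (fun i => upd v j x (t i)) = (fun i => v (t i)).
Proof. by move=> it; apply/funext => i'; rewrite /upd (negbTE (it i')). Qed.

Section pq.
Variables (p q : nat) (a : kform R V p) (b : kform R V q).

Lemma slot_linear_wedge : slot_linear a -> slot_linear b -> slot_linear (wedge a b).
Proof.
move=> la lb v j c x y; rewrite /wedge.
rewrite mulrCA -mulrDr; congr (_ * _); rewrite mulr_sumr -big_split /=.
apply: eq_bigr => s _.
have injl : injective (fun i => s (lshift q i)) by move=> i i' /perm_inj /lshift_inj.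
have injr : injective (fun i => s (rshift p i)) by move=> i i' /perm_inj /rshift_inj.
case E : (fintype.split ((s^-1)%g j)) => [i|i].
- have si : s (lshift q i) = j.
    have := splitK ((s^-1)%g j); rewrite E /= => ->.
    by rewrite permKV.
  rewrite !(upd_shift _ _ injl si).
  have nr i' : s (rshift p i') != j.
    by rewrite -si (inj_eq perm_inj) eq_sym eq_lrshift.
  rewrite !(upd_noshift _ _ nr) la mulrDr mulrDl; congr (_ + _).
  by rewrite mulrCA !mulrA.
- have si : s (rshift p i) = j.
    have := splitK ((s^-1)%g j); rewrite E /= => ->.
    by rewrite permKV.
  rewrite !(upd_shift _ _ injr si).
  have nr i' : s (lshift q i') != j.
    by rewrite -si (inj_eq perm_inj) eq_lrshift.
  by rewrite !(upd_noshift _ _ nr) lb mulrDr; congr (_ + _); rewrite mulrCA.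
Qed.

Lemma annihilated_wedge x : annihilated a x -> annihilated b x -> annihilated (wedge a b) x.
Proof.
move=> ka kb v j vj; rewrite /wedge big1 ?mulr0// => s _.
case E : (fintype.split ((s^-1)%g j)) => [i|i].
- have si : s (lshift q i) = j.
    have := splitK ((s^-1)%g j); rewrite E /= => ->.
    by rewrite permKV.
  by rewrite (ka _ i) ?si// mulr0 mul0r.
- have si : s (rshift p i) = j.
    have := splitK ((s^-1)%g j); rewrite E /= => ->.
    by rewrite permKV.
  by rewrite (kb _ i) ?si// mulr0.
Qed.

(** Composing the permutations with the transposition of i and j does not change the
    arguments but changes the sign, whatever the two factors are. *)
Lemma wedge_alternating v (i j : 'I_(p + q)) : i != j -> v i = v j -> wedge a b v = 0.
Proof.
move=> ij vij; rewrite /wedge.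
set S := \sum_s _; suff -> : S = 0 by rewrite mulr0.
have vt k : v (tperm i j k) = v k by case: tpermP => // ->.
have : S = - S.
  rewrite {1}/S (reindex_inj (mulIg (tperm i j))) /= /S -sumrN.
  apply: eq_bigr => s _.
  rewrite odd_permM odd_tperm ij /= signr_addb expr1 mulrN1 !mulNr.
  congr (- (_ * a _ * b _)); apply/funext => k; by rewrite permM vt.
move/eqP; rewrite -addr_eq0 -mulr2n mulrn_eq0 /= => /eqP.
exact.
Qed.

End pq.

Lemma slot_linear_pow (w : kform R V 2) n : slot_linear w -> slot_linear (wedge_pow w n).
Proof.
move=> lw; elim: n => [|n IH] /=; first by move=> v [].
exact: (slot_linear_wedge lw IH).
Qed.

Lemma annihilated_pow (w : kform R V 2) n x : annihilated w x -> annihilated (wedge_pow w n) x.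
Proof.
move=> lw; elim: n => [|n IH] /=; first by move=> v [].
exact: (annihilated_wedge lw IH).
Qed.

Definition form1 (a : 'cV[R]_m) : kform R V 1 := fun v => (v ord0 *m a) 0 0.
Definition form2 (W : 'M[R]_m) : kform R V 2 := fun v => (v ord0 *m W *m (v ord_max)^T) 0 0.

Lemma slot_linear_form1 a : slot_linear (form1 a).
Proof.
move=> v j c x y; rewrite /form1 /upd (ord1 j) eqxx.
by rewrite mulmxDl -scalemxAl !mxE.
Qed.

Lemma slot_linear_form2 W : slot_linear (form2 W).
Proof.
move=> v j c x y; rewrite /form2 /upd.
have [->|j0] : j = ord0 \/ j = ord_max.
  by case: j => -[|[|//]] h; [left|right]; exact: val_inj.
  by rewrite eqxx /= !mulmxDl -!scalemxAl !mxE.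
by rewrite j0 eqxx /= linearD linearZ /= mulmxDr -scalemxAr !mxE.
Qed.

End Wedge.

Section Nondegenerate.
Context {R : realType} (n : nat).
Local Notation m := (n.*2.+1).
Local Notation e_ l := (delta_mx 0 l : 'rV[R]_m).
Variables (a : 'cV[R]_m) (W : 'M[R]_m).
Hypothesis vol0 : wedge (form1 a) (wedge_pow (form2 W) n) (fun l : 'I_m => e_ l) != 0.
Hypothesis skew : W^T = - W.

(** If v is in the kernel of a and of W, every term of a /\ W^n with an argument v
    vanishes. Replacing by v a basis vector e_l with v_l <> 0 multiplies the value on
    the basis by v_l, all other contributions having a repeated argument. *)
Lemma volume_nondegenerate (v : 'rV[R]_m) : v *m a = 0 -> v *m W = 0 -> v = 0.
Proof.
move=> va vW; apply/eqP; rewrite -[_ == _]negbK; apply/negP => v0.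
case/eqP: vol0.
have [l vl] : exists l, v 0 l != 0.
  apply/existsP; rewrite -negb_forall; apply: contra v0 => /forallP h.
  by apply/eqP/rowP => l; rewrite mxE; apply/eqP; exact: h.
set b := wedge _ _.
have lb : slot_linear (b : kform R 'rV[R]_m m).
  have h := slot_linear_wedge (@slot_linear_form1 _ _ a)
    (slot_linear_pow (n := n) (@slot_linear_form2 _ _ W)).
  exact h.
have kb : annihilated (b : kform R 'rV[R]_m m) v.
  have k1 : annihilated (form1 a) v.
    move=> u j uj; have j0 : ord0 = j by apply/esym/ord1.
    by rewrite /form1 j0 uj va mxE.
  have k2 : annihilated (form2 W) v.
    move=> u j uj; rewrite /form2.
    have [j0|j0] : j = ord0 \/ j = ord_max.
      by case: (j) => -[|[|//]] h; [left|right]; exact: val_inj.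
      by rewrite -j0 uj vW mul0mx mxE.
    rewrite -j0 uj -mulmxA -[W]trmxK -trmx_mul skew mulmxN vW oppr0 trmx0 mulmx0.
    by rewrite mxE.
  exact: (annihilated_wedge k1 (annihilated_pow (n := n) k2)).
have E := slot_linear_sum (fun l => e_ l) l (index_enum _) (fun j => v 0 j) (fun j => e_ j) lb.
rewrite -row_sum_delta (kb _ l) in E; last by rewrite /upd eqxx.
have : v 0 l * b (fun l => e_ l) = 0.
  rewrite E (bigD1 l)//= big1 ?addr0; last first.
    move=> j jl; rewrite [b _](_ : _ = 0) ?mulr0//.
    apply: (@wedge_alternating _ _ 1 n.*2 _ _ _ j l jl).
    by rewrite /upd eqxx (negbTE jl).
  congr (_ * b _); apply/funext => j; rewrite /upd.
  by case: eqP => [->|].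
by move/eqP; rewrite mulf_eq0 (negbTE vl) => /eqP.
Qed.

Lemma volume_form_neq0 : a != 0.
Proof.
apply: contra vol0 => /eqP a0; rewrite /wedge big1 ?mulr0// => s _.
by rewrite /form1 a0 mulmx0 mxE mulr0 mul0r.
Qed.

(** If W vanished on the hyperplane ker a, then any v in ker a with W (v, Z) = 0 would
    violate nondegeneracy. These are two linear conditions in dimension 2 n + 1 >= 3,
    which is where n > 0 is used. *)
Lemma volume_symplectic_pair : (0 < n)%N -> exists X Y Z : 'rV[R]_m,
  [/\ X *m a = 0, Y *m a = 0, (Z *m a) 0 0 = 1 & (X *m W *m Y^T) 0 0 = 1].
Proof.
move=> n0.
have [Z Za] : exists Z : 'rV[R]_m, Z *m a = 1%:M.
  have [l al] : exists l, a l 0 != 0.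
    apply/existsP; rewrite -negb_forall; apply: contra volume_form_neq0 => /forallP h.
    by apply/eqP/colP => l; rewrite mxE; apply/eqP; exact: h.
  exists ((a l 0)^-1 *: e_ l); rewrite -scalemxAl -rowE; apply/matrixP => i j.
  by rewrite !mxE (ord1 i) (ord1 j) eqxx mulVf.
have [[X [Y [Xa Ya XY]]]|h] := pselect (exists X Y : 'rV[R]_m,
    [/\ X *m a = 0, Y *m a = 0 & (X *m W *m Y^T) 0 0 != 0]).
  exists (((X *m W *m Y^T) 0 0)^-1 *: X), Y, Z; split => //.
  - by rewrite -scalemxAl Xa scaler0.
  - by rewrite Za mxE eqxx.
  - by rewrite -!scalemxAl mxE mulVf.
exfalso.
have [v v0 vK] : exists2 v : 'rV[R]_m, v != 0 & v *m row_mx a (W *m Z^T) = 0.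
  have : kermx (row_mx a (W *m Z^T)) != 0.
    rewrite kermx_eq0 -row_leq_rank -ltnNge; apply: (leq_ltn_trans (rank_leq_col _)).
    by rewrite ltnS -[(1 + 1)%N]/(1.*2)%N leq_double.
  by move=> /rowV0Pn[v /sub_kermxP vK v0]; exists v.
rewrite mul_mx_row -[0]row_mx0 in vK; have [va vWZ] := eq_row_mx vK.
case/negP: v0; apply/eqP; apply: volume_nondegenerate => //.
apply/rowP => l; rewrite [RHS]mxE.
have -> : (v *m W) 0 l = (v *m W *m (e_ l)^T) 0 0.
  by rewrite trmx_delta -colE [RHS]mxE.
pose w := e_ l - (e_ l *m a) 0 0 *: Z.
have wa : w *m a = 0.
  rewrite /w mulmxBl -scalemxAl Za; apply/matrixP => i j.
  by rewrite (ord1 i) (ord1 j) !mxE eqxx mulr1 subrr.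
have -> : e_ l = w + (e_ l *m a) 0 0 *: Z by rewrite /w subrK.
rewrite linearD linearZ /= mulmxDr -scalemxAr -[v *m W *m Z^T]mulmxA vWZ scaler0 addr0.
apply/eqP; rewrite -[_ == _]negbK; apply/negP => h'; apply: h; exists v, w; split => //.
Qed.

End Nondegenerate.

Section ReebControl.
Context {R : realType} (m : nat).

Lemma norm_mulmx_le (p q r : nat) (u : 'M[R]_(p, q)) (M : 'M[R]_(q, r)) :
  `|u *m M| <= q%:R * `|u| * `|M|.
Proof.
apply: mx_norm_leP => [|i j]; first by rewrite !mulr_ge0.
rewrite mxE; apply: le_trans (ler_norm_sum _ _ _) _.
apply: (@le_trans _ _ (\sum_(k < q) `|u| * `|M|)).
  apply: ler_sum => k _; rewrite normrM; apply: ler_pM => //; exact: norm_coord_le.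
rewrite sumr_const card_ord -[leLHS]mulr_natl.
by rewrite mulrA.
Qed.

(** Near a point where (a, W) is nondegenerate, a vector in the kernel of W is bounded
    by its a-component: (a, W) has a left inverse at y0, and the error made by using it
    at a nearby point is absorbed in the left-hand side. In terms of the Reeb field,
    the field is locally bounded, and transverse to the kernel of the constant
    covector a y0. *)
Lemma reeb_control (a : 'rV[R]_m -> 'cV[R]_m) (W : 'rV[R]_m -> 'M[R]_m) (y0 : 'rV[R]_m) :
  {for y0, continuous a} -> {for y0, continuous W} ->
  (forall v : 'rV[R]_m, v *m a y0 = 0 -> v *m W y0 = 0 -> v = 0) ->
  exists2 C : R, 0 < C & exists2 d : R, 0 < d & forall y, `|y - y0| < d ->
    forall v : 'rV[R]_m, v *m W y = 0 ->
      `|v| <= C * `|v *m a y| /\ `|v *m a y0 - v *m a y| <= 2^-1 * `|v *m a y|.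
Proof.
move=> ca cW nd.
have [B1 [B2 BE]] : exists (B1 : 'rV[R]_m) (B2 : 'M[R]_m), a y0 *m B1 + W y0 *m B2 = 1%:M.
  have /row_freeP[B] : row_free (row_mx (a y0) (W y0)).
    rewrite -kermx_eq0; apply/rowV0P => v /sub_kermxP.
    rewrite mul_mx_row -[0]row_mx0 => /eq_row_mx[]; exact: nd.
  rewrite -[B]vsubmxK mul_row_col => BE.
  by exists (usubmx B), (dsubmx B).
have [M mE M0] : exists2 M : R, m%:R = M & 0 <= M by exists m%:R.
have [b1 b1E b10] : exists2 b1 : R, `|B1| = b1 & 0 <= b1 by exists `|B1|.
have [b2 b2E b20] : exists2 b2 : R, M * `|B2| * M = b2 & 0 <= b2.
  by exists (M * `|B2| * M); rewrite ?mulr_ge0.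
pose C := 2 * (b1 + 1).
pose eta := (2 * (M * C * (b1 + 1) + b2 + b1 * M + 1))^-1.
have C0 : 0 < C by rewrite /C; lra.
have D0 : 0 < 2 * (M * C * (b1 + 1) + b2 + b1 * M + 1).
  have h1 : 0 <= M * C * (b1 + 1) by rewrite !mulr_ge0 ?addr_ge0// ltW.
  have h2 : 0 <= b1 * M by rewrite mulr_ge0.
  lra.
have eta0 : 0 < eta by rewrite invr_gt0.
have [d1 d10 dP1] := continuous_dist_lt eta0 ca.
have [d2 d20 dP2] := continuous_dist_lt eta0 cW.
exists C => //; exists (Num.min d1 d2); first by rewrite lt_min d10.
move=> y; rewrite lt_min => /andP[/dP1 ya /dP2 yW] v vW.
have : exists2 t : R, `|v *m a y| = t & 0 <= t by exists `|v *m a y|.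
move=> [t tE t0]; rewrite tE.
have s1 : `|v *m a y0 - v *m a y| <= M * `|v| * eta.
  rewrite -mulmxBr; apply: le_trans (norm_mulmx_le _ _) _.
  by rewrite mE ler_wpM2l ?mulr_ge0// distrC.
have s2 : `|v *m W y0| <= M * `|v| * eta.
  have -> : v *m W y0 = v *m (W y0 - W y) by rewrite mulmxBr vW subr0.
  apply: le_trans (norm_mulmx_le _ _) _.
  by rewrite mE ler_wpM2l ?mulr_ge0// distrC.
have vE : v = (v *m a y0) *m B1 + (v *m W y0) *m B2.
  by rewrite -!mulmxA -mulmxDr BE mulmx1.
have n1 : `|v *m a y0| <= t + M * `|v| * eta.
  rewrite -[v *m a y0](subrK (v *m a y)) addrC; apply: le_trans (ler_normD _ _) _.
  by rewrite tE lerD2l.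
have n2 : `|v| <= (t + M * `|v| * eta) * b1 + M * (M * `|v| * eta) * `|B2|.
  rewrite {1}vE; apply: le_trans (ler_normD _ _) _; apply: lerD.
    apply: le_trans (norm_mulmx_le _ _) _.
    by rewrite mul1r b1E ler_wpM2r.
  apply: le_trans (norm_mulmx_le _ _) _.
  by rewrite mE ler_wpM2r// ler_wpM2l.
have h1 : M * C * (b1 + 1) * eta <= 2^-1.
  rewrite /eta ler_pdivrMr//.
  have h2 : 0 <= b1 * M by rewrite mulr_ge0.
  lra.
have h2 : (b2 + b1 * M) * eta <= 2^-1.
  rewrite /eta ler_pdivrMr//.
  have h2 : 0 <= M * C * (b1 + 1) by rewrite !mulr_ge0 ?addr_ge0// ltW.
  lra.
have n3 : `|v| <= C * t.
  have n4 : `|v| <= t * b1 + (b2 + b1 * M) * eta * `|v|.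
    by apply: le_trans n2 _; rewrite -b2E; lra.
  have n5 : (b2 + b1 * M) * eta * `|v| <= 2^-1 * `|v| by rewrite ler_wpM2r.
  have n6 : 0 <= `|v| by [].
  rewrite /C; lra.
split => //; apply: le_trans s1 _.
have n7 : M * eta * `|v| <= M * eta * (C * t) by rewrite ler_wpM2l// mulr_ge0// ltW.
have n8 : M * C * eta <= M * C * (b1 + 1) * eta.
  rewrite ler_wpM2r ?(ltW eta0)// ler_peMr ?mulr_ge0 ?(ltW C0)//; lra.
have n9 : M * C * eta * t <= 2^-1 * t by rewrite ler_wpM2r//; lra.
lra.
Qed.

End ReebControl.

(** * Bump functions and partitions of unity on a manifold *)

Section Topology.

(** Compactness in near-covering form, along the filter of all finite sequences that
    contain a given one. *)
Lemma compact_finite_cover (T : topologicalType) (K : set T) (O : T -> set T) :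
  compact K -> (forall x, K x -> nbhs x (O x)) ->
  exists s : seq T, forall y, K y -> exists2 x, x \in s & O x y.
Proof.
move=> /compact_near_coveringP cK KO.
pose F : set_system (seq T) :=
  [set S | exists s0 : seq T, forall s : seq T, {subset s0 <= s} -> S s].
have FF : Filter F.
  split.
  - by exists [::].
  - move=> P Q [s1 h1] [s2 h2]; exists (s1 ++ s2) => s hs; split.
      by apply: h1 => x xs; apply: hs; rewrite mem_cat xs.
    by apply: h2 => x xs; apply: hs; rewrite mem_cat xs orbT.
  - by move=> P Q PQ [s1 h1]; exists s1 => s /h1 /PQ.
have [s hs] : F (fun s => K `<=` (fun y => exists2 x, x \in s & O x y)).
  apply: (cK _ F (fun s y => exists2 x, x \in s & O x y)) => x Kx.
  exists (O x, [set s : seq T | x \in s]).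
    split => /=; first exact: KO.
    by exists [:: x] => s; apply; rewrite inE.
  by move=> [y s] /= [Oy xs]; exists x.
by exists s; exact: hs.
Qed.

Lemma open_preimage_in (S T : topologicalType) (A : set S) (B : set T) (f : S -> T) :
  open A -> open B -> (forall x, A x -> {for x, continuous f}) ->
  open (A `&` f @^-1` B).
Proof.
move=> oA oB cf; rewrite openE => x [Ax Bfx].
apply: filterI; first exact: open_nbhs_nbhs.
by apply: (cf x Ax); exact: open_nbhs_nbhs.
Qed.

Lemma compact_image_in (S T : topologicalType) (A : set S) (f : S -> T) :
  (forall x, A x -> {for x, continuous f}) -> compact A -> compact (f @` A).
Proof.
move=> cf; apply: continuous_compact; apply: continuous_in_subspaceT => x.
by rewrite inE => /cf.
Qed.

Lemma compact_cball (R : realType) (m : nat) (y : 'rV[R]_m) (r : R) :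
  compact [set x | `|x - y| <= r].
Proof.
apply: bounded_closed_compact.
  exists (`|y| + r); split; first exact: num_real.
  move=> M BM x /= xy; rewrite -[x](subrK y) addrC.
  by apply: le_trans (ler_normD _ _) _; apply: le_trans (ltW BM); rewrite lerD2l.
have -> : [set x | `|x - y| <= r] = (fun x : 'rV[R]_m => `|x - y|) @^-1` [set z | z <= r] by [].
apply: preimage_closed; last exact: closed_le.
move=> x _; apply: dist_lt_continuous => e e0; exists e => // z zx.
apply: le_trans (ler_dist_dist _ _) _; apply/ltW.
by rewrite opprB addrA subrK.
Qed.

End Topology.

Section Manifold.
Context {R : realType} (m : nat) (M : smoothManifold R m).
Implicit Types (i j : atlas M) (p : M) (f g : M -> R).

Lemma open_local_dom (N : smoothManifold R m) (phi : M -> N) (c : chart R m M) (c' : chart R m N) :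
  continuous phi -> open (local_dom phi c c').
Proof.
move=> cphi; apply: open_preimage_in; [exact: target_open|exact: source_open|].
move=> x tx; apply: continuous_comp; first exact: of_rV_continuous.
exact: cphi.
Qed.

Lemma smooth_fun_cst (c : R) : smooth_fun (fun _ : M => c).
Proof. by move=> i k; exact: Ck_cst. Qed.

Lemma smooth_fun_add f g : smooth_fun f -> smooth_fun g -> smooth_fun (fun p => f p + g p).
Proof. by move=> sf sg i k; apply: Ck_add (sf i k) (sg i k); exact: target_open. Qed.

Lemma smooth_fun_mul f g : smooth_fun f -> smooth_fun g -> smooth_fun (fun p => f p * g p).
Proof. by move=> sf sg i k; apply: Ck_mul (sf i k) (sg i k); exact: target_open. Qed.

Lemma smooth_fun_sum (I : Type) (r : seq I) (f : I -> M -> R) :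
  (forall l, smooth_fun (f l)) -> smooth_fun (fun p => \sum_(l <- r) f l p).
Proof. by move=> sf i k; apply: Ck_sum => [|l]; [exact: target_open|exact: sf]. Qed.

Lemma smooth_fun_comp1 (A : set R) (h : R -> R) f : smooth1 A h -> (forall p, A (f p)) ->
  smooth_fun f -> smooth_fun (fun p => h (f p)).
Proof.
move=> sh Af sf i k; apply: (Ck_comp1 (@target_open _ _ _ _) sh) (sf i k) => x _.
exact: Af.
Qed.

Lemma smooth_fun_continuous f : smooth_fun f -> continuous f.
Proof.
move=> sf p; have [i ip] := atlas_cover p.
have cf : {for to_rV (chart_of i) p, continuous (f \o of_rV (chart_of i))}.
  exact: (Ck_cont (sf i 0%N)) (to_rV_target ip).
apply: (@near_eq_continuous_at _ _ ((f \o of_rV (chart_of i)) \o to_rV (chart_of i))).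
  apply: filterS (open_nbhs_nbhs (conj (@source_open _ _ _ _) ip)) => q iq.
  by rewrite /= to_rVK.
apply: continuous_comp; first exact: to_rV_continuous.
exact: cf.
Qed.

Definition zero_ext i (g : 'rV[R]_m -> R) : M -> R :=
  (g \o to_rV (chart_of i)) \_ (source (chart_of i)).

Lemma zero_ext_chart i (g : 'rV[R]_m -> R) x : target (chart_of i) x -> zero_ext i g (of_rV (chart_of i) x) = g x.
Proof.
move=> tx; rewrite /zero_ext patchE mem_set; last exact: of_rV_source.
by rewrite /= of_rVK.
Qed.

Section Support.
Variables (i : atlas M) (g : 'rV[R]_m -> R) (K : set 'rV[R]_m).
Hypotheses (cK : compact K) (Kt : K `<=` target (chart_of i))
  (gK : forall x, target (chart_of i) x -> ~ K x -> g x = 0).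

Lemma closed_chart_image : closed (of_rV (chart_of i) @` K).
Proof.
apply: compact_closed; first exact: manifold_hausdorff.
apply: compact_image_in cK => x /Kt; exact: of_rV_continuous.
Qed.

Lemma zero_ext_out p : ~ (of_rV (chart_of i) @` K) p -> zero_ext i g p = 0.
Proof.
move=> np; rewrite /zero_ext patchE; case: ifPn => // /set_mem ip /=.
apply: gK; first exact: to_rV_target.
by move=> Kp; apply: np; exists (to_rV (chart_of i) p) => //; rewrite to_rVK.
Qed.

Lemma zero_ext_support : closure [set p | zero_ext i g p != 0] `<=` of_rV (chart_of i) @` K.
Proof.
rewrite [X in _ `<=` X](closure_id _).1; last exact: closed_chart_image.
apply: closureS => p /=; apply: contraPP => /zero_ext_out ->.
by rewrite eqxx.
Qed.

Lemma chart_image_source : of_rV (chart_of i) @` K `<=` source (chart_of i).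
Proof. by move=> _ [x /Kt tx <-]; exact: of_rV_source. Qed.

(** In another chart, the extension is either g composed with a change of charts or
    locally 0. The latter holds off the image of K, which is closed because M is
    Hausdorff. *)
Lemma smooth_zero_ext : smooth_on (target (chart_of i)) g -> smooth_fun (zero_ext i g).
Proof.
move=> sg j k; apply: Ck_local => x tx.
have [ix|nix] := pselect (source (chart_of i) (of_rV (chart_of j) x)).
  exists (local_dom id (chart_of j) (chart_of i)); split => //.
  have oU : open (local_dom id (chart_of j) (chart_of i)).
    by apply: open_local_dom => z; exact: cvg_id.
  have h : Ck_on k (local_dom id (chart_of j) (chart_of i))
     (fun y => g (local_expr id (chart_of j) (chart_of i) y)).
    apply: (Ck_comp oU (@target_open _ _ _ (chart_of i)) _ (atlas_compatible j i k) (sg k)).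
    by move=> y [ty sy]; exact: to_rV_target.
  apply: Ck_eq h => // y [ty sy].
  by rewrite /= /zero_ext patchE mem_set.
exists (target (chart_of j) `&` of_rV (chart_of j) @^-1` (~` (of_rV (chart_of i) @` K))).
have oV : open (target (chart_of j) `&` of_rV (chart_of j) @^-1` (~` (of_rV (chart_of i) @` K))).
  apply: open_preimage_in; [exact: target_open| |exact: of_rV_continuous].
  exact: closed_openC closed_chart_image.
split; first by split => // /chart_image_source.
apply: Ck_eq (Ck_cst k _ (0 : R)) => // y [ty /= ny].
by rewrite zero_ext_out.
Qed.

End Support.

Lemma chart_ball p : exists i (r : R), [/\ 0 < r, source (chart_of i) p &
  forall x, `|x - to_rV (chart_of i) p| <= 3 * r -> target (chart_of i) x].
Proof.
have [i ip] := atlas_cover p.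
have [d d0 dP] := nbhs_dist_lt (open_nbhs_nbhs (conj (@target_open _ _ _ (chart_of i)) (to_rV_target ip))).
exists i, (d / 4); split => //; first by rewrite divr_gt0.
by move=> x xp; apply: dP; apply: le_lt_trans xp _; lra.
Qed.

Section ChartBump.
Variables (i : atlas M) (y : 'rV[R]_m) (r : R).
Hypotheses (r0 : 0 < r) (yr : forall x, `|x - y| <= 3 * r -> target (chart_of i) x).

Definition chart_bump : M -> R := zero_ext i (bump y r).

Let K : set 'rV[R]_m := [set x | `|x - y| <= 2 * r].
Let cK : compact K := @compact_cball R m y (2 * r).
Let Kt : K `<=` target (chart_of i).
Proof.
move=> x xy; apply: yr; apply: le_trans xy _.
by rewrite ler_wpM2r ?ler_nat// ltW.
Qed.
Let gK x : target (chart_of i) x -> ~ K x -> bump y r x = 0.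
Proof. by move=> _ /negP; rewrite -ltNge => /ltW; exact: bump_eq0. Qed.

Lemma smooth_chart_bump : smooth_fun chart_bump.
Proof.
apply: (smooth_zero_ext cK Kt gK) => k; apply: Ck_bump; exact: target_open.
Qed.

Lemma chart_bump_ge0 p : 0 <= chart_bump p.
Proof. by rewrite /chart_bump /zero_ext patchE; case: ifP => //= _; exact: bump_ge0. Qed.

Lemma chart_bump_le1 p : chart_bump p <= 1.
Proof. by rewrite /chart_bump /zero_ext patchE; case: ifP => //= _; exact: bump_le1. Qed.

Lemma chart_bump_support : closure [set p | chart_bump p != 0] `<=`
  of_rV (chart_of i) @` [set x | `|x - y| <= 2 * r].
Proof. exact: (zero_ext_support cK Kt gK). Qed.

Lemma chart_bump_out p : ~ (of_rV (chart_of i) @` [set x | `|x - y| <= 2 * r]) p ->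
  chart_bump p = 0.
Proof. exact: (zero_ext_out gK). Qed.

End ChartBump.

(** Finitely many chart bumps have a positive sum; divide by that sum. *)
Lemma exists_partition_of_unity : compact [set: M] ->
  exists (N : nat) (i : 'I_N -> atlas M) (rho : 'I_N -> M -> R), partition_of_unity i rho.
Proof.
move=> cM.
have [c hc] := choice (fun p : M => chart_ball p).
have [r hr] := choice hc.
pose b (p : M) : M -> R := chart_bump (c p) (to_rV (chart_of (c p)) p) (r p).
have bp (p : M) : 0 < b p p.
  have [r0 sp tp] := hr p; rewrite /b /chart_bump /zero_ext patchE mem_set//=.
  by rewrite bump_eq1// subrr normr0 ltW.
have sb (p : M) : smooth_fun (b p) by have [r0 sp tp] := hr p; exact: smooth_chart_bump.
have b0 (p q : M) : 0 <= b p q by exact: chart_bump_ge0.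
have [s hs] : exists s : seq M, forall y, [set: M] y -> exists2 x, x \in s & 0 < b x y.
  apply: (compact_finite_cover (O := fun x => [set y | 0 < b x y]) cM) => x _.
  have cb : {for x, continuous (b x)} by exact: (smooth_fun_continuous (sb x)).
  by apply: (cb [set z : R | 0 < z]); exact: lt_nbhsr.
pose N := size s; pose P (k : 'I_N) : M := tnth (in_tuple s) k.
pose S q := \sum_(k < N) b (P k) q.
have S0 q : 0 < S q.
  have [x xs bx] := hs q I.
  have /tnthP[k xk] : x \in in_tuple s by [].
  rewrite /S (bigD1 k)//= ltr_pwDl//; last by apply: sumr_ge0.
  by rewrite /P -xk.
exists N, (fun k => c (P k)), (fun k q => b (P k) q * (S q)^-1); split.
- move=> k; apply: smooth_fun_mul => //.
  by apply: (smooth_fun_comp1 smooth1_inv S0); exact: smooth_fun_sum.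
- by move=> k q; rewrite mulr_ge0// invr_ge0 ltW.
- move=> k q.
  have [r0 sp tp] := hr (P k).
  have h : closure [set p | b (P k) p * (S p)^-1 != 0] `<=` closure [set p | b (P k) p != 0].
    by apply: closureS => p /=; apply: contraNN => /eqP ->; rewrite mul0r.
  move=> /h /(chart_bump_support r0 tp) [x /= xr <-]; apply: of_rV_source; apply: tp.
  by apply: le_trans xr _; rewrite ler_wpM2r ?ler_nat// ltW.
- move=> q; rewrite -mulr_suml divff//.
  by rewrite gt_eqF//; exact: S0.
Qed.

End Manifold.

(** * Integration against the contact volume *)

Section WedgeContinuity.
Context {R : realType} (m : nat) (T : topologicalType).
Local Notation V := 'rV[R]_m.

Lemma continuous_at_sum (I : Type) (r : seq I) (f : I -> T -> R) x0 :
  (forall i, {for x0, continuous (f i)}) ->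
  {for x0, continuous (fun x => \sum_(i <- r) f i x)}.
Proof.
move=> cf; elim: r => [|i r IH].
  rewrite (_ : (fun _ => _) = (fun=> 0)); first exact: cst_continuous.
  by apply/funext => x; rewrite big_nil.
rewrite (_ : (fun _ => _) = (fun x => f i x + \sum_(j <- r) f j x)).
  by apply: continuousD; [exact: cf|exact: IH].
by apply/funext => x; rewrite big_cons.
Qed.

Lemma continuous_at_wedge p q (a : T -> kform R V p) (b : T -> kform R V q) x0 :
  (forall u, {for x0, continuous (fun x => a x u)}) ->
  (forall u, {for x0, continuous (fun x => b x u)}) ->
  forall v, {for x0, continuous (fun x => wedge (a x) (b x) v)}.
Proof.
move=> ca cb v; rewrite /wedge.
apply: continuousM; first exact: cst_continuous.
apply: continuous_at_sum => s.
by apply: continuousM; [apply: continuousM; [exact: cst_continuous|exact: ca]|exact: cb].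
Qed.

Lemma continuous_at_wedge_pow n (w : T -> kform R V 2) x0 :
  (forall u, {for x0, continuous (fun x => w x u)}) ->
  forall v, {for x0, continuous (fun x => wedge_pow (w x) n v)}.
Proof.
move=> cw; elim: n => [|n IH] v /=; first exact: cst_continuous.
exact: (continuous_at_wedge cw IH).
Qed.

Lemma continuous_at_form1 (a : T -> 'cV[R]_m) x0 u : {for x0, continuous a} ->
  {for x0, continuous (fun x => form1 (a x) u)}.
Proof.
move=> /mx_continuousP ca; rewrite (_ : (fun _ => _) =
  (fun x => \sum_k u ord0 0 k * a x k 0)); last first.
  by apply/funext => x; rewrite /form1 mxE.
by apply: continuous_at_sum => k; apply: continuousM; [exact: cst_continuous|exact: ca].
Qed.

Lemma continuous_at_form2 (W : T -> 'M[R]_m) x0 u : {for x0, continuous W} ->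
  {for x0, continuous (fun x => form2 (W x) u)}.
Proof.
move=> /mx_continuousP cW; rewrite (_ : (fun _ => _) =
  (fun x => \sum_k (\sum_l u ord0 0 l * W x l k) * u ord_max 0 k)); last first.
  apply/funext => x; rewrite /form2 mxE; apply: eq_bigr => k _.
  by rewrite !mxE.
apply: continuous_at_sum => k; apply: continuousM; last exact: cst_continuous.
by apply: continuous_at_sum => l; apply: continuousM; [exact: cst_continuous|exact: cW].
Qed.

End WedgeContinuity.

Section ContactVolume.
Context {R : realType} (m : nat).

Lemma continuous_dmat (U : set 'rV[R]_m) (a : 'rV[R]_m -> 'cV[R]_m) x :
  open U -> Ck_on 1 U a -> U x -> {for x, continuous (dmat a)}.
Proof.
move=> oU /(Ck_mx _ _ oU) Ca Ux; apply/mx_continuousP => l k.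
rewrite (_ : (fun _ => _) = (fun y => 'D_(delta_mx 0 l) (fun y => a y k 0) y -
    'D_(delta_mx 0 k) (fun y => a y l 0) y)); last by apply/funext => y; rewrite mxE.
apply: continuousB.
  by have [_ /(_ l)[_ [+ _]]] := Ca k 0; exact.
by have [_ /(_ k)[_ [+ _]]] := Ca l 0; exact.
Qed.

Lemma dmat_skew (a : 'rV[R]_m -> 'cV[R]_m) x : (dmat a x)^T = - dmat a x.
Proof. by apply/matrixP => l k; rewrite !mxE opprB. Qed.

Lemma dform_atE (M : smoothManifold R m) (alpha : oneForm M) i x :
  target (chart_of i) x -> dform_at alpha i x = form2 (dmat (alpha i) x).
Proof.
move=> tx; apply/funext => v; rewrite /dform_at /form2.
have da : differentiable (alpha i) x.
  exact: C1_differentiable_mx (@target_open _ _ _ _) (form_smooth alpha i 1%N) tx.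
have dE l k : ('D_(delta_mx 0 l) (alpha i) x) k 0 = 'D_(delta_mx 0 l) (fun y => alpha i y k 0) x.
  by rewrite (derive_mx (diff_derivable (v := delta_mx 0 l) da)) mxE.
pose D l k := 'D_(delta_mx 0 l) (fun y => alpha i y k 0) x.
have wD (w u : 'rV[R]_m) : (w *m 'D_u (alpha i) x) 0 0 = \sum_k \sum_l w 0 k * (u 0 l * D l k).
  rewrite mxE; apply: eq_bigr => k _; rewrite (derive_row_sum _ da) summxE mulr_sumr.
  by apply: eq_bigr => l _; rewrite mxE dE.
have sub00 (A B : 'M[R]_1) : (A - B) 0 0 = A 0 0 - B 0 0 by rewrite !mxE.
transitivity (\sum_k \sum_l v ord_max 0 k * (v ord0 0 l * D l k) -
    \sum_k \sum_l v ord0 0 k * (v ord_max 0 l * D l k)).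
  transitivity ((v ord_max *m 'D_(v ord0) (alpha i) x) 0 0 -
    (v ord0 *m 'D_(v ord_max) (alpha i) x) 0 0); first exact: sub00.
  by congr (_ - _); exact: wD.
rewrite [RHS]mxE.
have -> : dmat (alpha i) x = \matrix_(l, k) (D l k - D k l) by [].
clearbody D; clear dE wD.
under [RHS]eq_bigr do rewrite !mxE mulr_suml.
under [RHS]eq_bigr => k _ do under eq_bigr => l _ do rewrite !mxE mulrBr mulrBl.
under [RHS]eq_bigr do rewrite sumrB.
rewrite sumrB; congr (_ - _).
  by apply: eq_bigr => k _; apply: eq_bigr => l _; rewrite mulrC.
rewrite exchange_big /=; apply: eq_bigr => k _; apply: eq_bigr => l _.
by rewrite mulrA mulrAC.
Qed.

End ContactVolume.

Section ContactIntegral.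
Context {R : realType} (n : nat) (M : smoothManifold R n.*2.+1) (alpha : oneForm M).

Lemma contact_volumeE i x : target (chart_of i) x ->
  contact_volume alpha i x = wedge (form1 (alpha i x))
    (wedge_pow (form2 (dmat (alpha i) x)) n) (fun l : 'I_(n.*2.+1) => delta_mx 0 l).
Proof. by move=> tx; rewrite /contact_volume dform_atE. Qed.

Lemma continuous_contact_volume i x : target (chart_of i) x ->
  {for x, continuous (contact_volume alpha i)}.
Proof.
move=> tx; have ot := @target_open _ _ _ (chart_of i).
apply: (@near_eq_continuous_at _ _ (fun x => wedge (form1 (alpha i x))
    (wedge_pow (form2 (dmat (alpha i) x)) n) (fun l : 'I_(n.*2.+1) => delta_mx 0 l))).
  by apply: filterS (open_nbhs_nbhs (conj ot tx)) => y ty; rewrite contact_volumeE.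
apply: (@continuous_at_wedge _ _ _ 1 n.*2).
  by move=> u; apply: continuous_at_form1; exact: Ck_cont (form_smooth alpha i 0%N) _ tx.
apply: continuous_at_wedge_pow => u; apply: continuous_at_form2.
exact: continuous_dmat ot (form_smooth alpha i 1%N) tx.
Qed.

Section PU.
Variables (N : nat) (i : 'I_N -> atlas M) (rho : 'I_N -> M -> R).
Hypotheses (cM : compact [set: M]) (pu : partition_of_unity i rho).

Definition integrand k (h : M -> R) : 'rV[R]_(n.*2.+1) -> R :=
  (fun x => rho k (of_rV (chart_of (i k)) x)
                     * h (of_rV (chart_of (i k)) x)
                     * `|contact_volume alpha (i k) x|)
             \_ (target (chart_of (i k))).

(** The support of the integrand is in the image of the support of rho k, so the same
    box works for all h; this is what linearity of the iterated integral requires. *)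
Lemma integrand_cc k : exists2 B, 0 < B & forall h, smooth_fun h -> cc_rV B (integrand k h).
Proof.
have [srho rho0 supp _] := pu.
set c := chart_of (i k).
pose S := closure [set p | rho k p != 0].
have cS : compact S by apply: subclosed_compact cM _ => //; exact: closed_closure.
have St : S `<=` source c by exact: supp.
pose K := to_rV c @` S.
have cK : compact K by apply: compact_image_in cS => p /St; exact: to_rV_continuous.
have Kt : K `<=` target c by move=> _ [p /St sp <-]; exact: to_rV_target.
have zK h x : ~ K x -> integrand k h x = 0.
  move=> nK; rewrite /integrand patchE; case: ifPn => // /set_mem tx.
  have [->|r0] := eqVneq (rho k (of_rV c x)) 0; first by rewrite !mul0r.
  case: nK; exists (of_rV c x); last exact: of_rVK.
  exact: subset_closure.
have [B0 [_ hB0]] := compact_bounded cK.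
exists (Num.max 1 (B0 + 1)); first by rewrite lt_max ltr01.
move=> h sh; split; last first.
  move=> x; rewrite gt_max => /andP[x1 xB]; apply: zK => Kx.
  have B1 : B0 < B0 + 1 by rewrite ltrDl.
  by have := hB0 _ B1 _ Kx; rewrite /= leNgt xB.
move=> x; have [tx|ntx] := pselect (target c x).
  have ot := @target_open _ _ _ c.
  apply: (@near_eq_continuous_at _ _ (fun x => rho k (of_rV c x) * h (of_rV c x)
      * `|contact_volume alpha (i k) x|)).
    apply: filterS (open_nbhs_nbhs (conj ot tx)) => y ty.
    by rewrite /integrand patchE mem_set.
  apply: continuousM.
    apply: continuousM; first exact: Ck_cont (srho k (i k) 0%N) _ tx.
    exact: Ck_cont (sh (i k) 0%N) _ tx.
  apply: (@continuous_comp _ _ _ (contact_volume alpha (i k)) (fun z : R => `|z|)).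
    exact: continuous_contact_volume.
  exact: norm_continuous.
have oK : open (~` K).
  apply: closed_openC; apply: compact_closed cK; exact: norm_hausdorff.
apply: (@near_eq_continuous_at _ _ (fun=> 0)); last exact: cst_continuous.
have nKx : (~` K) x by move=> /Kt.
by apply: filterS (open_nbhs_nbhs (conj oK nKx)) => y nK; rewrite zK.
Qed.

Definition pu_integral (h : M -> R) : R := \sum_(k < N) integral_rV (integrand k h).

Lemma pu_integral_linear (a b : R) (g h : M -> R) : smooth_fun g -> smooth_fun h ->
  pu_integral (fun p => a * g p + b * h p) = a * pu_integral g + b * pu_integral h.
Proof.
move=> sg sh; rewrite /pu_integral !mulr_sumr -big_split; apply: eq_bigr => k _.
transitivity (a * integral_rV (integrand k g) + b * integral_rV (integrand k h)) => //.
have [B B0 HB] := integrand_cc k.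
have [lin _ _ _] := @integral_rV_props R n.*2.+1 B B0.
rewrite -(lin a b _ _ (HB _ sg) (HB _ sh)); congr (integral_rV _); apply/funext => x.
rewrite /integrand !patchE; case: ifP => _; last by rewrite !mulr0 addr0.
ring.
Qed.

Lemma pu_integral_ge0 (h : M -> R) : (forall p, 0 <= h p) -> 0 <= pu_integral h.
Proof.
move=> h0; apply: sumr_ge0 => k _.
have [_ _ ge0 _] := @integral_rV_props R n.*2.+1 1 ltr01.
apply: ge0 => x; rewrite /integrand patchE; case: ifP => // _.
by have [_ rho0 _ _] := pu; rewrite !mulr_ge0.
Qed.

Lemma pu_integral_gt0 (h : M -> R) p0 : contact_form alpha -> smooth_fun h ->
  (forall p, 0 <= h p) -> 0 < h p0 -> 0 < pu_integral h.
Proof.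
move=> ctc sh h0 hp; have [srho rho0 supp sum1] := pu.
have int0 k x : 0 <= integrand k h x.
  by rewrite /integrand patchE; case: ifP => // _; rewrite !mulr_ge0.
have ge0k k : 0 <= integral_rV (integrand k h).
  by have [_ _ ge0 _] := @integral_rV_props R n.*2.+1 1 ltr01; exact: ge0.
have [k rk] : exists k, 0 < rho k p0.
  apply: contrapT => /forallNP nk; have := sum1 p0; rewrite big1 => [|k _].
    by move/esym/eqP; rewrite oner_eq0.
  by apply/eqP; rewrite eq_le rho0 andbT leNgt; apply/negP; exact: nk.
rewrite /pu_integral (bigD1 k)// ltr_pwDl//; last by apply: sumr_ge0 => j _; exact: ge0k.
have sp : source (chart_of (i k)) p0.
  by apply: supp; apply: subset_closure => /=; rewrite gt_eqF.
have [B B0 HB] := integrand_cc k.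
have [_ _ _ gt0] := @integral_rV_props R n.*2.+1 B B0.
apply: (gt0 _ (to_rV (chart_of (i k)) p0) (HB _ sh)) => //.
have tx := to_rV_target sp.
rewrite /integrand patchE mem_set// to_rVK// !mulr_gt0// normr_gt0.
exact: ctc.
Qed.

Lemma contact_integralE (h : M -> R) : contact_integral alpha h (pu_integral h).
Proof. by exists N, i, rho. Qed.

End PU.

End ContactIntegral.

(** * Closed Reeb orbits are not arbitrarily short *)

Section Curves.
Context {R : realType} (m : nat).

Lemma is_derive_curve (W : normedModType R) (x : R -> 'rV[R]_m) (f : 'rV[R]_m -> W) (t : R) v :
  is_derive t 1 x v -> differentiable f (x t) ->
  is_derive t 1 (fun s => f (x s)) ('D_v f (x t)).
Proof.
move=> [dx <-] df; have dx' : differentiable x t by apply/derivable1_diffP.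
have dc : differentiable (f \o x) t by exact: differentiable_comp.
split; first by apply/derivable1_diffP.
exact: (derive_comp_rV (1 : R) dx' df).
Qed.

Lemma is_derive_linear (a : 'cV[R]_m) (y v : 'rV[R]_m) :
  is_derive y v (fun z : 'rV[R]_m => (z *m a) 0 0) ((v *m a) 0 0).
Proof.
have E : (fun h : R => h^-1 *: (((fun z : 'rV[R]_m => (z *m a) 0 0) \o shift y) (h *: v)
    - (y *m a) 0 0)) @ 0^' --> ((v *m a) 0 0 : R).
  apply: cvg_near_cst; near=> h.
  have hn0 : h != 0 by near: h; exact: nbhs_dnbhs_neq.
  rewrite /=; have -> : ((h *: v + y) *m a) 0 0 = h * (v *m a) 0 0 + (y *m a) 0 0.
    by rewrite mulmxDl -scalemxAl [LHS]mxE [X in X + _ = _]mxE.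
  by rewrite addrK [_ *: _]mulrA mulVf ?mul1r.
by split; [apply/cvg_ex; eexists; exact: E|exact: cvg_lim E].
Unshelve. all: by end_near. Qed.

Lemma differentiable_linear (a : 'cV[R]_m) (y : 'rV[R]_m) :
  differentiable (fun z : 'rV[R]_m => (z *m a) 0 0) y.
Proof.
have h : Ck_on 1 setT (fun z : 'rV[R]_m => \sum_l z 0 l * a l 0).
  apply: Ck_sum => [|l]; first exact: openT.
  by apply: Ck_mul; [exact: openT|apply: Ck_coord; exact: openT|exact: Ck_cst].
rewrite (_ : (fun _ => _) = (fun z : 'rV[R]_m => \sum_l z 0 l * a l 0)).
  exact: C1_differentiable openT h I.
by apply/funext => z; rewrite mxE.
Qed.

Lemma norm_mx11 (A : 'M[R]_1) : `|A| = `|A 0 0|.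
Proof.
apply/eqP; rewrite eq_le norm_coord_le andbT.
by apply: mx_norm_leP => // i j; rewrite (ord1 i) (ord1 j).
Qed.

End Curves.

Section ReebLoops.
Context {R : realType} (n : nat) (M : smoothManifold R n.*2.+1) (alpha : oneForm M).
Hypotheses (cM : compact [set: M]) (ctc : contact_form alpha).
Variable (T : R).
Hypothesis (T0 : 0 < T).

(** A loop of period T in the direction of the Reeb field, run with speed at most e, so
    that its alpha-length is at most T e. The Reeb field itself is never constructed:
    it is enough that the velocity is in the kernel of d alpha and that alpha is
    positive on it. *)
Definition reeb_loop (e : R) (delta : R -> M) : Prop :=
  [/\ delta 0 = delta T, continuous delta &
    forall t j, source (chart_of j) (delta t) ->
      exists v, [/\ is_derive t 1 (fun s => to_rV (chart_of j) (delta s)) v,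
        v *m dmat (alpha j) (to_rV (chart_of j) (delta t)) = 0,
        0 < (v *m alpha j (to_rV (chart_of j) (delta t))) 0 0 &
        (v *m alpha j (to_rV (chart_of j) (delta t))) 0 0 <= e]].

Lemma reeb_loop_le (e e' : R) delta : e <= e' -> reeb_loop e delta -> reeb_loop e' delta.
Proof.
move=> ee [h1 h2 h3]; split => // t j st; have [v [d1 d2 d3 d4]] := h3 t j st.
by exists v; split => //; exact: le_trans ee.
Qed.

Lemma contact_nondegenerate j x : target (chart_of j) x ->
  forall v : 'rV[R]_(n.*2.+1), v *m alpha j x = 0 -> v *m dmat (alpha j) x = 0 -> v = 0.
Proof.
move=> tx v; apply: volume_nondegenerate; last exact: dmat_skew.
by rewrite -contact_volumeE//; exact: ctc.
Qed.

Lemma gradient_bound (y0 : 'rV[R]_(n.*2.+1)) (r : R) : exists2 G : R, 0 < G &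
  forall y, `|y - y0| <= 2 * r -> forall v, `|'D_v (bump y0 r) y| <= G * `|v|.
Proof.
have C2 : Ck_on 2 setT (bump y0 r) by apply: Ck_bump; exact: openT.
pose g (y : 'rV[R]_(n.*2.+1)) := \sum_l `|'D_(delta_mx 0 l) (bump y0 r) y|.
have cg y : {for y, continuous g}.
  apply: continuous_at_sum => l.
  apply: (@continuous_comp _ _ _ (fun y => 'D_(delta_mx 0 l) (bump y0 r) y) (fun z : R => `|z|)).
    by have [_ /(_ l)[_ [+ _]]] := C2; exact.
  exact: norm_continuous.
have cI : compact (g @` [set y | `|y - y0| <= 2 * r]).
  by apply: compact_image_in; [move=> y _; exact: cg|exact: compact_cball].
have [B [_ hB]] := compact_bounded cI.
exists (`|B| + 1); first by rewrite ltr_wpDl.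
move=> y yr v.
have dy : differentiable (bump y0 r) y by exact: C1_differentiable openT (Ck_pred C2) I.
have gB : g y <= `|B| + 1.
  apply: le_trans (ler_norm _) _; apply: (hB (`|B| + 1)); last by exists y.
  by apply: le_lt_trans (ler_norm _) _; rewrite ltrDl.
rewrite (derive_row_sum _ dy); apply: le_trans (ler_norm_sum _ _ _) _.
apply: (@le_trans _ _ (g y * `|v|)); last by rewrite ler_wpM2r.
rewrite /g mulr_suml; apply: ler_sum => l _; rewrite normrM mulrC ler_wpM2l//.
exact: norm_coord_le.
Qed.

(** A slow loop through p near q stays in a fixed chart: along it, a bump function around
    q has a derivative of order e, so that it cannot drop from more than 1/2 to 0 within
    a period. In that chart, the coordinate given by the covector alpha_q increases
    strictly along the loop, which therefore does not close up. *)
Lemma no_reeb_loop_near (q : M) : exists2 e : R, 0 < e &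
  \forall p \near q, forall e' delta, e' <= e -> delta 0 = p -> ~ reeb_loop e' delta.
Proof.
have [j [r [r0 sq tq]]] := chart_ball q.
set y0 := to_rV (chart_of j) q.
have ty0 : target (chart_of j) y0 by exact: to_rV_target.
have ot := @target_open _ _ _ (chart_of j).
have ca : {for y0, continuous (alpha j)} by exact: Ck_cont (form_smooth alpha j 0%N) _ ty0.
have cW : {for y0, continuous (dmat (alpha j))} by exact: continuous_dmat ot (form_smooth alpha j 1%N) ty0.
have [C C0 [d d0 dP]] := reeb_control ca cW (contact_nondegenerate ty0).
pose r' := Num.min r (d / 3).
have r'0 : 0 < r' by rewrite lt_min r0 divr_gt0.
have r'r : r' <= r by rewrite ge_min lexx.
have r'd : 2 * r' < d.
  have : r' <= d / 3 by rewrite ge_min lexx orbT.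
  by move: (r') => z zd; lra.
have tq' x : `|x - y0| <= 3 * r' -> target (chart_of j) x.
  by move=> xr; apply: tq; apply: le_trans xr _; rewrite ler_wpM2l.
have [G G0 hG] := gradient_bound y0 r'.
pose b := chart_bump j y0 r'.
have bq : b q = 1.
  rewrite /b /chart_bump /zero_ext patchE mem_set//= bump_eq1// subrr normr0.
  exact: ltW.
(* The bump function then varies by at most T G C e < 1/2 within a period. *)
pose e := (2 * (T * (G * C) + 1))^-1.
have TGC : 0 < T * (G * C) by rewrite !mulr_gt0.
have e0 : 0 < e by rewrite invr_gt0; move: (T * (G * C)) TGC => z z0; lra.
exists e => //.
have cb : {for q, continuous b}.
  by apply: smooth_fun_continuous; exact: (smooth_chart_bump r'0 tq').
have bnear : \forall p \near q, 2^-1 < b p.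
  apply: (cb [set z : R | 2^-1 < z]); apply: lt_nbhsr; rewrite bq.
  by rewrite invf_lt1// ltr1n.
apply: filterS bnear => p bp e' delta e'e dp [loop cd hd].
have e'e0 : G * C * e' <= G * C * e by rewrite ler_wpM2l// mulr_ge0// ltW.
pose x t := to_rV (chart_of j) (delta t).
have inK t : b (delta t) != 0 -> source (chart_of j) (delta t) /\ `|x t - y0| <= 2 * r'.
  move=> bt; have : (of_rV (chart_of j) @` [set x | `|x - y0| <= 2 * r']) (delta t).
    by apply: contrapT => /(chart_bump_out r'0) b0; move: bt; rewrite /b b0 eqxx.
  move=> [z /= zr E]; have tz : target (chart_of j) z.
    apply: tq'; apply: le_trans zr _; by rewrite ler_wpM2r ?ler_nat// ltW.
  split; first by rewrite -E; exact: of_rV_source.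
  by rewrite /x -E of_rVK.
have vP t : source (chart_of j) (delta t) -> `|x t - y0| <= 2 * r' ->
    exists v, [/\ is_derive t 1 x v, `|v| <= C * e & 0 < (v *m alpha j y0) 0 0].
  move=> st xt; have [v [dv v1 v2 v3]] := hd t j st; exists v.
  have [vC v4] := dP _ (le_lt_trans xt r'd) _ v1.
  move: vC v4; rewrite !norm_mx11 (gtr0_norm v2) => vC v4; split => //.
    by apply: le_trans vC _; rewrite ler_wpM2l ?(ltW C0)// (le_trans v3).
  move: v4; have -> : (v *m alpha j y0 - v *m alpha j (x t)) 0 0 =
    (v *m alpha j y0) 0 0 - (v *m alpha j (x t)) 0 0 by rewrite mxE [X in _ + X]mxE.
  rewrite ler_norml => /andP[v4 _].
  by move: v2 v4; rewrite -/(x t); move: (_ 0 0) (_ 0 0) => z w; lra.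
have db t : derivable (b \o delta) t 1 /\ `|'D_1 (b \o delta) t| <= G * C * e.
  have [ink|nink] := pselect ((of_rV (chart_of j) @` [set x | `|x - y0| <= 2 * r']) (delta t)).
    move: ink => [z /= zr E]; have tz : target (chart_of j) z.
      by apply: tq'; apply: le_trans zr _; rewrite ler_wpM2r ?ler_nat// ltW.
    have st : source (chart_of j) (delta t) by rewrite -E; exact: of_rV_source.
    have xt : `|x t - y0| <= 2 * r' by rewrite /x -E of_rVK.
    have [v [dv vC _]] := vP t st xt.
    have dfb : differentiable (bump y0 r') (x t).
      by apply: C1_differentiable openT _ I; apply: Ck_bump; exact: openT.
    have dc := is_derive_curve dv dfb.
    have nE : \forall s \near t, bump y0 r' (x s) = (b \o delta) s.
      have ns : \forall s \near t, source (chart_of j) (delta s).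
        exact: (cd t _ (open_nbhs_nbhs (conj (@source_open _ _ _ (chart_of j)) st))).
      apply: filterS ns => s ss.
      by rewrite /= /b /chart_bump /zero_ext patchE mem_set.
    have [d1 d2] := near_eq_is_derive nE dc; split => //.
    rewrite d2; apply: le_trans (hG _ xt v) _.
    by rewrite -mulrA ler_wpM2l// ltW.
  have nE : \forall s \near t, (cst 0 : R -> R) s = (b \o delta) s.
    have oK : open (~` (of_rV (chart_of j) @` [set x | `|x - y0| <= 2 * r'])).
      apply: closed_openC; apply: closed_chart_image; first exact: compact_cball.
      move=> z /= zr; apply: tq'; apply: le_trans zr _.
      by rewrite ler_wpM2r ?ler_nat// ltW.
    have ns : \forall s \near t, (~` (of_rV (chart_of j) @` [set x | `|x - y0| <= 2 * r'])) (delta s).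
      exact: (cd t _ (open_nbhs_nbhs (conj oK nink))).
    by apply: filterS ns => s ss; rewrite /= /b chart_bump_out.
  have [d1 d2] := near_eq_is_derive nE (is_derive_cst (0 : R) t 1); split => //.
  by rewrite d2 normr0 !mulr_ge0// ltW.
have bpos t : 0 <= t <= T -> b (delta t) != 0.
  move=> /andP[t0 tT]; rewrite gt_eqF//.
  have [s _ E] := @MVT_line R R (b \o delta) 0 1 t (fun s _ => (db _).1).
  move: E; rewrite add0r [t%:A]mulr1 /= dp => E.
  have : `|b (delta t) - b p| <= T * (G * C * e).
    rewrite E normrM; apply: ler_pM => //; first by rewrite ger0_norm.
    exact: (db _).2.
  have : T * (G * C * e) <= 2^-1.
    rewrite (mulrA T) /e; move: (T * (G * C)) TGC => z z0.
    by rewrite ler_pdivrMr; lra.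
  rewrite ler_norml => h1 /andP[h2 _].
  by move: (T * (G * C * e)) h1 h2 bp => z; lra.
pose h t := (x t *m alpha j y0) 0 0.
have dh t : 0 <= t <= T -> derivable h t 1 /\ 0 < 'D_1 h t.
  move=> tT; have [st xt] := inK t (bpos t tT).
  have [v [dv _ v0]] := vP t st xt.
  have [d1 d2] := is_derive_curve dv (differentiable_linear (alpha j y0) (x t)).
  split => //; rewrite d2.
  by have [_ ->] := is_derive_linear (alpha j y0) (x t) v.
have [c cT] : exists2 c, c \in `]0, T[ & h T - h 0 = 'D_1 h c * (T - 0).
  apply: (MVT T0) => [c|].
    rewrite in_itv /= => /andP[c0 c1]; apply: derivableP.
    by apply: (dh c _).1; rewrite !ltW.
  apply: derivable_within_continuous => c; rewrite in_itv /= => c1.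
  exact: (dh c c1).1.
move: cT; rewrite in_itv /= => /andP[c0 c1].
have [_ hc] := dh c (introT andP (conj (ltW c0) (ltW c1))).
rewrite /h /x -loop subrr subr0 => /esym/eqP; rewrite mulf_eq0 !gt_eqF//.
Qed.

Lemma no_short_reeb_loop :
  exists2 e : R, 0 < e & forall delta, ~ reeb_loop e delta.
Proof.
have : \forall e \near (0 : R)^'+, [set: M] `<=` (fun p => forall delta, delta 0 = p -> ~ reeb_loop e delta).
  apply: (iffLR (compact_near_coveringP _) cM R ((0 : R)^'+)
    (fun e p => forall delta, delta 0 = p -> ~ reeb_loop e delta)) => q _.
  have [e e0 he] := no_reeb_loop_near q.
  exists ([set p | forall e' delta, e' <= e -> delta 0 = p -> ~ reeb_loop e' delta], [set e' | e' <= e]).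
    by split => //=; exact: nbhs_right_le.
  by move=> [p e'] /= [h1 h2] delta; exact: h1.
move=> ne; near (0 : R)^'+ => e; exists e; first by [].
have h : [set: M] `<=` (fun p => forall delta, delta 0 = p -> ~ reeb_loop e delta) by near: e.
by move=> delta; exact: h (delta 0) I delta erefl.
Unshelve. all: by end_near. Qed.

End ReebLoops.

(** * A small positively transverse loop *)

Section Pairing.
Context {R : realType} (m : nat).
Implicit Types (u v : 'rV[R]_m) (a b : 'cV[R]_m).

Definition pair u a : R := (u *m a) 0 0.

Lemma pairDl u v a : pair (u + v) a = pair u a + pair v a.
Proof. by rewrite /pair mulmxDl mxE. Qed.
Lemma pairNl u a : pair (- u) a = - pair u a.
Proof. by rewrite /pair mulNmx mxE. Qed.
Lemma pairZl c u a : pair (c *: u) a = c * pair u a.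
Proof. by rewrite /pair -scalemxAl mxE. Qed.
Lemma pairDr u a b : pair u (a + b) = pair u a + pair u b.
Proof. by rewrite /pair mulmxDr mxE. Qed.
Lemma pairNr u a : pair u (- a) = - pair u a.
Proof. by rewrite /pair mulmxN mxE. Qed.
Lemma pairZr c u a : pair u (c *: a) = c * pair u a.
Proof. by rewrite /pair -scalemxAr mxE. Qed.
Lemma pairE u a : pair u a = \sum_k u 0 k * a k 0.
Proof. by rewrite /pair mxE. Qed.
Lemma pair_le u a : `|pair u a| <= m%:R * `|u| * `|a|.
Proof. by rewrite /pair -norm_mx11; exact: norm_mulmx_le. Qed.

Lemma pair_trmx u v (W : 'M[R]_m) : pair u (W *m v^T) = pair v (W^T *m u^T).
Proof.
rewrite /pair -[in LHS](trmxK (u *m (W *m v^T))) mxE !trmx_mul trmxK.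
by rewrite mulmxA.
Qed.

Lemma pair_skew u (W : 'M[R]_m) : W^T = - W -> pair u (W *m u^T) = 0.
Proof.
move=> skew; have := pair_trmx u u W; rewrite skew mulNmx pairNr.
move=> /eqP; rewrite -addr_eq0 -mulr2n mulrn_eq0 /= => /eqP; exact.
Qed.

End Pairing.

Section DeriveScalar.
Context {R : realType} (V : normedModType R) (x v : V).
Implicit Types (f g : V -> R).

Lemma der_add f g df dg : is_derive x v f df -> is_derive x v g dg ->
  is_derive x v (fun z => f z + g z) (df + dg).
Proof. by move=> hf hg; exact: (is_deriveD hf hg). Qed.

Lemma der_mul f g df dg : is_derive x v f df -> is_derive x v g dg ->
  is_derive x v (fun z => f z * g z) (f x * dg + g x * df).
Proof. by move=> hf hg; exact: (is_deriveM hf hg). Qed.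

Lemma der_cst (c : R) : is_derive x v (fun=> c) 0.
Proof. exact: is_derive_cst. Qed.

Lemma der_scale (c : R) f df : is_derive x v f df -> is_derive x v (fun z => c * f z) (c * df).
Proof.
move=> hf; have h := der_mul (der_cst c) hf.
by apply: is_derive_eq h _; rewrite mulr0 addr0.
Qed.

Lemma der_mx (p q : nat) (F : V -> 'M[R]_(p, q)) (D : 'M[R]_(p, q)) :
  (forall i j, is_derive x v (fun z => F z i j) (D i j)) -> is_derive x v F D.
Proof.
move=> h; have d : derivable F x v by apply/derivable_mxP => i j; have [] := h i j.
split => //; rewrite (derive_mx d); apply/matrixP => i j; rewrite mxE.
by have [_ ->] := h i j.
Qed.

End DeriveScalar.

Section QuadraticSurface.
Context {R : realType} (m : nat).
Variables (x0 X Y Z : 'rV[R]_m) (p q s : R).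

(** The loop lies over a circle in the coordinates (y1, y2), on the graph of a quadratic
    form in the direction Z; dquad and dsurf are the differentials of quad and surf. *)
Definition quad (y1 y2 : R) : R := (p * (y1 * y1) + q * (y1 * y2) + s * (y2 * y2)) / 2.
Definition dquad (u1 u2 y1 y2 : R) : R :=
  u1 * (p * y1 + q / 2 * y2) + u2 * (s * y2 + q / 2 * y1).

Definition surf (y1 y2 : R) : 'rV[R]_m := x0 + y1 *: X + y2 *: Y - quad y1 y2 *: Z.
Definition dsurf (u1 u2 y1 y2 : R) : 'rV[R]_m := u1 *: X + u2 *: Y - dquad u1 u2 y1 y2 *: Z.

Lemma is_derive_quad (V : normedModType R) (x v : V) (f g : V -> R) df dg :
  is_derive x v f df -> is_derive x v g dg ->
  is_derive x v (fun z => quad (f z) (g z)) (dquad df dg (f x) (g x)).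
Proof.
move=> hf hg.
have h1 := der_scale p (der_mul hf hf).
have h2 := der_scale q (der_mul hf hg).
have h3 := der_scale s (der_mul hg hg).
have h := der_scale 2^-1 (der_add (der_add h1 h2) h3).
rewrite (_ : (fun z => _) = (fun z => 2^-1 * (p * (f z * f z) + q * (f z * g z) + s * (g z * g z)))).
  by apply: is_derive_eq h _; rewrite /dquad; field.
by apply/funext => z; rewrite /quad mulrC.
Qed.

Lemma is_derive_surf (V : normedModType R) (x v : V) (f g : V -> R) df dg :
  is_derive x v f df -> is_derive x v g dg ->
  is_derive x v (fun z => surf (f z) (g z)) (dsurf df dg (f x) (g x)).
Proof.
move=> hf hg; apply: der_mx => i k.
have hq := is_derive_quad hf hg.
have h := der_add (der_add (der_add (der_cst x v (x0 i k)) (der_scale (X i k) hf))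
  (der_scale (Y i k) hg)) (der_scale (- Z i k) hq).
rewrite (_ : (fun z => _) = (fun z => x0 i k + X i k * f z + Y i k * g z + - Z i k * quad (f z) (g z))).
  by apply: is_derive_eq h _; rewrite !mxE; ring.
by apply/funext => z; rewrite !mxE; ring.
Qed.

Lemma dsurfZ c u1 u2 y1 y2 : dsurf (c * u1) (c * u2) y1 y2 = c *: dsurf u1 u2 y1 y2.
Proof.
rewrite /dsurf scalerBr scalerDr !scalerA; congr (_ - _ *: _).
by rewrite /dquad; ring.
Qed.

Lemma surf_scale (r c1 c2 : R) :
  surf (r * c1) (r * c2) = x0 + r *: (c1 *: X + c2 *: Y - (r * quad c1 c2) *: Z).
Proof. by apply/matrixP => i j; rewrite !mxE /quad; ring. Qed.

Lemma dsurf_scale (r c1 c2 : R) :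
  dsurf (- (r * c2)) (r * c1) (r * c1) (r * c2) =
  r *: (- c2 *: X + c1 *: Y - (r * dquad (- c2) c1 c1 c2) *: Z).
Proof. by apply/matrixP => i j; rewrite !mxE /dquad; ring. Qed.

Lemma quad_le (c1 c2 : R) : `|c1| <= 1 -> `|c2| <= 1 -> `|quad c1 c2| <= `|p| + `|q| + `|s|.
Proof.
move=> h1 h2; rewrite /quad normrM (ger0_norm (_ : 0 <= 2^-1))//.
have t (k a b : R) : `|a| <= 1 -> `|b| <= 1 -> `|k * (a * b)| <= `|k|.
  by move=> a1 b1; rewrite !normrM ler_piMr// mulr_ile1.
have h : `|p * (c1 * c1) + q * (c1 * c2) + s * (c2 * c2)| <= `|p| + `|q| + `|s|.
  apply: le_trans (ler_normD _ _) _; apply: lerD; last exact: t.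
  by apply: le_trans (ler_normD _ _) _; apply: lerD; exact: t.
apply: le_trans h; rewrite ler_piMr// invf_le1// ler1n//.
Qed.

Lemma dquad_le (u1 u2 c1 c2 : R) : `|u1| <= 1 -> `|u2| <= 1 -> `|c1| <= 1 -> `|c2| <= 1 ->
  `|dquad u1 u2 c1 c2| <= `|p| + `|q| + `|s|.
Proof.
move=> h1 h2 h3 h4.
have t (k a b : R) : `|a| <= 1 -> `|b| <= 1 -> `|k * (a * b)| <= `|k|.
  by move=> a1 b1; rewrite !normrM ler_piMr// mulr_ile1.
have -> : dquad u1 u2 c1 c2 = (p * (u1 * c1) + q / 2 * (u1 * c2)) + (q / 2 * (u2 * c1) + s * (u2 * c2)).
  by rewrite /dquad; ring.
have q2 : `|q| = `|q / 2| + `|q / 2|.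
  by rewrite normrM (ger0_norm (_ : 0 <= 2^-1))//; field.
rewrite [leRHS](_ : _ = (`|p| + `|q / 2|) + (`|q / 2| + `|s|)); last by rewrite q2; ring.
apply: le_trans (ler_normD _ _) _; apply: lerD.
  by apply: le_trans (ler_normD _ _) _; apply: lerD; exact: t.
by apply: le_trans (ler_normD _ _) _; apply: lerD; exact: t.
Qed.

End QuadraticSurface.

Section TransverseLoop.
Context {R : realType} (m : nat).
Local Notation e_ l := (delta_mx 0 l : 'rV[R]_m).
Variables (U : set 'rV[R]_m) (a : 'rV[R]_m -> 'cV[R]_m) (x0 X Y Z : 'rV[R]_m).
Hypotheses (oU : open U) (sa : smooth_on U a) (Ux0 : U x0).
Hypotheses (Xa : pair X (a x0) = 0) (Ya : pair Y (a x0) = 0) (Za : pair Z (a x0) = 1)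
  (XY : pair X (dmat a x0 *m Y^T) = 1).

(** The first-order part of the coefficients at x0: a (x0 + h) = a x0 + J h^T + o(h). *)
Let J : 'M[R]_m := \matrix_(k, l) 'D_(e_ l) (fun y => a y k 0) x0.
Let be u v : R := pair u (J *m v^T).

Let dmatE : dmat a x0 = J^T - J.
Proof. by apply/matrixP => l k; rewrite !mxE. Qed.

Let beYX : be Y X - be X Y = 1.
Proof. by rewrite -XY dmatE mulmxBl pairDr pairNr pair_trmx trmxK. Qed.

(** The coefficients of the quadratic form h |-> be h h on the span of X and Y: subtracting
    half of it in the direction Z cancels the symmetric part of be, which would otherwise
    give the loop a contribution of no definite sign. *)
Definition loop_p := be X X.
Definition loop_q := be X Y + be Y X.
Definition loop_s := be Y Y.

Local Notation G := (surf x0 X Y Z loop_p loop_q loop_s).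
Local Notation Gd := (dsurf X Y Z loop_p loop_q loop_s).

Lemma littleo_form (eps : R) : 0 < eps -> exists2 d : R, 0 < d &
  forall h, `|h| < d -> `|a (x0 + h) - a x0 - J *m h^T| <= eps * `|h|.
Proof.
move=> eps0.
have C1 k : Ck_on 1 U (fun y => a y k 0) by have /(Ck_mx _ _ oU) := sa 1; exact.
have N : \forall h \near (0 : 'rV[R]_m), forall k : 'I_m,
   `|a (x0 + h) k 0 - a x0 k 0 - \sum_l h 0 l * 'D_(e_ l) (fun y => a y k 0) x0| <= eps * `|h|.
  near=> h; near: h; apply: filter_forall => k; apply: (C1_littleo oU Ux0 _ _ eps0) => [l y Uy|l].
    by have [_ /(_ l)[+ _]] := C1 k; exact.
  by have [_ /(_ l)[_ [+ _]]] := C1 k; exact.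
have [d d0 dP] := nbhs_dist_lt N.
exists d => // h hd; apply: mx_norm_leP => [|k j]; first by rewrite mulr_ge0// ltW.
have := dP h; rewrite subr0 => /(_ hd k); rewrite (ord1 j) !mxE.
congr (`|_ - _| <= _); apply: eq_bigr => l _.
by rewrite !mxE mulrC.
Unshelve. all: by end_near. Qed.

Let beDl u v w : be (u + v) w = be u w + be v w. Proof. exact: pairDl. Qed.
Let beZl c u w : be (c *: u) w = c * be u w. Proof. exact: pairZl. Qed.
Let beDr u v w : be w (u + v) = be w u + be w v.
Proof. by rewrite /be linearD mulmxDr pairDr. Qed.
Let beZr c u w : be w (c *: u) = c * be w u.
Proof. by rewrite /be linearZ /= -scalemxAr pairZr. Qed.

(** On the circle of radius r the value of the form on the velocity is r^2/2 up to an
    error of order r^3 and an arbitrarily small multiple of r^2: the skew part of be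
    contributes r^2/2, as d a (X, Y) = 1, and the graph term cancels the symmetric part.
    Hence the loop is positively transverse once r is small. *)
Lemma loop_estimate (rho : R) : 0 < rho -> exists r : R, 0 < r /\
  forall c s, c ^+ 2 + s ^+ 2 = 1 ->
    [/\ `|G (r * c) (r * s) - x0| <= rho,
      r ^+ 2 / 4 <= pair (Gd (- (r * s)) (r * c) (r * c) (r * s)) (a (G (r * c) (r * s))) &
      pair (Gd (- (r * s)) (r * c) (r * c) (r * s)) (a (G (r * c) (r * s))) <= r ^+ 2].
Proof.
move=> rho0.
pose K : R := `|loop_p| + `|loop_q| + `|loop_s|.
have K0 : 0 <= K by rewrite !addr_ge0.
pose N : R := `|X| + `|Y| + K * `|Z| + 1.
have N1 : 1 <= N by rewrite lerDr !addr_ge0// mulr_ge0.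
pose M : R := m%:R.
have [L L0 beL] : exists2 L : R, 0 <= L & forall u v, `|be u v| <= L * (`|u| * `|v|).
  exists (M * M * `|J|); first by rewrite !mulr_ge0.
  move=> u v; apply: le_trans (pair_le _ _) _.
  have nT : `|v^T| <= `|v| by apply: mx_norm_leP => // i j; rewrite mxE; exact: norm_coord_le.
  have h : `|J *m v^T| <= M * `|J| * `|v|.
    by apply: le_trans (norm_mulmx_le _ _) _; rewrite ler_wpM2l// mulr_ge0.
  apply: (@le_trans _ _ (M * `|u| * (M * `|J| * `|v|))); first by rewrite ler_wpM2l// mulr_ge0.
  by rewrite le_eqVlt; apply/orP; left; apply/eqP; ring.
(* Each of the two errors is made at most r^2/8. *)
pose eps := (8 * (M * N * N + 1))^-1.
have MNN : 0 <= M * N * N by rewrite !mulr_ge0// (le_trans ler01).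
have eps0 : 0 < eps by rewrite invr_gt0; move: (M * N * N) MNN => z z0; lra.
have [d d0 dP] := littleo_form eps0.
have LNN : 0 <= L * N * N by rewrite !mulr_ge0// (le_trans ler01).
have N0 : 0 < N by rewrite (lt_le_trans ltr01).
pose r := Num.min (Num.min 1 (rho / N)) (Num.min (d / (2 * N)) (24 * (L * N * N + 1))^-1).
have LN1 : 0 < 24 * (L * N * N + 1) by move: (L * N * N) LNN => z z0; lra.
have r0 : 0 < r by rewrite !lt_min ltr01 !divr_gt0 ?mulr_gt0// invr_gt0.
have r1 : r <= 1 by rewrite !ge_min lexx.
have rrho : r * N <= rho by rewrite -ler_pdivlMr// !ge_min lexx !orbT.
have rd : r * N < d.
  have : r <= d / (2 * N) by rewrite !ge_min lexx !orbT.
  rewrite ler_pdivlMr ?mulr_gt0// mulrCA => h; move: (r * N) h (mulr_gt0 r0 N0) => z; lra.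
have rL : r * (L * N * N) <= 24^-1.
  have : r <= (24 * (L * N * N + 1))^-1 by rewrite !ge_min lexx !orbT.
  rewrite -[X in _ <= X]mul1r ler_pdivlMr// => h.
  move: (L * N * N) h => z; lra.
clearbody r; exists r; split => // c s cs1.
have c1 : `|c| <= 1.
  by rewrite -(expr_le1 (n := 2))// real_normK ?num_real// -cs1 lerDl sqr_ge0.
have s1 : `|s| <= 1.
  by rewrite -(expr_le1 (n := 2))// real_normK ?num_real// -cs1 lerDr sqr_ge0.
pose q0 := quad loop_p loop_q loop_s c s.
pose q1 := dquad loop_p loop_q loop_s (- s) c c s.
have q0K : `|q0| <= K by exact: quad_le.
have q1K : `|q1| <= K by apply: dquad_le; rewrite ?normrN.
pose k1 := c *: X + s *: Y; pose w1 := - s *: X + c *: Y.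
have n_lin (b1 b2 : R) : `|b1| <= 1 -> `|b2| <= 1 -> `|b1 *: X + b2 *: Y| <= `|X| + `|Y|.
  move=> h1 h2; apply: le_trans (ler_normD _ _) _; rewrite !normrZ.
  by apply: lerD; rewrite ler_piMl.
have nZ (b : R) : `|b| <= K -> `|b *: Z| <= K * `|Z| by move=> h; rewrite normrZ ler_wpM2r.
have nk1 : `|k1| <= N.
  apply: le_trans (n_lin _ _ c1 s1) _; rewrite /N -addrA lerDl addr_ge0// mulr_ge0//.
have nw1 : `|w1| <= N.
  apply: le_trans (n_lin _ _ _ c1) _; first by rewrite normrN.
  by rewrite /N -addrA lerDl addr_ge0// mulr_ge0.
have nqZ (b : R) : `|b| <= K -> `|b *: Z| <= N.
  move=> h; apply: le_trans (nZ _ h) _; rewrite /N addrAC lerDr.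
  by rewrite !addr_ge0.
pose k := k1 - (r * q0) *: Z; pose w := w1 - (r * q1) *: Z.
have nk : `|k| <= N.
  rewrite /k; apply: le_trans (ler_normB _ _) _.
  apply: (@le_trans _ _ (`|X| + `|Y| + K * `|Z|)); last by rewrite lerDl.
  apply: lerD; first exact: n_lin.
  apply: nZ; rewrite normrM (gtr0_norm r0); apply: le_trans q0K; rewrite ler_piMl//.
have nw : `|w| <= N.
  rewrite /w; apply: le_trans (ler_normB _ _) _.
  apply: (@le_trans _ _ (`|X| + `|Y| + K * `|Z|)); last by rewrite lerDl.
  apply: lerD; first by apply: n_lin; rewrite ?normrN.
  apply: nZ; rewrite normrM (gtr0_norm r0); apply: le_trans q1K; rewrite ler_piMl//.
have GE : G (r * c) (r * s) = x0 + r *: k by exact: surf_scale.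
have GdE : Gd (- (r * s)) (r * c) (r * c) (r * s) = r *: w by exact: dsurf_scale.
have nrk : `|r *: k| <= r * N by rewrite normrZ (gtr0_norm r0) ler_wpM2l// ltW.
rewrite GE GdE; set E := a (x0 + r *: k).
pose Er := E - a x0 - J *m (r *: k)^T.
have nEr : `|Er| <= eps * (r * N).
  apply: le_trans (dP _ (le_lt_trans nrk rd)) _.
  by rewrite ler_wpM2l// ltW.
have EE : E = a x0 + J *m (r *: k)^T + Er by rewrite /Er -[E - a x0 - _]addrA -opprD [RHS]addrC subrK.
have w0 : pair w (a x0) = - (r * q1).
  by rewrite /w /w1 pairDl pairNl pairDl !pairZl Xa Ya Za !mulr0 add0r sub0r mulr1.
pose e1 := be w1 Z; pose e2 := be Z k1; pose e3 := be Z Z.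
have wk : be w k = q1 + 2^-1 - r * (q0 * e1 + q1 * e2) + r ^+ 2 * (q0 * q1 * e3).
  have -> : be w k = be w1 k1 - r * (q0 * e1 + q1 * e2) + r ^+ 2 * (q0 * q1 * e3).
    have gen u1 u2 (b1 b2 : R) : be (u1 - b1 *: Z) (u2 - b2 *: Z) =
        be u1 u2 - b2 * be u1 Z - b1 * be Z u2 + b1 * b2 * be Z Z.
      by rewrite -(scaleNr b1 Z) -(scaleNr b2 Z) beDl !beDr !beZl !beZr; ring.
    have alg (b f1 f2 f3 g0 g1 t : R) : b - t * g0 * f1 - t * g1 * f2 + t * g1 * (t * g0) * f3 =
      b - t * (g0 * f1 + g1 * f2) + t ^+ 2 * (g0 * g1 * f3) by ring.
    by rewrite /w /k gen alg.
  suff -> : be w1 k1 = q1 + 2^-1 by [].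
  rewrite /w1 /k1 beDl !beDr !beZl !beZr /q1 /dquad /loop_p /loop_q /loop_s.
  have -> : be Y X = 1 + be X Y by rewrite -beYX subrK.
  move: (be X X) (be X Y) (be Y Y) => p q t.
  have c2 : c * c = 1 - s * s by rewrite -cs1 !expr2 addrK.
  apply/eqP; rewrite -subr_eq0 (_ : _ - _ = 2^-1 * (c * c - (1 - s * s))); last by field.
  by rewrite c2 subrr mulr0.
have KZ : K * `|Z| <= N by rewrite /N addrAC lerDr !addr_ge0.
have b1 : `|q0 * e1| <= L * N * N.
  rewrite normrM; apply: (@le_trans _ _ (K * (L * (N * `|Z|)))).
    apply: ler_pM => //; apply: le_trans (beL _ _) _.
    by rewrite ler_wpM2l// ler_wpM2r.
  by rewrite (_ : K * _ = L * N * (K * `|Z|)); [rewrite ler_wpM2l// mulr_ge0// ltW|ring].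
have b2 : `|q1 * e2| <= L * N * N.
  rewrite normrM; apply: (@le_trans _ _ (K * (L * (`|Z| * N)))).
    apply: ler_pM => //; apply: le_trans (beL _ _) _.
    by rewrite ler_wpM2l// ler_wpM2l.
  by rewrite (_ : K * _ = L * N * (K * `|Z|)); [rewrite ler_wpM2l// mulr_ge0// ltW|ring].
have b3 : `|q0 * q1 * e3| <= L * N * N.
  rewrite (normrM (q0 * q1)) (normrM q0); apply: (@le_trans _ _ (K * K * (L * (`|Z| * `|Z|)))).
    apply: ler_pM => //; [exact: ler_pM|exact: beL].
  rewrite (_ : K * _ * _ = L * ((K * `|Z|) * (K * `|Z|))); last by ring.
  by rewrite -[leRHS]mulrA ler_wpM2l//; apply: ler_pM => //; rewrite mulr_ge0.
have b4 : `|pair w Er| <= r * 8^-1.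
  apply: le_trans (pair_le _ _) _.
  apply: (@le_trans _ _ (M * N * (eps * (r * N)))).
    by apply: ler_pM => //; rewrite ler_wpM2l.
  rewrite (_ : M * N * _ = r * (M * N * N * eps)); last by ring.
  rewrite ler_wpM2l ?(ltW r0)// /eps ler_pdivrMr; move: (M * N * N) MNN => z z0; lra.
have -> : pair (r *: w) E = r * (r * (2^-1 - r * (q0 * e1 + q1 * e2) + r * (r * (q0 * q1 * e3)))
    + pair w Er).
  rewrite pairZl EE !pairDr w0; congr (r * (_ + _)).
  have -> : pair w (J *m (r *: k)^T) = be w (r *: k) by [].
  rewrite beZr wk; ring.
move: b1 b2 b3 b4 rL; move: (q0 * e1) (q1 * e2) (q0 * q1 * e3) (pair w Er).
move: (L * N * N) LNN => D D0 t1 t2 t3 t4 b1 b2 b3 b4 rD.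
have b12 : `|r * (t1 + t2)| <= 12^-1.
  rewrite normrM (gtr0_norm r0); apply: (@le_trans _ _ (r * (D + D))).
    by rewrite ler_wpM2l ?(ltW r0)//; apply: le_trans (ler_normD _ _) _; exact: lerD.
  by rewrite mulrDr; move: (r * D) rD => z; lra.
have b33 : `|r * (r * t3)| <= 24^-1.
  rewrite !normrM (gtr0_norm r0); apply: le_trans rD.
  apply: (@le_trans _ _ (r * `|t3|)); last by rewrite ler_wpM2l// ltW.
  by rewrite ler_piMl// mulr_ge0// ltW.
have b44 : `|t4 / r| <= 8^-1.
  by rewrite normrM normfV (gtr0_norm r0) ler_pdivrMr// mulrC.
have -> : r * (r * (2^-1 - r * (t1 + t2) + r * (r * t3)) + t4) =
    r ^+ 2 * (2^-1 - r * (t1 + t2) + r * (r * t3) + t4 / r).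
  by field; rewrite gt_eqF.
move: b12 b33 b44; rewrite !ler_norml.
move: (r * (t1 + t2)) (r * (r * t3)) (t4 / r) => z1 z2 z3 /andP[? ?] /andP[? ?] /andP[? ?].
split.
- by apply: le_trans rrho; rewrite addrC addKr.
- by rewrite ler_wpM2l ?sqr_ge0//; lra.
- by rewrite ler_piMr ?sqr_ge0//; lra.
Qed.

End TransverseLoop.

(** * A function with prescribed differential along the loop *)

Lemma is_derive_entry (R : realType) (m : nat) (j : 'I_m) (x v : 'rV[R]_m) :
  is_derive x v (fun z : 'rV[R]_m => z 0 j) (v 0 j).
Proof.
have E : (fun h : R => h^-1 *: (((fun x : 'rV[R]_m => x 0 j) \o shift x) (h *: v) - x 0 j))
   @ 0^' --> (v 0 j : R).
  apply: cvg_near_cst; near=> h.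
  rewrite /= !mxE addrK [_ *: _]mulrA mulVf ?mul1r//.
  by near: h; exact: nbhs_dnbhs_neq.
by split; [apply/cvg_ex; eexists; exact: E|exact: cvg_lim E].
Unshelve. all: by end_near. Qed.

Section LoopJet.
Context {R : realType} (m : nat).
Variables (U : set 'rV[R]_m) (a : 'rV[R]_m -> 'cV[R]_m) (x0 X Y Z : 'rV[R]_m) (p q s r z0 : R).
Variables (xi1 xi2 : 'cV[R]_m).
Local Notation G := (surf x0 X Y Z p q s).
Local Notation Gd := (dsurf X Y Z p q s).
Hypotheses (oU : open U) (sa : smooth_on U a) (r0 : 0 < r) (z00 : 0 < z0).
Hypotheses (X1 : pair X xi1 = 1) (Y1 : pair Y xi1 = 0) (Z1 : pair Z xi1 = 0).
Hypotheses (X2 : pair X xi2 = 0) (Y2 : pair Y xi2 = 1) (Z2 : pair Z xi2 = 0).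
Hypothesis est : forall c s, c ^+ 2 + s ^+ 2 = 1 -> U (G (r * c) (r * s)) /\
  z0 <= pair (Gd (- (r * s)) (r * c) (r * c) (r * s)) (a (G (r * c) (r * s))).

Let y1 x := pair (x - x0) xi1.
Let y2 x := pair (x - x0) xi2.
(** The velocity of the loop, extended to a vector field. *)
Definition loop_field x := Gd (- y2 x) (y1 x) (y1 x) (y2 x).
Definition loop (t : R) := G (r * cos t) (r * sin t).

Let surfB u1 u2 : G u1 u2 - x0 = u1 *: X + u2 *: Y - quad p q s u1 u2 *: Z.
Proof. by apply/matrixP => i j; rewrite !mxE; ring. Qed.

Let y1G u1 u2 : y1 (G u1 u2) = u1.
Proof.
by rewrite /y1 surfB !(pairDl, pairNl, pairZl) X1 Y1 Z1 !mulr0 oppr0 !addr0 mulr1.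
Qed.

Let y2G u1 u2 : y2 (G u1 u2) = u2.
Proof.
by rewrite /y2 surfB !(pairDl, pairNl, pairZl) X2 Y2 Z2 !mulr0 oppr0 !addr0 mulr1 add0r.
Qed.

Lemma loop_fieldE t : loop_field (loop t) =
  Gd (- (r * sin t)) (r * cos t) (r * cos t) (r * sin t).
Proof. by rewrite /loop_field y1G y2G. Qed.

Lemma loop_period : loop 0 = loop (2 * pi).
Proof. by rewrite /loop mulr_natl cos2pi sin2pi cos0 sin0. Qed.

Lemma loop_in t : U (loop t).
Proof. by have [] := est (cos2Dsin2 t). Qed.

Lemma loop_transverse t : z0 <= pair (loop_field (loop t)) (a (loop t)).
Proof. by rewrite loop_fieldE; have [] := est (cos2Dsin2 t). Qed.

Lemma is_derive_loop (t : R) : is_derive t 1 loop (loop_field (loop t)).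
Proof.
rewrite loop_fieldE.
have h1 := der_scale r (is_derive_cos t); have h2 := der_scale r (is_derive_sin t).
apply: is_derive_eq (is_derive_surf x0 X Y Z p q s h1 h2) _.
by rewrite mulrN.
Qed.

Let is_derive_y (xi : 'cV[R]_m) x v : is_derive x v (fun z => pair (z - x0) xi) (pair v xi).
Proof.
have h := der_add (is_derive_linear xi x v) (der_cst x v (- pair x0 xi)).
rewrite (_ : (fun z => _) = (fun z : 'rV[R]_m => (z *m xi) 0 0 + - pair x0 xi)).
  by apply: is_derive_eq h _; rewrite addr0.
by apply/funext => z; rewrite pairDl pairNl.
Qed.

Let g x := (3 - (y1 x * y1 x + y2 x * y2 x) / r ^+ 2) / 2.
(** A polynomial map that fixes the loop and whose differential along it has rank one,
    with image the tangent line. The factor g = (3 - |y|^2 / r^2) / 2 is 1 on the circle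
    and is chosen so that the radial derivative of |y| g is 0 there; the projection to
    the circle itself would need a square root. *)
Definition loop_retract x := G (y1 x * g x) (y2 x * g x).

Let yr t : y1 (loop t) * y1 (loop t) + y2 (loop t) * y2 (loop t) = r ^+ 2.
Proof.
rewrite /loop y1G y2G.
rewrite (_ : _ + _ = r ^+ 2 * (cos t ^+ 2 + sin t ^+ 2)); last by ring.
by rewrite cos2Dsin2 mulr1.
Qed.

Let g1 t : g (loop t) = 1.
Proof.
rewrite /g yr divff; last by rewrite expf_neq0// gt_eqF.
by field.
Qed.

Lemma loop_retractK t : loop_retract (loop t) = loop t.
Proof. by rewrite /loop_retract g1 !mulr1 /loop y1G y2G. Qed.

(** On the circle, the differential of y |-> g y is the projection to the tangent line. *)
Lemma is_derive_loop_retract t v : exists mu : R,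
  is_derive (loop t) v loop_retract (mu *: loop_field (loop t)).
Proof.
set x := loop t.
have d1 := is_derive_y xi1 x v; have d2 := is_derive_y xi2 x v.
set eta1 := pair v xi1 in d1; set eta2 := pair v xi2 in d2.
have dg : is_derive x v g (- (y1 x * eta1 + y2 x * eta2) / r ^+ 2).
  have h := der_add (der_cst x v (3 / 2))
     (der_scale (- (r ^+ 2)^-1 / 2) (der_add (der_mul d1 d1) (der_mul d2 d2))).
  rewrite (_ : g = (fun z => 3 / 2 + - (r ^+ 2)^-1 / 2 * (pair (z - x0) xi1 * pair (z - x0) xi1
     + pair (z - x0) xi2 * pair (z - x0) xi2))).
    by apply: is_derive_eq h _; rewrite /y1 /y2; field; rewrite gt_eqF.
  by apply/funext => z; rewrite /g /y1 /y2; field; rewrite gt_eqF.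
have h := is_derive_surf x0 X Y Z p q s (der_mul d1 dg) (der_mul d2 dg).
exists ((y1 x * eta2 - y2 x * eta1) / r ^+ 2).
apply: is_derive_eq h _.
rewrite -/(y1 x) -/(y2 x) /x g1 -/x !mulr1 /loop_field -dsurfZ.
have rr : r ^+ 2 != 0 by rewrite expf_neq0// gt_eqF.
have yrx := yr t; rewrite -/x in yrx.
have rn : r != 0 by rewrite gt_eqF.
congr (dsurf _ _ _ _ _ _ _ _ _ _); apply: (mulIf rr).
- rewrite [LHS](_ : _ = eta1 * r ^+ 2 - y1 x * (y1 x * eta1 + y2 x * eta2)); last by field.
  rewrite [RHS](_ : _ = - y2 x * (y1 x * eta2 - y2 x * eta1)); last by field.
  by rewrite -yrx; ring.
- rewrite [LHS](_ : _ = eta2 * r ^+ 2 - y2 x * (y1 x * eta1 + y2 x * eta2)); last by field.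
  rewrite [RHS](_ : _ = y1 x * (y1 x * eta2 - y2 x * eta1)); last by field.
  by rewrite -yrx; ring.
Qed.

Let Ck_y k (xi : 'cV[R]_m) : Ck_on k U (fun x => pair (x - x0) xi).
Proof.
have h : Ck_on k U (fun x : 'rV[R]_m => \sum_l (x 0 l - x0 0 l) * xi l 0).
  apply: Ck_sum => // l; apply: Ck_mul => //; last exact: Ck_cst.
  by apply: Ck_sub_fun => //; [exact: Ck_coord|exact: Ck_cst].
apply: Ck_eq h => // x _; rewrite pairE; apply: eq_bigr => l _.
by rewrite !mxE.
Qed.

Let Ck_quad k f h : Ck_on k U f -> Ck_on k U h -> Ck_on k U (fun x => quad p q s (f x) (h x)).
Proof.
move=> Cf Ch; rewrite /quad; apply: Ck_mul => //; last exact: Ck_cst.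
apply: Ck_add => //; first apply: Ck_add => //; apply: Ck_mul => //; try exact: Ck_cst.
all: exact: Ck_mul.
Qed.

Let Ck_dquad k u w f h : Ck_on k U u -> Ck_on k U w -> Ck_on k U f -> Ck_on k U h ->
  Ck_on k U (fun x => dquad p q s (u x) (w x) (f x) (h x)).
Proof.
move=> Cu Cw Cf Ch; rewrite /dquad; apply: Ck_add => //; apply: Ck_mul => //.
all: by apply: Ck_add => //; apply: Ck_mul => //; exact: Ck_cst.
Qed.

Let Ck_field k l : Ck_on k U (fun x => loop_field x 0 l).
Proof.
have h : Ck_on k U (fun x => - y2 x * X 0 l + y1 x * Y 0 l -
   dquad p q s (- y2 x) (y1 x) (y1 x) (y2 x) * Z 0 l).
  have C1 := Ck_y k xi1; have C2 := Ck_y k xi2; have C2' := Ck_opp oU C2.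
  apply: Ck_sub_fun => //; first apply: Ck_add => //; apply: Ck_mul => //; try exact: Ck_cst.
  exact: Ck_dquad.
by apply: Ck_eq h => // x _; rewrite !mxE.
Qed.

Let Ck_retract k l : Ck_on k U (fun x => loop_retract x 0 l).
Proof.
have C1 := Ck_y k xi1; have C2 := Ck_y k xi2.
have Cg : Ck_on k U g.
  apply: Ck_mul => //; last exact: Ck_cst.
  apply: Ck_sub_fun => //; first exact: Ck_cst.
  apply: Ck_mul => //; last exact: Ck_cst.
  by apply: Ck_add => //; exact: Ck_mul.
have C1g := Ck_mul oU C1 Cg; have C2g := Ck_mul oU C2 Cg.
have h : Ck_on k U (fun x => x0 0 l + y1 x * g x * X 0 l + y2 x * g x * Y 0 l -
   quad p q s (y1 x * g x) (y2 x * g x) * Z 0 l).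
  apply: Ck_sub_fun => //; last by apply: Ck_mul => //; [exact: Ck_quad|exact: Ck_cst].
  apply: Ck_add => //; last by apply: Ck_mul => //; exact: Ck_cst.
  apply: Ck_add => //; first exact: Ck_cst.
  by apply: Ck_mul => //; exact: Ck_cst.
by apply: Ck_eq h => // x _; rewrite !mxE.
Qed.

(** kap is a smooth function on the whole chart that is 1 / al along the loop: the step
    function S replaces the denominator by 1 before al can reach 0. *)
Let al x := pair (loop_field x) (a x).
Let S x := step (2 / z0 * al x - 1).
Let kap x := (al x * S x + (1 - S x))^-1.

Let kap_den x : 0 < al x * S x + (1 - S x).
Proof.
have [h|h] := leP (al x) (z0 / 2).
  have -> : S x = 0.
    by apply: step_eq0; rewrite subr_le0 mulrAC ler_pdivrMr// mul1r mulrC -ler_pdivlMr.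
  by rewrite mulr0 add0r subr0.
have al0 : 0 < al x by apply: lt_trans h; rewrite divr_gt0.
have S0 : 0 <= S x := step_ge0 _; have S1 : S x <= 1 := step_le1 _.
have [->|Sn] := eqVneq (S x) 1; first by rewrite mulr1 subrr addr0.
have S1' : 0 < 1 - S x by rewrite subr_gt0 lt_neqAle Sn.
by apply: ltr_wpDl S1'; apply: mulr_ge0 => //; exact: ltW.
Qed.

Let kap_loop t : kap (loop t) * al (loop t) = 1.
Proof.
have h := loop_transverse t; rewrite -/(al _) in h.
have -> : kap (loop t) = (al (loop t))^-1.
  rewrite /kap; have -> : S (loop t) = 1.
    apply: step_eq1; rewrite lerBrDr mulrAC ler_pdivlMr//.
    by rewrite -(natrD _ 1 1) ler_wpM2l.
  by rewrite mulr1 subrr addr0.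
by rewrite mulVf// gt_eqF// (lt_le_trans z00).
Qed.

Let Ck_Om k i l : Ck_on k U (fun x => dmat a x i l).
Proof.
have Ca j : Ck_on k.+1 U (fun x => a x j 0) by have /(Ck_mx _ _ oU) := sa k.+1; exact.
have h : Ck_on k U (fun x => 'D_(delta_mx 0 i) (fun y => a y l 0) x - 'D_(delta_mx 0 l) (fun y => a y i 0) x).
  by apply: Ck_sub_fun => //; [have [_ /(_ i)[]] := Ca l|have [_ /(_ l)[]] := Ca i].
by apply: Ck_eq h => // x _; rewrite mxE.
Qed.

Let Ck_al k : Ck_on k U al.
Proof.
have h : Ck_on k U (fun x => \sum_l loop_field x 0 l * a x l 0).
  apply: Ck_sum => // l; apply: Ck_mul => //.
  by have /(Ck_mx _ _ oU) := sa k; exact.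
by apply: Ck_eq h => // x _; rewrite -pairE.
Qed.

Let Ck_kap k : Ck_on k U kap.
Proof.
have CS : Ck_on k U S.
  apply: Ck_step => //; apply: Ck_sub_fun => //; last exact: Ck_cst.
  by apply: Ck_mul => //; exact: Ck_cst.
have h : Ck_on k U (fun x => al x * S x + (1 - S x)).
  apply: Ck_add => //; first exact: Ck_mul.
  by apply: Ck_sub_fun => //; exact: Ck_cst.
exact: (Ck_comp1 oU smooth1_inv (fun x _ => kap_den x) h).
Qed.

Let F j x := kap x * \sum_l loop_field x 0 l * dmat a x l j.
(** F is the covector d a (W, .) / a(W), with W the extended velocity, and loop_jet is its
    pairing with x - loop_retract x. *)
Definition loop_jet x := \sum_j F j x * (x 0 j - loop_retract x 0 j).

Let Ck_F k j : Ck_on k U (F j).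
Proof.
apply: Ck_mul => //; apply: Ck_sum => // l; exact: Ck_mul.
Qed.

Lemma smooth_loop_jet : smooth_on U loop_jet.
Proof.
move=> k; apply: Ck_sum => // j; apply: Ck_mul => //.
by apply: Ck_sub_fun => //; exact: Ck_coord.
Qed.

Lemma loop_jet0 t : loop_jet (loop t) = 0.
Proof. by rewrite /loop_jet loop_retractK big1// => j _; rewrite subrr mulr0. Qed.

(** Along the loop x - loop_retract x vanishes, so only its differential v - mu W
    contributes, and d a (W, W) = 0 removes mu. *)
Lemma derive_loop_jet t v :
  'D_v loop_jet (loop t) * pair (loop_field (loop t)) (a (loop t)) =
  pair (loop_field (loop t)) (dmat a (loop t) *m v^T).
Proof.
have [mu dpi] := is_derive_loop_retract t v.
have Ut := loop_in t; set x := loop t in Ut dpi *.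
have dpij j : is_derive x v (fun z => loop_retract z 0 j) (mu * loop_field x 0 j).
  case: dpi => d1 d2; split; first by have /derivable_mxP := d1; exact.
  by have := congr1 (fun A : 'rV[R]_m => A 0 j) d2; rewrite (derive_mx d1) !mxE.
have dcoord j : is_derive x v (fun z : 'rV[R]_m => z 0 j) (v 0 j).
  exact: is_derive_entry.
have dF j : is_derive x v (F j) ('D_v (F j) x).
  apply: derivableP; apply: diff_derivable.
  exact: C1_differentiable oU (Ck_F 1 j) Ut.
have dsum j : is_derive x v (fun z => F j z * (z 0 j - loop_retract z 0 j))
   (F j x * (v 0 j - mu * loop_field x 0 j)).
  have h := der_mul (dF j) (is_deriveB (dcoord j) (dpij j)).
  apply: is_derive_eq h _.
  have -> : ((fun z : 'rV[R]_m => z 0 j) - (fun z => loop_retract z 0 j)) x = 0.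
    by rewrite -[LHS]/(x 0 j - loop_retract x 0 j) /x loop_retractK subrr.
  by rewrite mul0r addr0.
have E : 'D_v loop_jet x = \sum_j F j x * (v 0 j - mu * loop_field x 0 j).
  have -> : loop_jet = \sum_j (fun z => F j z * (z 0 j - loop_retract z 0 j)).
    by apply/funext => z; rewrite fct_sumE.
  rewrite derive_sum; last by move=> j; have [] := dsum j.
  by apply: eq_bigr => j _; have [] := dsum j.
have FE (u : 'rV[R]_m) : \sum_j F j x * u 0 j = kap x * pair (loop_field x) (dmat a x *m u^T).
  rewrite /F; under eq_bigr do rewrite -mulrA; rewrite -mulr_sumr; congr (_ * _).
  rewrite /pair mulmxA mxE; apply: eq_bigr => j _; by rewrite !mxE.
rewrite E.
have -> : \sum_j F j x * (v 0 j - mu * loop_field x 0 j) =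
    kap x * pair (loop_field x) (dmat a x *m (v - mu *: loop_field x)^T).
  by rewrite -FE; apply: eq_bigr => j _; rewrite !mxE.
rewrite linearB linearZ /= mulmxBr -scalemxAr pairDr pairNr pairZr.
rewrite (pair_skew _ (dmat_skew a x)) mulr0 oppr0 addr0.
by rewrite mulrAC [kap x * _](kap_loop t) mul1r.
Qed.

End LoopJet.

(** * Naturality of closed Reeb orbits *)

Section Pullback.
Context {R : realType} (m : nat) (M : smoothManifold R m) (alpha : oneForm M).

Lemma diffeo_jacobian_inv (phi : M -> M) i j x : diffeomorphism phi ->
  local_dom phi (chart_of i) (chart_of j) x ->
  exists B : 'M[R]_m, B *m 'J (local_expr phi (chart_of i) (chart_of j)) x = 1%:M.
Proof.
move=> [[cphi sphi] [psi [[cpsi spsi] phiK psiK]]] [tx sx].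
set F := local_expr phi _ _; pose G := local_expr psi (chart_of j) (chart_of i).
set D := local_dom phi (chart_of i) (chart_of j).
set E := local_dom psi (chart_of j) (chart_of i).
have oD : open D by exact: open_local_dom.
have oE : open E by exact: open_local_dom.
have Fx : E (F x).
  split; first exact: to_rV_target.
  by rewrite /F /local_expr to_rVK// phiK; exact: of_rV_source.
have GFx : G (F x) = x by rewrite /G /F /local_expr to_rVK// phiK of_rVK.
have dG : differentiable G (F x) := C1_differentiable_mx oE (spsi j i 1%N) Fx.
have dF : differentiable F x := C1_differentiable_mx oD (sphi i j 1%N) (conj tx sx).
have dFG : differentiable F (G (F x)) by rewrite GFx.
have FGid (v : 'rV[R]_m) : 'D_v (F \o G) (F x) = v.
  rewrite -[RHS](derive_id (F x)).
  apply: near_eq_derive; apply: filterS (open_nbhs_nbhs (conj oE Fx)) => y [ty sy].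
  by rewrite /= /F /G /local_expr to_rVK// psiK of_rVK.
clearbody F G; exists ('J G (F x)); apply/row_matrixP => k; rewrite !rowE.
rewrite mulmxA mulmx1.
have h1 : 'D_(delta_mx 0 k) G (F x) = delta_mx 0 k *m 'J G (F x) := deriveEjacobian _ dG.
rewrite -h1 -(deriveEjacobian _ dF).
have h3 := derive_comp_rV (delta_mx 0 k : 'rV[R]_m) dG dFG.
by rewrite GFx in h3; rewrite -h3 FGid.
Qed.

(** phi maps a velocity w that is Reeb for phi^* alpha = e^g alpha to one that is Reeb for
    alpha. Naturality of d gives the equation after multiplication by the transposed
    Jacobian, which is invertible. *)
Lemma pullback_reeb (phi : M -> M) f i j x (g : 'rV[R]_m -> R) (w : 'rV[R]_m) :
  diffeomorphism phi -> pullback_eq phi alpha f ->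
  local_dom phi (chart_of i) (chart_of j) x ->
  (\forall y \near x, f (of_rV (chart_of i) y) = g y) ->
  w *m dmat (fun y => expR (g y) *: alpha i y) x = 0 ->
  let v := w *m 'J (local_expr phi (chart_of i) (chart_of j)) x in
  v *m dmat (alpha j) (local_expr phi (chart_of i) (chart_of j) x) = 0 /\
  v *m alpha j (local_expr phi (chart_of i) (chart_of j) x) = expR (g x) *: (w *m alpha i x).
Proof.
move=> dphi pe Dx fg wd v.
have [[cphi sphi] _] := dphi.
set F := local_expr phi (chart_of i) (chart_of j) in v *.
set D := local_dom phi (chart_of i) (chart_of j) in Dx.
have oD : open D by exact: open_local_dom.
have nD := open_nbhs_nbhs (conj oD Dx).
have pullE y : D y -> 'J F y *m alpha j (F y) = expR (f (of_rV (chart_of i) y)) *: alpha i y.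
  by move=> Dy; exact: (pe i j y Dy).
split; last first.
  by rewrite /v -mulmxA pullE// (nbhs_singleton fg) scalemxAr.
have dE : 'J F x *m dmat (alpha j) (F x) *m ('J F x)^T = dmat (fun y => expR (g y) *: alpha i y) x.
  rewrite -(dmat_pullback oD (@target_open _ _ _ (chart_of j)) Dx _ (sphi i j 2%N) (form_smooth alpha j 1%N)).
    apply: eq_dmat; apply: filterS2 nD fg => y Dy <-; exact: pullE.
  by move=> y [ty sy]; exact: to_rV_target.
have [B BJ] := diffeo_jacobian_inv dphi Dx.
have JB : ('J F x)^T *m B^T = 1%:M by rewrite -trmx_mul BJ trmx1.
by rewrite -[LHS]mulmx1 -JB mulmxA /v -!(mulmxA w) dE (mulmxA w) wd mul0mx.
Qed.

End Pullback.

Section ReebJet.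
Context {R : realType} (m : nat).

(** d(e^l a) = e^l (d a + d l /\ a) vanishes on (w, v) when d l (v) a(w) = d a (w, v) and
    d l (w) = 0; the second equation is the first one for v = w. *)
Lemma jet_reeb (a : 'rV[R]_m -> 'cV[R]_m) (l : 'rV[R]_m -> R) (c : R) x (w : 'rV[R]_m) :
  differentiable a x -> differentiable l x -> pair w (a x) != 0 ->
  (forall v, 'D_v l x * pair w (a x) = pair w (dmat a x *m v^T)) ->
  w *m dmat (fun y => expR (l y + c) *: a y) x = 0.
Proof.
move=> da dl wa lP.
have dlc : differentiable (fun y => l y + c) x.
  by apply: differentiableD => //; exact: differentiable_cst.
have DE v : 'D_v (fun y => l y + c) x = 'D_v l x.
  have h := der_add (derivableP (diff_derivable (v := v) dl)) (der_cst x v c).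
  by have [_ ->] := h; rewrite addr0.
rewrite (dmat_exp dlc da) -scalemxAr.
suff -> : w *m (dmat a x + (\col_k 'D_(delta_mx 0 k) (fun y => l y + c) x) *m (a x)^T -
    a x *m (\col_k 'D_(delta_mx 0 k) (fun y => l y + c) x)^T) = 0 by rewrite scaler0.
have Dw : 'D_w l x = 0.
  have := lP w; rewrite (pair_skew _ (dmat_skew a x)) => /eqP.
  by rewrite mulf_eq0 (negbTE wa) orbF => /eqP.
pose dg : 'cV[R]_m := \col_k 'D_(delta_mx 0 k) l x.
have -> : \col_k 'D_(delta_mx 0 k) (fun y => l y + c) x = dg.
  by apply/colP => k; rewrite !mxE DE.
have wdg : w *m dg = 0.
  apply/matrixP => k1 k2; rewrite (ord1 k1) (ord1 k2) !mxE -[RHS]Dw (derive_row_sum _ dl).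
  by apply: eq_bigr => k _; rewrite mxE.
rewrite mulmxDr mulmxDr mulmxN !mulmxA wdg mul0mx addr0.
apply/rowP => k; rewrite [LHS]mxE [X in _ + X]mxE.
have -> : (w *m dmat a x) 0 k = 'D_(delta_mx 0 k) l x * pair w (a x).
  by rewrite lP /pair mulmxA trmx_delta -colE [RHS]mxE.
have -> : (w *m a x *m dg^T) 0 k = pair w (a x) * dg k 0.
  by rewrite [LHS]mxE big_ord1 [X in _ * X]mxE.
by rewrite [dg k 0]mxE mulrC subrr mxE.
Qed.

End ReebJet.

Section DualPair.
Context {R : realType} (m : nat).

(** The covectors W (., Y) and - W (., X), corrected by multiples of a so as to vanish
    on Z. *)
Lemma dual_covectors (a : 'cV[R]_m) (W : 'M[R]_m) (X Y Z : 'rV[R]_m) : W^T = - W ->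
  pair X a = 0 -> pair Y a = 0 -> pair Z a = 1 -> pair X (W *m Y^T) = 1 ->
  exists xi1 xi2 : 'cV[R]_m,
    [/\ pair X xi1 = 1, pair Y xi1 = 0 & pair Z xi1 = 0] /\
    [/\ pair X xi2 = 0, pair Y xi2 = 1 & pair Z xi2 = 0].
Proof.
move=> skew Xa Ya Za XY.
exists (W *m Y^T - pair Z (W *m Y^T) *: a).
exists (- (W *m X^T) + pair Z (W *m X^T) *: a).
have YX : pair Y (W *m X^T) = -1 by rewrite pair_trmx skew mulNmx pairNr XY.
split; split; rewrite !(pairDr, pairNr, pairZr) ?Xa ?Ya ?Za ?XY ?YX ?(pair_skew _ skew); ring.
Qed.

End DualPair.

(** * The conformal factor, and the theorem *)

Section Main.
Context {R : realType} (n : nat) (n_gt0 : (0 < n)%N) (M : smoothManifold R n.*2.+1).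
Hypothesis cM : compact [set: M].
Variable alpha : oneForm M.
Hypothesis ctc : contact_form alpha.

Lemma transverse_loop_jet i x0 (rho : R) : 0 < rho ->
  (forall x, `|x - x0| <= rho -> target (chart_of i) x) ->
  exists (gam w : R -> 'rV[R]_(n.*2.+1)) (l : 'rV[R]_(n.*2.+1) -> R) (A : R),
  [/\ smooth_on (target (chart_of i)) l, gam 0 = gam (2 * pi), 0 < A &
   forall t : R, [/\ `|gam t - x0| <= rho, is_derive t 1 gam (w t),
     0 < pair (w t) (alpha i (gam t)) <= A, l (gam t) = 0 &
     forall v, 'D_v l (gam t) * pair (w t) (alpha i (gam t)) =
       pair (w t) (dmat (alpha i) (gam t) *m v^T)]].
Proof.
move=> rho0 tx; pose U := target (chart_of i).
have oU : open U by exact: target_open.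
have tx0 : U x0 by apply: tx; rewrite subrr normr0 ltW.
have vol : wedge (form1 (alpha i x0)) (wedge_pow (form2 (dmat (alpha i) x0)) n)
    (fun l : 'I_(n.*2.+1) => delta_mx 0 l) != 0.
  by rewrite -contact_volumeE//; exact: ctc.
have skew := dmat_skew (alpha i) x0.
have [X [Y [Z [Xa Ya Za XY]]]] := volume_symplectic_pair vol skew n_gt0.
have pXa : pair X (alpha i x0) = 0 by rewrite /pair Xa mxE.
have pYa : pair Y (alpha i x0) = 0 by rewrite /pair Ya mxE.
have pXY : pair X (dmat (alpha i) x0 *m Y^T) = 1 by rewrite /pair mulmxA.
have [r [r0 est]] := loop_estimate oU (form_smooth alpha i) tx0 pXa pYa Za pXY rho0.
have [xi1 [xi2 [[X1 Y1 Z1] [X2 Y2 Z2]]]] := dual_covectors skew pXa pYa Za pXY.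
set p := loop_p (alpha i) x0 X in est.
set q := loop_q (alpha i) x0 X Y in est.
set s := loop_s (alpha i) x0 Y in est.
clearbody p q s.
have z00 : 0 < r ^+ 2 / 4 by rewrite divr_gt0// exprn_gt0.
have est' c t : c ^+ 2 + t ^+ 2 = 1 -> U (surf x0 X Y Z p q s (r * c) (r * t)) /\
  r ^+ 2 / 4 <= pair (dsurf X Y Z p q s (- (r * t)) (r * c) (r * c) (r * t))
    (alpha i (surf x0 X Y Z p q s (r * c) (r * t))).
  by move=> /est[h1 h2 _]; split => //; exact: tx.
exists (loop x0 X Y Z p q s r),
  (fun t => loop_field x0 X Y Z p q s xi1 xi2 (loop x0 X Y Z p q s r t)),
  (loop_jet (alpha i) x0 X Y Z p q s r (r ^+ 2 / 4) xi1 xi2), (r ^+ 2).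
split.
- exact: (smooth_loop_jet x0 X Y Z p q s r xi1 xi2 oU (form_smooth alpha i) z00).
- exact: loop_period.
- exact: exprn_gt0.
move=> t; have [e1 e2 e3] := est _ _ (cos2Dsin2 t).
have fE := loop_fieldE x0 p q s r X1 Y1 Z1 X2 Y2 Z2 t.
split.
- exact: e1.
- exact: (is_derive_loop x0 p q s r X1 Y1 Z1 X2 Y2 Z2).
- by rewrite fE (lt_le_trans z00 e2).
- exact: (loop_jet0 _ x0 p q s _ r0 X1 Y1 Z1 X2 Y2 Z2).
- exact: (derive_loop_jet oU (form_smooth alpha i) r0 z00 X1 Y1 Z1 X2 Y2 Z2 est').
Qed.

(** With f = l + c around the loop and l = 0 on it, the loop is a Reeb loop of
    e^f alpha = phi^* alpha, of speed at most e^c A; phi carries it to one of alpha. *)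
Lemma reeb_loop_image (phi : M -> M) f i x0 (rho d A c : R)
    (gam w : R -> 'rV[R]_(n.*2.+1)) (l : 'rV[R]_(n.*2.+1) -> R) :
  diffeomorphism phi -> pullback_eq phi alpha f ->
  smooth_on (target (chart_of i)) l -> gam 0 = gam (2 * pi) -> rho < d ->
  (forall x, `|x - x0| < d -> target (chart_of i) x /\ f (of_rV (chart_of i) x) = l x + c) ->
  (forall t : R, [/\ `|gam t - x0| <= rho, is_derive t 1 gam (w t),
     0 < pair (w t) (alpha i (gam t)) <= A, l (gam t) = 0 &
     forall v, 'D_v l (gam t) * pair (w t) (alpha i (gam t)) =
       pair (w t) (dmat (alpha i) (gam t) *m v^T)]) ->
  reeb_loop alpha (2 * pi) (expR c * A) (fun t => phi (of_rV (chart_of i) (gam t))).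
Proof.
move=> dphi pe sl gper rd fl gP.
have [[cphi sphi] _] := dphi.
have oU := @target_open _ _ _ (chart_of i).
have tg t : target (chart_of i) (gam t).
  by have [g1 _ _ _ _] := gP t; have [] := fl _ (le_lt_trans g1 rd).
split; first by rewrite gper.
  move=> t; apply: (@continuous_comp _ _ _ (of_rV (chart_of i) \o gam) phi); last exact: cphi.
  apply: continuous_comp; last exact: of_rV_continuous.
  by have [_ [dg _] _ _ _] := gP t; apply: differentiable_continuous; apply/derivable1_diffP.
move=> t j st; have [g1 dg /andP[g2 g3] g4 g5] := gP t.
have Dx : local_dom phi (chart_of i) (chart_of j) (gam t) by split.
have oD : open (local_dom phi (chart_of i) (chart_of j)) by exact: open_local_dom.
have dF := C1_differentiable_mx oD (sphi i j 1%N) Dx.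
have nfl : \forall y \near gam t, f (of_rV (chart_of i) y) = l y + c.
  have ob : nbhs (gam t) [set y | `|y - x0| < d].
    apply/nbhs_ballP; exists (d - `|gam t - x0|); first by rewrite /= subr_gt0 (le_lt_trans g1).
    move=> y; rewrite -ball_normE /ball_ /= distrC ltrBrDr => yd.
    by rewrite (le_lt_trans _ yd)// ler_distD.
  by apply: filterS ob => y /fl[].
have wd : w t *m dmat (fun y => expR (l y + c) *: alpha i y) (gam t) = 0.
  apply: jet_reeb => //; last by rewrite gt_eqF.
    exact: C1_differentiable_mx oU (form_smooth alpha i 1%N) (tg t).
  exact: C1_differentiable oU (sl 1%N) (tg t).
have [v1 v2] := pullback_reeb dphi pe Dx nfl wd.
exists (w t *m 'J (local_expr phi (chart_of i) (chart_of j)) (gam t)).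
have vE : (w t *m 'J (local_expr phi (chart_of i) (chart_of j)) (gam t) *m
    alpha j (local_expr phi (chart_of i) (chart_of j) (gam t))) 0 0 =
    expR c * pair (w t) (alpha i (gam t)).
  by rewrite v2 g4 add0r mxE.
split.
- by have := is_derive_curve dg dF; rewrite deriveEjacobian.
- exact: v1.
- by rewrite [X in 0 < X]vE mulr_gt0// expR_gt0.
- by rewrite [X in X <= _]vE ler_wpM2l// expR_ge0.
Qed.

(** The constraint is linear in u = e^((n + 1) f), and u is sought in the form
    kap^(n + 1) e^((n + 1) l) chi + sg (1 - chi), with chi a bump function that is 1 near
    the loop. For kap small the first term has less than the prescribed volume, and the
    constant sg > 0 makes up for the rest; there f = l + ln kap near the loop. *)
Lemma exists_conformal_factor i x0 (rho e : R) (l : 'rV[R]_(n.*2.+1) -> R) :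
  0 < rho -> 0 < e -> (forall x, `|x - x0| <= 3 * rho -> target (chart_of i) x) ->
  smooth_on (target (chart_of i)) l ->
  exists (c : R) (f : M -> R), [/\ expR c <= e, smooth_fun f,
    average_value_constraint alpha f &
    forall x, `|x - x0| <= rho -> f (of_rV (chart_of i) x) = l x + c].
Proof.
move=> rho0 e0 tx sl; pose U := target (chart_of i).
have oU : open U by exact: target_open.
pose chi : M -> R := chart_bump i x0 rho.
have schi : smooth_fun chi by exact: smooth_chart_bump.
pose k : R := n.+1%:R; have k0 : 0 < k by rewrite ltr0n.
have tx2 x : `|x - x0| <= 2 * rho -> U x.
  by move=> xr; apply: tx; apply: le_trans xr _; rewrite ler_wpM2r ?ler_nat// ltW.
pose E : M -> R := zero_ext i (fun x => expR (k * l x) * bump x0 rho x).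
have sE : smooth_fun E.
  apply: (smooth_zero_ext (@compact_cball R _ x0 (2 * rho))); first exact: tx2.
    by move=> x _ /negP; rewrite -ltNge => /ltW h; rewrite bump_eq0// mulr0.
  move=> j; apply: Ck_mul => //; last exact: Ck_bump.
  apply: (Ck_comp1 oU smooth1_expR) => //.
  by apply: Ck_mul => //; exact: Ck_cst.
have E0 p : 0 <= E p.
  by rewrite /E /zero_ext patchE; case: ifP => //= _; rewrite mulr_ge0 ?expR_ge0 ?bump_ge0.
pose b p := 1 + (-1) * chi p.
have sb : smooth_fun b.
  by apply: smooth_fun_add; [exact: smooth_fun_cst|apply: smooth_fun_mul => //; exact: smooth_fun_cst].
have b0 p : 0 <= b p by rewrite /b mulN1r subr_ge0; exact: chart_bump_le1.
have [N [ii [rh pu]]] := exists_partition_of_unity cM.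
pose I := pu_integral alpha ii rh.
have s1 : smooth_fun (fun _ : M => 1 : R) by exact: smooth_fun_cst.
have I1 : 0 < I (fun=> 1).
  apply: (pu_integral_gt0 (p0 := of_rV (chart_of i) x0) cM pu ctc s1) => //.
have Ib : 0 < I b.
  pose x1 := x0 + (2 * rho) *: delta_mx 0 ord0.
  have x1d : `|x1 - x0| = 2 * rho.
    rewrite /x1 addrC addKr normrZ gtr0_norm ?mulr_gt0//.
    rewrite (_ : `|_| = 1) ?mulr1//; apply/eqP; rewrite eq_le norm_delta_le /=.
    by have := norm_coord_le (delta_mx 0 ord0 : 'rV[R]_(n.*2.+1)) 0 ord0; rewrite mxE !eqxx normr1.
  apply: (pu_integral_gt0 (p0 := of_rV (chart_of i) x1) cM pu ctc sb) => //.
  have tx1 : U x1 by apply: tx2; rewrite x1d.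
  by rewrite /b /chi /chart_bump zero_ext_chart// bump_eq0 ?x1d// mulr0 addr0.
have IE : 0 <= I E by apply: pu_integral_ge0 pu _ _.
pose kap := Num.min (Num.min 1 e) (I (fun=> 1) / (I E + 1)).
have IE1 : 0 < I E + 1 by rewrite ltr_wpDl.
have kap0 : 0 < kap by rewrite !lt_min ltr01 e0 divr_gt0.
have kap1 : kap <= 1 by rewrite !ge_min lexx.
have kape : kap <= e by rewrite !ge_min lexx orbT.
have kapI : kap * I E < I (fun=> 1).
  have : kap <= I (fun=> 1) / (I E + 1) by rewrite !ge_min lexx !orbT.
  rewrite ler_pdivlMr// mulrDr mulr1 => h; apply: lt_le_trans h.
  by rewrite ltrDl.
have kapn : kap ^+ n.+1 * I E < I (fun=> 1).
  apply: le_lt_trans kapI; rewrite ler_wpM2r// exprS ler_piMr ?(ltW kap0)//.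
  by rewrite exprn_ile1// ltW.
pose sg := (I (fun=> 1) - kap ^+ n.+1 * I E) / I b.
have sg0 : 0 < sg by rewrite divr_gt0// subr_gt0.
pose u p := kap ^+ n.+1 * E p + sg * b p.
have u0 p : 0 < u p.
  rewrite /u; have [b0'|bn] := eqVneq (b p) 0; last first.
    apply: ltr_wpDl; first by rewrite mulr_ge0// exprn_ge0// ltW.
    by rewrite mulr_gt0// lt_def bn b0.
  have chi1 : chi p = 1.
    by move: b0'; rewrite /b mulN1r => /eqP; rewrite subr_eq0 => /eqP ->.
  rewrite b0' mulr0 addr0 mulr_gt0 ?exprn_gt0//.
  move: chi1; rewrite /chi /chart_bump /E /zero_ext !patchE; case: ifP => /= _.
    by move=> ->; rewrite mulr1 expR_gt0.
  by move/esym/eqP; rewrite oner_eq0.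
have su : smooth_fun u.
  by apply: smooth_fun_add; apply: smooth_fun_mul => //; exact: smooth_fun_cst.
exists (ln kap), (fun p => k^-1 * ln (u p)); split.
- by rewrite lnK ?posrE.
- apply: smooth_fun_mul; first exact: smooth_fun_cst.
  exact: (smooth_fun_comp1 smooth1_ln u0).
- exists (I (fun=> 1)); split; last exact: contact_integralE.
  have -> : I (fun=> 1) = I u.
    have -> : I u = kap ^+ n.+1 * I E + sg * I b := pu_integral_linear alpha cM pu _ _ sE sb.
    by rewrite /sg divfK ?gt_eqF// addrC subrK.
  have -> : (fun p => expR (n.+1%:R * (k^-1 * ln (u p)))) = u.
    by apply/funext => p; rewrite mulrA divff ?gt_eqF// mul1r lnK ?posrE.
  exact: contact_integralE.
- move=> x xr; have Ux : U x.
    by apply: tx2; apply: le_trans xr _; rewrite ler_peMl ?ler1n// ltW.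
  have chi1 : chi (of_rV (chart_of i) x) = 1.
    by rewrite /chi /chart_bump zero_ext_chart// bump_eq1.
  have Ex : E (of_rV (chart_of i) x) = expR (k * l x).
    by rewrite /E zero_ext_chart// bump_eq1// mulr1.
  rewrite /u /b chi1 Ex mulr1 subrr mulr0 addr0.
  rewrite lnM ?posrE ?exprn_gt0 ?expR_gt0// expRK lnXn//.
  by rewrite -mulr_natl -/k mulrDr !mulrA mulVf ?gt_eqF// !mul1r addrC.
Qed.

End Main.

Theorem theorem3 (R : realType) (n : nat) (n_gt0 : (0 < n)%N)
    (M : smoothManifold R n.*2.+1)
    (M_nonempty : [set: M] !=set0) (M_closed : compact [set: M])
    (alpha : oneForm M) (alpha_contact : contact_form alpha) :
  ~ maximal_orbit alpha.
Proof.
move=> max; have [p0 _] := M_nonempty.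
have [i [rho [rho0 sp tx]]] := chart_ball p0.
set x0 := to_rV (chart_of i) p0 in tx.
have rho20 : 0 < rho / 2 by rewrite divr_gt0.
have rho2 : rho / 2 < rho by rewrite ltr_pdivrMr// ltr_pMr// ltr1n.
have tx1 x : `|x - x0| <= rho -> target (chart_of i) x.
  by move=> xr; apply: tx; apply: le_trans xr _; rewrite ler_peMl ?ler1n// ltW.
have tx2 x : `|x - x0| <= rho / 2 -> target (chart_of i) x.
  by move=> xr; apply: tx1; apply: le_trans xr _; exact: ltW.
have [gam [w [l [A [sl gper A0 gP]]]]] := transverse_loop_jet n_gt0 alpha_contact rho20 tx2.
have pi2 : 0 < 2 * pi :> R by rewrite mulr_gt0// pi_gt0.
have [e e0 noloop] := no_short_reeb_loop M_closed alpha_contact pi2.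
have eA0 : 0 < e / A by rewrite divr_gt0.
have [c [f [ce sf avg fl]]] := exists_conformal_factor M_closed alpha_contact rho0 eA0 tx sl.
have : C_plus alpha f by rewrite max; split.
move=> [_ [phi [[dphi _] pe]]].
have fl' x : `|x - x0| < rho -> target (chart_of i) x /\ f (of_rV (chart_of i) x) = l x + c.
  by move=> /ltW xr; split; [exact: tx1|exact: fl].
have loopP := reeb_loop_image dphi pe sl gper rho2 fl' gP.
apply: noloop (reeb_loop_le _ loopP).
by rewrite -ler_pdivlMr.
Qed.
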